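(* The following decision problem (UNION OF TWO FORESTS $3$-CHOOSABILITY) is $\Pi_2^p$-complete: given two forests $F_1$ and $F_2$ with $V(F_1)=V(F_2)$, decide whether the union of $F_1$ and $F_2$ (the graph on vertex set $V(F_1)$ with edge set $E(F_1)\cup E(F_2)$) is $3$-choosable.
   Context: All graphs are finite, undirected and simple. A graph $G=(V,E)$ is $k$-choosable if for every assignment of sets $S(v)\subseteq\mathbb{Z}$ with $|S(v)|=k$ for all $v\in V$, there is a proper vertex coloring $c:V\to\mathbb{Z}$ with $c(v)\in S(v)$ for all $v$. $\Pi_2^p$ is the second level of the polynomial hierarchy, and completeness is with respect to polynomial-time many-one reductions. *)

(* Defs.v *)
From mathcomp Require Import all_boot all_order all_algebra finmap.

Set Implicit Arguments.
Unset Strict Implicit.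
Unset Printing Implicit Defensive.

Record sgraph (V : finType) := SGraph {
  adj :> rel V;
  adj_sym : symmetric adj;
  adj_irr : irreflexive adj
}.

Section Union.
Variables (V : finType) (G H : sgraph V).

Definition union_adj : rel V := fun u v => G u v || H u v.

Lemma union_adj_sym : symmetric union_adj.
Proof. by move=> u v; rewrite /union_adj adj_sym [H u v]adj_sym. Qed.

Lemma union_adj_irr : irreflexive union_adj.
Proof. by move=> u; rewrite /union_adj !adj_irr. Qed.

Definition graph_union : sgraph V := SGraph union_adj_sym union_adj_irr.

End Union.

(* The bound 2 is there because [ucycle] also holds of [::] and, for every edge
   uv, of the back-and-forth walk [:: u; v]. *)
Definition is_forest (V : finType) (G : sgraph V) : Prop :=
  forall c : seq V, ucycle G c -> size c <= 2.

Definition choosable (k : nat) (V : finType) (G : sgraph V) : Prop :=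
  forall S : V -> {fset int}, (forall v, #|` S v| = k) ->
  exists c : V -> int,
    (forall v, c v \in S v) /\ (forall u v, G u v -> c u != c v).

Definition word := seq bool.

Inductive move := MoveLeft | Stay | MoveRight.

(* A two-way infinite tape with all but finitely many cells blank: the cells to
   the left of the head (nearest first), the scanned cell, and the cells to its
   right (nearest first). Cells outside of both lists are blank. *)
Record tape (A : Type) := Tape { cells_left : seq A; scanned : A; cells_right : seq A }.

Definition tape_move (A : Type) (blank : A) (m : move) (t : tape A) : tape A :=
  let: Tape l a r := t in
  match m with
  | MoveLeft => Tape (behead l) (head blank l) (a :: r)
  | Stay => t
  | MoveRight => Tape (a :: l) (head blank r) (behead r)
  end.

Definition tape_write (A : Type) (a : A) (t : tape A) : tape A :=
  Tape (cells_left t) a (cells_right t).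

(* The tape alphabet over the work symbols W: [None] is the blank,
   [Some (inl b)] is the input/output bit b. *)
Definition symbol (W : finType) : finType := option (bool + W).

Record machine := Machine {
  tm_tapes : nat; (* the machine has tm_tapes.+1 tapes, hence at least one *)
  tm_work : finType;
  tm_state : finType;
  tm_start : tm_state;
  tm_halt : pred tm_state;
  tm_trans : tm_state -> {ffun 'I_tm_tapes.+1 -> symbol tm_work} ->
    tm_state * ('I_tm_tapes.+1 -> symbol tm_work * move)
}.

Section Semantics.
Variable M : machine.

Record config := Config {
  cstate : tm_state M;
  ctape : 'I_(tm_tapes M).+1 -> tape (symbol (tm_work M))
}.

Definition bit_symbol (b : bool) : symbol (tm_work M) := Some (inl b).

Definition tape_of (w : word) : tape (symbol (tm_work M)) :=
  let s := map bit_symbol w in Tape [::] (head None s) (behead s).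

(* The i-th input word is written on the i-th tape, with the head on its first
   letter; the tapes beyond the last input are blank. (A machine with fewer
   tapes than inputs does not see the extra inputs.) *)
Definition init (xs : seq word) : config :=
  Config (tm_start M) (fun i => tape_of (nth [::] xs i)).

Definition halted (c : config) : bool := tm_halt (cstate c).

(* A halted configuration is a fixed point of [step], so that [iter t step]
   reaches a halted configuration iff the machine halts within t steps. *)
Definition step (c : config) : config :=
  if halted c then c else
  let: (q, act) := tm_trans (cstate c) [ffun i => scanned (ctape c i)] in
  Config q (fun i => tape_move None (act i).2 (tape_write (act i).1 (ctape c i))).

Fixpoint read_bits (s : seq (symbol (tm_work M))) : word :=
  if s is Some (inl b) :: s' then b :: read_bits s' else [::].

(* The output is the longest bit string that starts at the head of tape 0. *)
Definition output (c : config) : word :=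
  read_bits (scanned (ctape c ord0) :: cells_right (ctape c ord0)).

Definition outputs_within (t : nat) (xs : seq word) (w : word) : Prop :=
  let c := iter t step (init xs) in halted c /\ output c = w.

End Semantics.

Definition polytime_fun (f : word -> word) : Prop :=
  exists (M : machine) (p : {poly nat}), forall x : word,
    outputs_within M p.[size x]%R [:: x] (f x).

Definition polytime_rel (R : word -> word -> word -> bool) : Prop :=
  exists (M : machine) (p : {poly nat}), forall x y z : word,
    outputs_within M p.[(size x + size y + size z)%N]%R [:: x; y; z] [:: R x y z].

Definition language := word -> Prop.

(* The alternating-quantifier form of Pi_2^p: for all y there is a z, of
   polynomial length, such that a polynomial-time predicate holds. *)
Definition in_Pi2p (L : language) : Prop :=
  exists (R : word -> word -> word -> bool) (p : {poly nat}),
    polytime_rel R /\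
    forall x : word,
      L x <-> (forall y : word, size y = p.[size x]%R ->
               exists2 z : word, size z = p.[size x]%R & R x y z).

Definition reduces (A B : language) : Prop :=
  exists f : word -> word, polytime_fun f /\ forall x, A x <-> B (f x).

Definition Pi2p_complete (L : language) : Prop :=
  in_Pi2p L /\ forall A : language, in_Pi2p A -> reduces A L.

Definition adjacency_bits (n : nat) (G : sgraph 'I_n) : word :=
  [seq G u v | u <- enum 'I_n, v <- enum 'I_n].

(* The number of vertices in unary, followed by the two adjacency matrices. *)
Definition encode (n : nat) (F1 F2 : sgraph 'I_n) : word :=
  nseq n true ++ false :: adjacency_bits F1 ++ adjacency_bits F2.

(* Up to renaming, the common vertex set of the two forests is {0, ..., n-1}.
   Words that do not encode a pair of forests are not in the language. *)
Definition union_of_two_forests_3_choosability : language := fun x =>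
  exists (n : nat) (F1 F2 : sgraph 'I_n),
    [/\ x = encode F1 F2, is_forest F1, is_forest F2 &
        choosable 3 (graph_union F1 F2)].

(* Main.v *)
(** Membership: the universal player names the lists, within a palette of three
    colours per input bit, and the existential player answers with a colouring
    and with a ranking of the vertices of each graph by depth, which certifies
    that the graph is a forest.

    Hardness: the tableau of a run of a machine on x, y, z, with cells addressed
    relative to the heads, is derived by Horn clauses. Hence x belongs to a
    Pi_2^p language iff, however the bits of y are chosen, the bits of z can be
    chosen so that some set of facts is closed under the clauses, contains the
    facts about the initial configuration and contains no fact saying that the
    machine rejects. This game becomes a graph in which a derived fact is a
    forced colour.
    - A triangle attached to u, to t and to the root forbids, for the worst
      lists, exactly one pair of colours of (u, t); it carries a signal from u
      to t.
    - A gate is an edge ab with two pages, vertices adjacent to both a and b.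
      If one end keeps three colours and the other one two, the edge has at
      least three colourings, so that both pages can avoid their signal. Pages
      are forced only if both ends lose a colour: if b is attached to the root
      the gate is the disjunction of the signals at a, and if b is attached to a
      wire it is a conjunction.
    - In a 4-cycle attached to the root, the lists choose which one of two
      opposite vertices emits a signal; in an edge attached to the root, the
      colouring chooses.
    The lists of a copy of this graph are adapted to one colour of the root, and
    three copies share the root. Every edge joins a vertex to one of its at most
    two parents, one for each forest. *)

(* The machine model is concrete, so polynomial time is obtained by compiling arithmetic terms whose
   only iteration is a bounded sum. For this reason facts, vertices and certificates are numbered in
   mixed radix and all their data are computed by division.

   Two limits shape the graph. A vertex has only two parents, so a disjunction with many inputs is
   spread over a cycle of gates. A signal may circulate there without an origin; this is harmless,
   because the game asks for some closed set of facts, not for the least one. And a page can be kept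
   from emitting into one wire only, because for arbitrary lists the emitting colour differs from
   wire to wire; hence each premise of each rule has a page of its own, a rule must not use a fact
   twice, and rules with one real premise get a dummy second one.

   An edge to the root costs a vertex a colour only if its list contains the colour of the root. The
   root has three possible colours, so the worst lists prepare one copy for each of them, and the
   copy that matches is the one from which a model is read. Conversely, arbitrary lists may impose a
   different choice of y in each copy. *)
From mathcomp Require Import all_boot all_order all_algebra finmap zify.
From Stdlib Require Import FunctionalExtensionality IndefiniteDescription.
Require Import Defs.

Set Implicit Arguments.
Unset Strict Implicit.
Unset Printing Implicit Defensive.

(** * Programs for machines *)

Section TapePrograms.

Variable k : nat.

Definition sym : Type := symbol unit.
Definition bsym (b : bool) : sym := Some (inl b).
Definition marker : sym := Some (inr tt).

Definition scan := {ffun 'I_k.+1 -> symbol unit}.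
Definition action := 'I_k.+1 -> symbol unit * move.
Definition tapes := 'I_k.+1 -> tape (symbol unit).

Inductive cmd :=
| Act of scan -> action
| Seq of cmd & cmd
| While of pred scan & cmd.

Definition scan_of (T : tapes) : scan := [ffun i => scanned (T i)].

Definition do_act (a : action) (T : tapes) : tapes :=
  fun i => tape_move None (a i).2 (tape_write (a i).1 (T i)).

Definition idle (sc : scan) : action := fun i => (sc i, Stay).

Lemma do_idle T : do_act (idle (scan_of T)) T = T.
Proof.
by apply: functional_extensionality => i; rewrite /do_act /= ffunE; case: (T i).
Qed.

(** The last index counts machine steps exactly: each test of a loop condition is a step of its own,
    in which the tapes stay as they are. *)
Inductive runs : cmd -> tapes -> tapes -> nat -> Prop :=
| RunsAct f T : runs (Act f) T (do_act (f (scan_of T)) T) 1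
| RunsSeq c1 c2 T1 T2 T3 t1 t2 :
    runs c1 T1 T2 t1 -> runs c2 T2 T3 t2 -> runs (Seq c1 c2) T1 T3 (t1 + t2)
| RunsStop (b : pred scan) c T : ~~ b (scan_of T) -> runs (While b c) T T 1
| RunsLoop (b : pred scan) c T1 T2 T3 t1 t2 : b (scan_of T1) ->
    runs c T1 T2 t1 -> runs (While b c) T2 T3 t2 ->
    runs (While b c) T1 T3 (1 + t1 + t2).

Fixpoint clen (c : cmd) : nat :=
  match c with
  | Act _ => 1
  | Seq c1 c2 => clen c1 + clen c2
  | While _ c => (clen c).+1
  end.

(* Program counters [l, l + clen c) belong to [c]; its exit is [m]. *)
Fixpoint ctrans (c : cmd) (l m pc : nat) (sc : scan) : nat * action :=
  match c with
  | Act f => (m, f sc)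
  | Seq c1 c2 =>
      if pc < l + clen c1 then ctrans c1 l (l + clen c1) pc sc
      else ctrans c2 (l + clen c1) m pc sc
  | While b c =>
      if pc == l then (if b sc then l.+1 else m, idle sc)
      else ctrans c l.+1 l pc sc
  end.

Definition cmachine (c : cmd) : machine :=
  @Machine k unit 'I_(clen c).+1 ord0 (fun q => (q : nat) == clen c)
    (fun q sc => let r := ctrans c 0 (clen c) q sc in (inord r.1, r.2)).

Definition cstep C := @step (cmachine C).
Definition cconf C (l : nat) (T : tapes) : config (cmachine C) :=
  @Config (cmachine C) (inord l) T.

Lemma cstepE C l T : l < clen C ->
  cstep (cconf C l T) =
  let r := ctrans C 0 (clen C) l (scan_of T) in cconf C r.1 (do_act r.2 T).
Proof.
move=> ltlC; rewrite /cstep /step /halted /= inordK ?(ltnW ltlC) // 1?ltnW //.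
by rewrite ltn_eqF.
Qed.

(** The induction needs a command placed inside a larger program, at some address and with some
    exit, because the parts of a sequence or of a loop run there. Only agreement of the two
    transition tables on the addresses of [c] is assumed. *)
Lemma runs_iter C c T T' t : runs c T T' t -> forall l m,
  (forall pc sc, l <= pc < l + clen c ->
     ctrans C 0 (clen C) pc sc = ctrans c l m pc sc) ->
  l + clen c <= clen C ->
  iter t (@cstep C) (cconf C l T) = cconf C m T'.
Proof.
elim=> {c T T' t}.
- move=> f T l m agree leC /=; rewrite cstepE; last by rewrite -addn1.
  by rewrite agree //= leqnn addn1 ltnSn.
- move=> c1 c2 T1 T2 T3 t1 t2 _ IH1 _ IH2 l m agree leC.
  rewrite addnC iterD (IH1 l (l + clen c1)); first last.
  + by apply: leq_trans leC; rewrite /= addnA leq_addr.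
  + move=> pc sc /andP[lp pl]; rewrite agree /= ?pl // lp /=.
    by apply: leq_trans pl _; rewrite addnA leq_addr.
  apply: IH2; last by move: leC; rewrite /= addnA.
  move=> pc sc /andP[lp pl]; rewrite agree /=; last first.
    by rewrite addnA pl (leq_trans _ lp) // leq_addr.
  by rewrite ltnNge lp.
- move=> b c T nb l m agree leC /=; rewrite cstepE; last first.
    by apply: leq_trans leC; rewrite /= -addn1 leq_add2l.
  rewrite agree /= ?leqnn ?addnS ?ltnS ?leq_addr // eqxx (negbTE nb) /=.
  by rewrite do_idle.
- move=> b c T1 T2 T3 t1 t2 bT _ IH1 _ IH2 l m agree leC.
  have ltlC : l < clen C by apply: leq_trans leC; rewrite /= addnS ltnS leq_addr.
  rewrite -addnA addnC iterD [t1 + t2]addnC iterD [iter 1 _ _]/= cstepE //.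
  rewrite agree /= ?leqnn ?addnS ?ltnS ?leq_addr // eqxx bT /= do_idle.
  rewrite (IH1 l.+1 l); first exact: IH2.
  + move=> pc sc /andP[lp pl]; rewrite agree /=; last first.
      by rewrite (ltnW lp) addnS.
    by rewrite gtn_eqF.
  + by move: leC; rewrite /= addnS addSn.
Qed.

Lemma runs_halts C T T' t n : runs C T T' t -> t <= n ->
  iter n (@cstep C) (cconf C 0 T) = cconf C (clen C) T' /\
  halted (cconf C (clen C) T').
Proof.
move=> rC le_t_n.
have hl: halted (cconf C (clen C) T') by rewrite /halted /= inordK.
split=> //; rewrite -(subnK le_t_n) iterD (runs_iter rC (m := clen C)) //.
by elim: (n - t) => //= j ->; rewrite /cstep /step hl.
Qed.

(** * Tapes as unary counters and as pointers into words *)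

Section Counters.

Variable inp : nat -> word.

(* A counter of value [v]: the origin carries the marker, the head is [v] cells
   to the right of it. The word [inp r] is written to the right of the origin of
   counter [r], so that its letter number [i] is scanned at the value [i.+1]. *)
Definition content (w : word) (i : nat) : sym := nth None (marker :: map bsym w) i.

Definition rep_counter (w : word) (v : nat) (t : tape sym) : Prop :=
  [/\ scanned t = content w v,
      forall i, nth None (cells_right t) i = content w (v + i.+1) &
      forall i, nth None (cells_left t) i =
                if i < v then content w (v - i.+1) else None].

(** The head rests on the blank to the left of the word, so that writing a letter and moving left
    puts the letter in front. *)
Definition rep_output (o : word) (t : tape sym) : Prop :=
  [/\ scanned t = None,
      forall i, nth None (cells_right t) i = nth None (map bsym o) i &
      forall i, nth None (cells_left t) i = None].

Definition store := ((nat -> nat) * word)%type.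

Definition rep (s : store) (T : tapes) : Prop :=
  forall i : 'I_k.+1, if i == 0 :> nat then rep_output s.2 (T i)
                      else rep_counter (inp i) (s.1 i) (T i).

Definition does (c : cmd) (s s' : store) (n : nat) : Prop :=
  forall T, rep s T -> exists T' t, [/\ t <= n, runs c T T' t & rep s' T'].

Definition upd (rho : nat -> nat) (r v : nat) : nat -> nat :=
  fun i => if i == r then v else rho i.

Lemma updE rho r v i : upd rho r v i = if i == r then v else rho i.
Proof. by []. Qed.

Lemma does_le c s s' n n' : does c s s' n -> n <= n' -> does c s s' n'.
Proof.
move=> dc nn' T /dc[T' [t [tn rc rT']]]; exists T', t; split=> //.
exact: leq_trans nn'.
Qed.

Lemma does_seq c1 c2 s1 s2 s3 n1 n2 :
  does c1 s1 s2 n1 -> does c2 s2 s3 n2 -> does (Seq c1 c2) s1 s3 (n1 + n2).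
Proof.
move=> d1 d2 T /d1[T1 [t1 [le1 r1 /d2[T2 [t2 [le2 r2 rT]]]]]].
by exists T2, (t1 + t2); split; rewrite ?leq_add //; apply: RunsSeq r1 r2.
Qed.

Definition reads (p : pred sym) (r : nat) : pred scan := fun sc => p (sc (inord r)).

Lemma readsE (p : pred sym) r s T : 0 < r <= k -> rep s T ->
  reads p r (scan_of T) = p (content (inp r) (s.1 r)).
Proof.
move=> /andP[r0 rk] /(_ (inord r)).
by rewrite /reads ffunE !inordK ?ltnS // gtn_eqF // => -[->].
Qed.

(** [F] is the invariant in closed form: the store after [i] rounds. In the bound, [b.+1] pays for a
    round and the test before it, and the last [.+1] for the failing test. *)
Lemma does_while (p : pred sym) r c (F : nat -> store) n b : 0 < r <= k ->
  (forall i, i < n -> p (content (inp r) ((F i).1 r))) ->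
  ~~ p (content (inp r) ((F n).1 r)) ->
  (forall i, i < n -> does c (F i) (F i.+1) b) ->
  does (While (reads p r) c) (F 0) (F n) (n * b.+1).+1.
Proof.
move=> rk; elim: n F => [|n IHn] F pF npF dF T rT.
  by exists T, 1; split=> //; apply: RunsStop; rewrite (readsE p rk rT).
have [T1 [t1 [le1 r1 rT1]]] := dF 0 isT T rT.
have [| | |T2 [t2 [le2 r2 rT2]]] := IHn (fun i => F i.+1) _ _ _ T1 rT1.
- by move=> i; apply: (pF i.+1).
- by [].
- by move=> i; apply: (dF i.+1).
exists T2, (1 + t1 + t2); split=> //; first by lia.
by apply: RunsLoop r1 r2; rewrite (readsE p rk rT) pF.
Qed.

Definition nonzero : pred sym := fun a => a != marker.

Lemma nonzeroE w v : nonzero (content w v) = (v != 0).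
Proof.
case: v => [|v] //; rewrite /nonzero /content /=.
by elim: w v => [|b w IHw] [|v] //=; rewrite ?nth_nil.
Qed.

Definition loop r c := While (reads nonzero r) c.

Lemma does_loop r c (F : nat -> store) n b : 0 < r <= k ->
  (forall i, i <= n -> (F i).1 r = n - i) ->
  (forall i, i < n -> does c (F i) (F i.+1) b) ->
  does (loop r c) (F 0) (F n) (n * b.+1).+1.
Proof.
move=> rk Fr dF; apply: does_while => // [i ltin|].
  by rewrite nonzeroE Fr ?(ltnW ltin) // subn_eq0 -ltnNge.
by rewrite nonzeroE Fr // subnn.
Qed.

Definition moving (d : nat) (m : scan -> move) : cmd :=
  Act (fun sc i => (sc i, if i == d :> nat then m sc else Stay)).

Lemma rep_stay T (i : 'I_k.+1) :
  tape_write (scan_of T i) (T i) = T i.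
Proof. by rewrite ffunE; case: (T i). Qed.

Definition inc_if (p : pred sym) r d :=
  moving d (fun sc => if reads p r sc then MoveRight else Stay).
Definition inc d := inc_if predT d d.
Definition dec d := moving d (fun sc => if reads nonzero d sc then MoveLeft else Stay).

Lemma rep_counter_right w v t : rep_counter w v t ->
  rep_counter w v.+1 (tape_move None MoveRight (tape_write (scanned t) t)).
Proof.
case: t => l a r [/= sa sr sl]; split => /=.
- by rewrite -nth0 sr addn1.
- by move=> i; rewrite nth_behead sr !addnS addSn.
- case=> [|i] /=; first by rewrite subn1 sa.
  by rewrite sl ltnS subSS.
Qed.

Lemma rep_counter_left w v t : rep_counter w v.+1 t ->
  rep_counter w v (tape_move None MoveLeft (tape_write (scanned t) t)).
Proof.
case: t => l a r [/= sa sr sl]; split => /=.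
- by rewrite -nth0 sl subn1.
- case=> [|i] /=; first by rewrite addn1.
  by rewrite sr !addnS addSn.
- by move=> i; rewrite nth_behead sl ltnS subSS.
Qed.

Lemma does_inc_if (p : pred sym) r d rho o : 0 < r <= k -> 0 < d <= k ->
  does (inc_if p r d) (rho, o)
    (upd rho d (rho d + p (content (inp r) (rho r))), o) 1.
Proof.
move=> rk /andP[d0 dk] T rT; do 2!eexists; split; [exact: leqnn|exact: RunsAct|].
move=> i; rewrite /do_act /= updE (readsE p rk rT) /=.
have := rT i; case: (altP (_ =P 0)) => [-> | i0] /=.
  by rewrite (ltn_eqF d0) /= rep_stay.
case: eqP => [<-|_]; last by rewrite /= rep_stay.
case: (p _) => /=; last by rewrite /= rep_stay addn0.
by move=> ri; rewrite ffunE addn1; apply: rep_counter_right.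
Qed.

Lemma does_inc d rho o : 0 < d <= k ->
  does (inc d) (rho, o) (upd rho d (rho d).+1, o) 1.
Proof. by move=> dk; have := @does_inc_if predT d d rho o dk dk; rewrite addn1. Qed.

Lemma does_dec d rho o : 0 < d <= k ->
  does (dec d) (rho, o) (upd rho d (rho d).-1, o) 1.
Proof.
move=> dk T rT; do 2!eexists; split; [exact: leqnn|exact: RunsAct|].
move=> i; rewrite /do_act /= updE (readsE _ dk rT) nonzeroE /=.
have := rT i; case: (altP (_ =P 0)) => [-> | i0] /=.
  by rewrite (ltn_eqF (proj1 (andP dk))) /= rep_stay.
case: eqP => [<-|_]; last by rewrite /= rep_stay.
case E: (rho i) => [|v] /=; first by rewrite /= rep_stay.
by move=> ri; rewrite ffunE; apply: rep_counter_left.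
Qed.

Lemma upd_upd rho r v w : upd (upd rho r v) r w = upd rho r w.
Proof. by apply: functional_extensionality => i; rewrite !updE; case: eqP. Qed.

Lemma upd_id rho r v : v = rho r -> upd rho r v = rho.
Proof. by move=> ->; apply: functional_extensionality => i; rewrite updE; case: eqP => // ->. Qed.

Definition clear d := loop d (dec d).

Lemma does_clear d rho o : 0 < d <= k ->
  does (clear d) (rho, o) (upd rho d 0, o) (rho d * 2).+1.
Proof.
move=> dk; have := @does_loop d (dec d) (fun i => (upd rho d (rho d - i), o)) (rho d) 1 dk.
rewrite subn0 upd_id // subnn; apply=> [i _|i _] /=.
  by rewrite updE eqxx.
by have := @does_dec d (upd rho d (rho d - i)) o dk; rewrite upd_upd updE eqxx subnS.
Qed.

Definition push r : cmd :=
  Act (fun sc i => if i == 0 :> nat then (bsym (reads nonzero r sc), MoveLeft)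
                   else (sc i, Stay)).

Lemma does_push r rho o : 0 < r <= k ->
  does (push r) (rho, o) (rho, (rho r != 0) :: o) 1.
Proof.
move=> rk T rT; do 2!eexists; split; [exact: leqnn|exact: RunsAct|].
move=> i; rewrite /do_act /= (readsE _ rk rT) nonzeroE /=.
have := rT i; case: (altP (_ =P 0)) => [i0 | _] /=; last by rewrite /= rep_stay.
case: (T i) => l a q [/= _ sq sl]; split=> /=; first by rewrite -nth0 sl.
  by case.
by move=> j; rewrite nth_behead sl.
Qed.

Definition finish : cmd :=
  Act (fun sc i => (sc i, if i == 0 :> nat then MoveRight else Stay)).

(** Tapes are known only cell by cell, hence only up to trailing blanks; this is enough, because
    reading stops at the first blank. *)
Lemma read_bits_nth M (s : seq (symbol (tm_work M))) (o : word) :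
  (forall i, nth None s i = nth None (map (@bit_symbol M) o) i) -> read_bits s = o.
Proof.
elim: o s => [|b o IHo] [|a s] so //.
- by move: (so 0) => /= ->.
- by move: (so 0).
- by move: (so 0) => /= ->; rewrite IHo // => i; apply: (so i.+1).
Qed.

(** * Arithmetic terms and their compilation *)

Inductive term :=
| One
| Var of nat
| Len of 'I_3
| Bit of 'I_3 & term
| Add of term & term
| Le of term & term
| Sum of term & term.

Fixpoint eval (e : term) (s : seq nat) : nat :=
  match e with
  | One => 1
  | Var i => nth 0 s i
  | Len i => size (inp i.+1)
  | Bit i e => nth false (inp i.+1) (eval e s)
  | Add e1 e2 => eval e1 s + eval e2 s
  | Le e1 e2 => eval e1 s <= eval e2 s
  | Sum e b => \sum_(i < eval e s) eval b ((i : nat) :: s)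
  end.

(** The number of scratch counters that the compiled term may touch. *)
Fixpoint width (e : term) : nat :=
  match e with
  | One | Len _ => 0
  | Var _ => 1
  | Bit _ e => (width e).+1
  | Add e1 e2 => maxn (width e1) (width e2)
  | Le e1 e2 => (maxn (width e1) (width e2)).+2
  | Sum e b => (maxn (width e) (width b)).+2
  end.

Definition nonblank : pred sym := fun a => a != None.
Definition is_one : pred sym := fun a => a == bsym true.

(* [comp e vs m d] adds the value of [e] to counter [d]; variable number [i] is
   counter [nth 0 vs i], and the counters from [m] on are scratch: they are zero
   before and after. *)
Fixpoint comp (e : term) (vs : seq nat) (m d : nat) : cmd :=
  match e with
  | One => inc d
  | Var i =>
      if i < size vs then
        let v := nth 0 vs i in
        (* Reading a counter destroys it; the second copy in [m] serves to restore it. *)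
        Seq (loop v (Seq (dec v) (Seq (inc d) (inc m))))
            (loop m (Seq (dec m) (inc v)))
      (* A variable without a counter has the value 0; this loop does nothing, as the scratch
         counter [m] is zero. *)
      else loop m (dec m)
  | Len i =>
      (* The first increment leaves the marker, which is not a letter but would pass the test for a
         non-blank cell. *)
      Seq (inc i.+1)
        (Seq (While (reads nonblank i.+1) (Seq (inc i.+1) (inc d))) (clear i.+1))
  | Bit i e =>
      Seq (comp e vs m.+1 m)
        (Seq (loop m (Seq (dec m) (inc i.+1)))
          (Seq (inc i.+1) (Seq (inc_if is_one i.+1 d) (clear i.+1))))
  | Add e1 e2 => Seq (comp e1 vs m d) (comp e2 vs m d)
  | Le e1 e2 =>
      Seq (comp e1 vs m.+2 m)
        (Seq (comp e2 vs m.+2 m.+1)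
          (* After this truncated subtraction [m] is zero exactly if the first value is at most the
             second. *)
          (Seq (loop m.+1 (Seq (dec m.+1) (dec m)))
            (Seq (inc_if (predC nonzero) m d) (clear m))))
  | Sum e b =>
      Seq (comp e vs m.+2 m)
        (* [m] counts the remaining rounds down, while [m.+1] counts up and is the summation
           variable. *)
        (Seq (loop m (Seq (dec m) (Seq (comp b (m.+1 :: vs) m.+2 d) (inc m.+1))))
          (clear m.+1))
  end.

(** Counters 1 to 3 carry the input words and are at their origin between terms, so variables and
    destinations lie above 3. *)
Definition fits (vs : seq nat) (m d : nat) (rho : nat -> nat) : Prop :=
  [/\ all (fun v => 3 < v < m) vs, 3 < d < m, d \notin vs,
      forall r, 0 < r <= 3 -> rho r = 0 & forall r, m <= r -> rho r = 0].

Lemma does_conv c s s1 n1 s2 n2 :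
  does c s s1 n1 -> s1.1 =1 s2.1 -> s1.2 = s2.2 -> n1 <= n2 -> does c s s2 n2.
Proof.
move=> dc /functional_extensionality e1 e2 len; apply: does_le len.
by case: s1 s2 e1 e2 dc => [a b] [c' d] /= -> ->.
Qed.

Lemma does_loop_conv r c (F : nat -> nat -> nat) o n b s1 s2 t :
  0 < r <= k -> F 0 =1 s1 -> F n =1 s2 -> (forall i, i <= n -> F i r = n - i) ->
  (forall i, i < n -> does c (F i, o) (F i.+1, o) b) -> (n * b.+1).+1 <= t ->
  does (loop r c) (s1, o) (s2, o) t.
Proof.
move=> rk /functional_extensionality <- F2 Fr dF le_t.
exact: does_conv (@does_loop r c (fun i => (F i, o)) n b rk Fr dF) _ _ _.
Qed.

Lemma does_while_conv (p : pred sym) r c (F : nat -> nat -> nat) o n b s1 s2 t :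
  0 < r <= k -> F 0 =1 s1 -> F n =1 s2 ->
  (forall i, i <= n -> p (content (inp r) (F i r)) = (i < n)) ->
  (forall i, i < n -> does c (F i, o) (F i.+1, o) b) -> (n * b.+1).+1 <= t ->
  does (While (reads p r) c) (s1, o) (s2, o) t.
Proof.
move=> rk /functional_extensionality <- F2 Fr dF le_t.
apply: does_conv (@does_while p r c (fun i => (F i, o)) n b rk _ _ dF) _ _ _ => //=.
  by move=> i lti; rewrite Fr ?(ltnW lti).
by rewrite Fr // ltnn.
Qed.

Ltac solve_upd :=
  move=> ? /=; rewrite /upd; repeat (case: ifP => /eqP ?); subst; try lia.

Lemma does_copy v d m rho o : 0 < v <= k -> 0 < d <= k -> 0 < m <= k ->
  v <> d -> v <> m -> d <> m -> rho m = 0 ->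
  does (Seq (loop v (Seq (dec v) (Seq (inc d) (inc m))))
            (loop m (Seq (dec m) (inc v))))
    (rho, o) (upd rho d (rho d + rho v), o) (7 * rho v + 2).
Proof.
move=> vk dk mk vd vm dm m0.
apply: does_le (_ : (rho v * 4).+1 + (rho v * 3).+1 <= _); last by lia.
apply: does_seq (_ : does _ _
  (upd (upd (upd rho v 0) d (rho d + rho v)) m (rho v), o) _) _.
  apply: (@does_loop_conv _ _
    (fun i => upd (upd (upd rho v (rho v - i)) d (rho d + i)) m i) _ (rho v) 3) => //.
  - by solve_upd.
  - by solve_upd.
  - by move=> i; solve_upd.
  move=> i lti; apply: does_conv
    (does_seq (does_dec vk) (does_seq (does_inc dk) (does_inc mk))) _ _ _ => //.
  by solve_upd.
apply: (@does_loop_conv _ _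
  (fun i => upd (upd (upd rho v i) d (rho d + rho v)) m (rho v - i)) _ (rho v) 2) => //.
- by solve_upd.
- by solve_upd.
- by move=> i; solve_upd.
move=> i lti; apply: does_conv (does_seq (does_dec mk) (does_inc vk)) _ _ _ => //.
by solve_upd.
Qed.

Lemma does_transfer m a rho o : 0 < m <= k -> 0 < a <= k -> m <> a -> rho a = 0 ->
  does (loop m (Seq (dec m) (inc a))) (rho, o) (upd (upd rho m 0) a (rho m), o)
    (3 * rho m + 1).
Proof.
move=> mk ak ma a0; apply: (@does_loop_conv _ _
  (fun i => upd (upd rho m (rho m - i)) a i) _ (rho m) 2) => //.
- by solve_upd.
- by solve_upd.
- by move=> i; solve_upd.
- move=> i lti; apply: does_conv (does_seq (does_dec mk) (does_inc ak)) _ _ _ => //.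
  by solve_upd.
- by lia.
Qed.

Lemma does_minus m1 m rho o : 0 < m1 <= k -> 0 < m <= k -> m1 <> m ->
  does (loop m1 (Seq (dec m1) (dec m))) (rho, o)
    (upd (upd rho m1 0) m (rho m - rho m1), o) (3 * rho m1 + 1).
Proof.
move=> mk ak ma; apply: (@does_loop_conv _ _
  (fun i => upd (upd rho m1 (rho m1 - i)) m (rho m - i)) _ (rho m1) 2) => //.
- by solve_upd.
- by solve_upd.
- by move=> i; solve_upd.
- move=> i lti; apply: does_conv (does_seq (does_dec mk) (does_dec ak)) _ _ _ => //.
  by solve_upd.
- by lia.
Qed.

Lemma does_measure a d rho o : 0 < a <= k -> 0 < d <= k -> a <> d -> rho a = 0 ->
  does (Seq (inc a) (Seq (While (reads nonblank a) (Seq (inc a) (inc d))) (clear a)))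
    (rho, o) (upd rho d (rho d + size (inp a)), o) (5 * size (inp a) + 5).
Proof.
move=> ak dk ad a0; set n := size _.
apply: does_le (_ : 1 + ((n * 3).+1 + (n.+1 * 2).+1) <= _); last by lia.
apply: does_seq (does_inc ak) _; rewrite a0.
apply: does_seq (_ : does _ _ (upd (upd rho a n.+1) d (rho d + n), o) _) _; last first.
  apply: does_conv (does_clear ak) _ _ _ => //; first by solve_upd.
  by rewrite /upd eqxx; case: eqP.
have nb v : nonblank (content (inp a) v) = (v <= n).
  rewrite /nonblank /content; case: v => // v /=.
  case: (ltnP v n) => [ltvn|]; first by rewrite (nth_map false).
  by move=> ge; rewrite nth_default ?size_map.
apply: (@does_while_conv nonblank a _
  (fun i => upd (upd rho a i.+1) d (rho d + i)) _ n 2) => //.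
- by solve_upd.
- by move=> i lti; rewrite nb /upd; case: eqP => // _; rewrite eqxx.
- move=> i lti; apply: does_conv (does_seq (does_inc ak) (does_inc dk)) _ _ _ => //.
  by solve_upd.
Qed.

End Counters.

(** Constant factors are absorbed into the exponent. This is why time bounds are pure powers of a
    base that is at least 2. *)
Lemma scale_pow C n a j : 2 <= n -> C <= 2 ^ j -> C * n ^ a <= n ^ (a + j).
Proof.
move=> n2 leC; rewrite expnD mulnC leq_mul2l; apply/orP; right.
by apply: leq_trans leC _; case: j => // j; rewrite leq_exp2r.
Qed.

Lemma pow_mono n a b : 0 < n -> a <= b -> n ^ a <= n ^ b.
Proof. by move=> n0 ab; apply: leq_pexp2l. Qed.

Lemma fits_temp vs m d rho m1 d1 v : fits vs m d rho -> m <= d1 < m1 ->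
  fits vs m1 d1 (upd rho d1 v).
Proof.
case=> /allP vm dm dvs r0 rm /andP[lem ltm]; split.
- by apply/allP => r /vm; lia.
- by lia.
- by apply/negP => /vm; lia.
- by move=> r r3; rewrite updE; case: eqP => [?|_]; [lia | apply: r0].
- by move=> r r3; rewrite updE; case: eqP => [?|_]; [lia | apply: rm; lia].
Qed.

Lemma fits_upd vs m d rho v : fits vs m d rho -> fits vs m d (upd rho d v).
Proof.
case=> vm dm dvs r0 rm; split=> // r r3.
  by rewrite updE; case: eqP => [?|_]; [lia | apply: r0].
by rewrite updE; case: eqP => [?|_]; [lia | apply: rm].
Qed.

Lemma map_upd_notin rho d v (vs : seq nat) : d \notin vs ->
  [seq upd rho d v r | r <- vs] = [seq rho r | r <- vs].
Proof.
move=> dvs; apply/eq_in_map => r rvs; rewrite updE; case: eqP => // rd.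
by rewrite rd (negbTE dvs) in rvs.
Qed.

(** The exponent is chosen before the base, and the base bounds the variables as well as the words.
    So the body of a sum, whose index may reach [n ^ p1], can be treated by its induction hypothesis
    with the larger base [n ^ p1.+1]; this multiplies the exponents. *)
Lemma comp_does e : exists p, forall inp n vs m d rho o, 2 <= n ->
  (forall i, size (inp i) <= n) -> all (fun v => rho v <= n) vs ->
  fits vs m d rho -> m + width e <= k.+1 ->
  let v := eval inp e [seq rho r | r <- vs] in
  v <= n ^ p /\ does inp (comp e vs m d) (rho, o) (upd rho d (rho d + v), o) (n ^ p).
Proof.
elim: e => [|i|i|i e [p IH]|e1 [p1 IH1] e2 [p2 IH2]|e1 [p1 IH1] e2 [p2 IH2]
           |e1 [p1 IH1] e2 [p2 IH2]].
- exists 1 => inp n vs m d rho o n2 _ _ [_ dm _ _ _] mk /=; rewrite expn1.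
  split; first by lia.
  by rewrite addn1; apply: does_le (does_inc _) _; lia.
- exists 5 => inp n vs m d rho o n2 _ /allP small [/allP vm dm dvs _ rm] mk /=.
  rewrite /= in mk; have n5 : 9 * n <= n ^ 5 by apply: (@scale_pow 9 n 1 4).
  case: ltnP => isz.
    have iv := mem_nth 0 isz; have /= lev := small _ iv; have /= mv := vm _ iv.
    have nd : nth 0 vs i <> d by move=> E; rewrite -E iv in dvs.
    rewrite (nth_map 0) //; split; first by lia.
    by apply: does_le (does_copy _ _ _ _ _ _ (rm m _)) _; lia.
  rewrite nth_default ?size_map //; split=> //.
  have mk' : 0 < m <= k by lia.
  apply: does_conv (does_clear mk') _ _ _ => //=; last by rewrite rm; lia.
  have rm0 := rm m (leqnn m).
  by move=> r; rewrite /upd addn0; repeat (case: eqP => ?); subst; lia.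
- exists 5 => inp n vs m d rho o n2 sz _ [_ dm _ r0 _] mk /=.
  rewrite /= in mk; have n5 : 10 * n <= n ^ 5 by apply: (@scale_pow 10 n 1 4).
  have := sz i.+1; have := ltn_ord i => i3 szi; split; first by lia.
  by apply: does_le (does_measure _ _ _ _) _; rewrite ?r0; lia.
- exists (p + 4) => inp n vs m d rho o n2 sz small fi mk.
  have n4 : 12 * n ^ p <= n ^ (p + 4) by apply: scale_pow.
  have np : 0 < n ^ p by rewrite expn_gt0; lia.
  have fi1 : fits vs m.+1 m rho.
    by rewrite -(upd_id (erefl (rho m))); apply: fits_temp fi _; lia.
  have mk1 : m.+1 + width e <= k.+1 by move: mk => /=; lia.
  move: fi => [_ dm _ r0 rm]; have := ltn_ord i => i3.
  have [] := IH inp n vs m.+1 m rho o n2 sz small fi1 mk1.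
  move=> /=; set v := eval _ _ _ => lev D1; split; first by case: (nth _ _ _) => /=; lia.
  rewrite rm // add0n in D1.
  have mk' : 0 < m <= k by lia. have ik : 0 < i.+1 <= k by lia.
  have dk : 0 < d <= k by lia. have ik' : 0 < i.+1 <= 3 by lia.
  apply: does_le (does_seq D1 _) (_ : n ^ p + ((3 * v + 1) + (1 + (1 + (v.+1 * 2).+1))) <= _);
    last by lia.
  have ri := r0 i.+1 ik'; have rm0 := rm m (leqnn m).
  apply: does_seq (_ : does _ _ _ (upd rho i.+1 v, o) _) _.
    apply: does_conv (does_transfer mk' ik _ _) _ _ _; rewrite ?updE ?eqxx //=.
    + by lia.
    + by case: eqP => // ?; lia.
    + by move=> r; rewrite /upd; repeat (case: eqP => ?); subst; lia.
  apply: does_seq (does_inc ik) _.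
  apply: does_seq (does_inc_if _ ik dk) _.
  apply: does_conv (does_clear ik) _ _ _ => //=; last first.
    by rewrite !updE eqxx; case: eqP => [?|_]; lia.
  have E : is_one (content (inp i.+1) v.+1) = nth false (inp i.+1) v.
    rewrite /is_one /content /=; case: (ltnP v (size (inp i.+1))) => lv.
      by rewrite (nth_map false) //; case: (nth _ _ _).
    by rewrite !nth_default ?size_map.
  move=> r /=; rewrite !updE !eqxx E /upd.
  by repeat (case: eqP => ?); subst; lia.
- exists (p1 + p2 + 1) => inp n vs m d rho o n2 sz small fi mk.
  have n1 : 2 * n ^ (p1 + p2) <= n ^ (p1 + p2 + 1) by apply: scale_pow.
  have a1 : n ^ p1 <= n ^ (p1 + p2) by apply: pow_mono; lia.
  have a2 : n ^ p2 <= n ^ (p1 + p2) by apply: pow_mono; lia.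
  have dvs : d \notin vs by case: fi.
  have [] := IH1 inp n vs m d rho o n2 sz small fi; first by move: mk => /=; lia.
  move=> /=; set v1 := eval _ e1 _ => l1 D1.
  have [] := IH2 inp n vs m d (upd rho d (rho d + v1)) o n2 sz _ (fits_upd _ fi).
  + apply/allP => r rv; rewrite updE; case: eqP => [rd|_]; last exact: (allP small).
    by rewrite -rd rv in dvs.
  + by move: mk => /=; lia.
  rewrite map_upd_notin //; set v2 := eval _ e2 _ => /= l2 D2; split; first by lia.
  apply: does_conv (does_seq D1 D2) _ _ _ => //=; last by lia.
  by rewrite updE eqxx upd_upd addnA => ?.
- exists (p1 + p2 + 4) => inp n vs m d rho o n2 sz small fi mk.
  have n1 : 14 * n ^ (p1 + p2) <= n ^ (p1 + p2 + 4) by apply: scale_pow.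
  have a1 : n ^ p1 <= n ^ (p1 + p2) by apply: pow_mono; lia.
  have a2 : n ^ p2 <= n ^ (p1 + p2) by apply: pow_mono; lia.
  have np : 0 < n ^ (p1 + p2) by rewrite expn_gt0; lia.
  have fi1 : fits vs m.+2 m rho.
    by rewrite -(upd_id (erefl (rho m))); apply: fits_temp fi _; lia.
  have [] := IH1 inp n vs m.+2 m rho o n2 sz small fi1; first by move: mk => /=; lia.
  move=> /=; set v1 := eval _ e1 _ => l1 D1.
  have mvs : m \notin vs by case: fi1.
  have mm : m <= m < m.+1 by lia.
  have mm1 : m < m.+1 < m.+2 by lia.
  have fi2 : fits vs m.+2 m.+1 (upd rho m v1).
    have F := fits_temp v1 fi mm.
    by have := fits_temp (upd rho m v1 m.+1) F mm1; rewrite upd_id.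
  have [] := IH2 inp n vs m.+2 m.+1 (upd rho m v1) o n2 sz _ fi2.
  + apply/allP => r rv; rewrite updE; case: eqP => [rm|_]; last exact: (allP small).
    by rewrite -rm rv in mvs.
  + by move: mk => /=; lia.
  rewrite map_upd_notin //; set v2 := eval _ e2 _ => /= l2 D2; split.
    by have := leq_b1 (v1 <= v2); lia.
  move: fi => [_ dm _ r0 rm]; rewrite /= in mk.
  have mk0 : 0 < m <= k by lia. have mk1 : 0 < m.+1 <= k by lia.
  have dk : 0 < d <= k by lia.
  have rm0 := rm m (leqnn m).
  have E1 : upd rho m v1 m.+1 = 0.
    by rewrite /upd; case: eqP => [?|_]; [lia | apply: rm; lia].
  rewrite rm0 add0n in D1; rewrite E1 add0n in D2.
  apply: does_le (does_seq D1 (does_seq D2 _))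
    (_ : n ^ p1 + (n ^ p2 + ((3 * v2 + 1) + (1 + (v1 * 2).+1))) <= _); last by lia.
  apply: does_seq (_ : does _ _ _ (upd rho m (v1 - v2), o) _) _.
    apply: does_conv (does_minus mk1 mk0 _) _ _ _; rewrite ?updE ?eqxx //=; first by lia.
    move=> r; rewrite /upd; have rm1 := rm m.+1 (leqnSn m).
    by repeat (case: eqP => ?); subst; lia.
  apply: does_seq (does_inc_if _ mk0 dk) _.
  apply: does_conv (does_clear mk0) _ _ _ => //=.
    move=> r; rewrite nonzeroE negbK /upd eqxx subn_eq0.
    by repeat (case: eqP => ?); subst; lia.
  by rewrite /upd !eqxx; case: eqP => [?|_]; lia.
- exists (p1 + p1.+1 * p2 + 4) => inp n vs m d rho o n2 sz small fi mk.
  set q := p1.+1 * p2.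
  have n1 : 12 * n ^ (p1 + q) <= n ^ (p1 + q + 4) by apply: scale_pow.
  have a1 : n ^ p1 <= n ^ (p1 + q) by apply: pow_mono; lia.
  have np : 0 < n ^ (p1 + q) by rewrite expn_gt0; lia.
  have np1 : 0 < n ^ p1 by rewrite expn_gt0; lia.
  have nn : n * n ^ p1 = n ^ p1.+1 by rewrite expnS.
  have fi1 : fits vs m.+2 m rho.
    by rewrite -(upd_id (erefl (rho m))); apply: fits_temp fi _; lia.
  have [] := IH1 inp n vs m.+2 m rho o n2 sz small fi1; first by move: mk => /=; lia.
  move=> /=; set v := eval _ e1 _ => l1 D1.
  set s := [seq rho r | r <- vs]; set b := fun i => eval inp e2 (i :: s).
  (* The store after [i] rounds: rounds left, summation index and partial sum. *)
  pose F i := upd (upd (upd rho m (v - i)) m.+1 i) d (rho d + \sum_(j < i) b j).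
  move: (fi) => [/allP vm dm dvs r0 rm].
  have rm0 := rm m (leqnn m); rewrite rm0 add0n in D1.
  have mk' : m + maxn (width e1) (width e2) < k by move: mk => /=; lia.
  have mk0 : 0 < m <= k by lia. have mk1 : 0 < m.+1 <= k by lia.
  have body i rho1 : i < v -> rho1 =1 upd (F i) m (v - i.+1) ->
      b i <= n ^ q /\ does inp (comp e2 (m.+1 :: vs) m.+2 d) (rho1, o)
                       (upd rho1 d (rho1 d + b i), o) (n ^ q).
    move=> ltiv /functional_extensionality ->.
    have := IH2 inp (n ^ p1.+1) (m.+1 :: vs) m.+2 d (upd (F i) m (v - i.+1)) o.
    rewrite -expnM -/q.
    have -> : [seq upd (F i) m (v - i.+1) r | r <- m.+1 :: vs] = i :: s.
      rewrite /= updE; have -> : (m.+1 == m) = false by apply/eqP; lia.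
      rewrite /F !updE; have -> : (m.+1 == d) = false by apply/eqP; lia.
      rewrite eqxx; congr (_ :: _); apply/eq_in_map => r rv.
      have /= lr := vm _ rv; rewrite !updE.
      have -> : (r == m) = false by apply/eqP; lia.
      have -> : (r == m.+1) = false by apply/eqP; lia.
      by case: eqP => // rd; rewrite -rd rv in dvs.
    apply.
    + by nia.
    + by move=> j; apply: leq_trans (sz j) _; nia.
    + apply/allP => r; rewrite inE => /predU1P[->|rv].
        rewrite /F !updE eqxx; have -> : (m.+1 == m) = false by apply/eqP; lia.
        by have -> : (m.+1 == d) = false by [apply/eqP; lia]; nia.
      have /= lr := vm _ rv; have /= := allP small _ rv; rewrite !updE /F !updE.
      have -> : (r == m) = false by apply/eqP; lia.
      have -> : (r == m.+1) = false by apply/eqP; lia.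
      by case: eqP => [rd|_]; [rewrite -rd rv in dvs | nia].
    + split.
      * by rewrite /= !leqnn /=; apply/andP; split; [lia | apply/allP => r /vm; lia].
      * by lia.
      * by rewrite inE negb_or dvs andbT; apply/eqP; lia.
      * by move=> r r3; rewrite /F /upd; repeat (case: eqP => ?; first lia); apply: r0.
      * by move=> r r3; rewrite /F /upd; repeat (case: eqP => ?; first lia); apply: rm; lia.
    + by lia.
  split.
    apply: leq_trans (_ : \sum_(i < v) n ^ q <= _).
      by apply: leq_sum => i _; case: (body i _ (ltn_ord i) (frefl _)).
    rewrite sum_nat_const card_ord; apply: leq_trans (_ : n ^ p1 * n ^ q <= _).
      by rewrite leq_mul2r l1 orbT.
    by rewrite -expnD; apply: pow_mono; lia.
  apply: does_conv (does_seq D1 (does_seq (does_loop_conv (F := F)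
    (s2 := F v) (n := v) (b := 1 + (n ^ q + 1)) mk0 _ (frefl _) _ _ (leqnn _)) (does_clear mk1))) _ _ _ => //=.
  + by move=> r; rewrite /F big_ord0 addn0 subn0;
      have rm1 := rm m.+1 (leqnSn m); rewrite /upd; repeat (case: eqP => ?); subst; lia.
  + by move=> i lei; rewrite /F !updE eqxx; have -> : (m == d) = false by [apply/eqP; lia];
      have -> : (m == m.+1) = false by apply/eqP; lia.
  + move=> i lti; have Fm : F i m = v - i.
      by rewrite /F !updE eqxx; have -> : (m == d) = false by [apply/eqP; lia];
        have -> : (m == m.+1) = false by apply/eqP; lia.
    apply: does_conv (does_seq (does_dec mk0)
      (does_seq (proj2 (body i _ lti _)) (does_inc mk1))) _ _ _ => //=.
      by move=> r; rewrite !updE Fm; case: eqP => // _; lia.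
    move=> r; rewrite /F /upd big_ord_recr /= -/(b i).
    by repeat (case: eqP => ?); lia.
  + have rm1 := rm m.+1 (leqnSn m).
    change (\sum_(i < v) eval inp e2 ((i : nat) :: s)) with (\sum_(i < v) b i).
    rewrite /F subnn => r.
    by rewrite /upd; repeat (case: eqP => ?); subst; lia.
  + rewrite /F !updE eqxx; have -> : (m.+1 == d) = false by apply/eqP; lia.
    have n3 : v * n ^ q <= n ^ (p1 + q) by rewrite expnD leq_mul2r l1 orbT.
    by lia.
Qed.

(** * Loading the inputs and printing the result *)

Definition copy_input : cmd :=
  While (fun sc => sc ord0 != None)
    (Act (fun sc i => if i == 0 :> nat then (None, MoveRight)
                      else if i == 3 :> nat then (sc ord0, MoveRight)
                      else (sc i, Stay))).

(** Tape 0 is to become the output tape, so [x] is moved from there to tape 3. The initial step to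
    the left makes room for the marker in front of the other words. *)
Definition setup : cmd :=
  Seq (Act (fun sc i => (sc i, if i == 0 :> nat then Stay else MoveLeft)))
    (Seq (Act (fun sc i => if i == 0 :> nat then (sc i, Stay)
                           else (marker, if i == 3 :> nat then MoveRight else Stay)))
      (Seq copy_input (clear 3))).

(** Invariant of the copying loop: [u] has reached tape 3 and [v] is still on tape 0. *)
Definition copying (inp : nat -> word) (u v : word) (T : tapes) : Prop :=
  forall i : 'I_k.+1,
    if i == 0 :> nat then
      [/\ scanned (T i) = nth None (map bsym v) 0,
          forall j, nth None (cells_right (T i)) j = nth None (map bsym v) j.+1 &
          forall j, nth None (cells_left (T i)) j = None]
    else if i == 3 :> nat then rep_counter u (size u).+1 (T i)
    else rep_counter (inp i) 0 (T i).

Lemma content_rcons u b i :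
  content (rcons u b) i = if i == (size u).+1 then bsym b else content u i.
Proof.
rewrite /content map_rcons -rcons_cons nth_rcons /= size_map.
by case: ltngtP => // lt; rewrite nth_default //= size_map ltnW.
Qed.

Lemma rep_counter_append u b t : rep_counter u (size u).+1 t ->
  rep_counter (rcons u b) (size (rcons u b)).+1
    (tape_move None MoveRight (tape_write (bsym b) t)).
Proof.
rewrite size_rcons; case: t => l a r [/= sa sr sl]; split => /=.
- by rewrite -nth0 sr content_rcons; case: eqP => [|_]; [lia | congr content; lia].
- by move=> i; rewrite nth_behead sr content_rcons; case: eqP => [|_]; [lia | congr content; lia].
- case=> [|i] /=; first by rewrite subn1 content_rcons eqxx.
  rewrite sl [i.+1 < _]ltnS content_rcons; case: ifP => // lti.
  by case: eqP => [?|_]; [lia | congr content; lia].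
Qed.

Hypothesis k3 : 2 < k.

Lemma copy_runs inp v u T : copying inp u v T ->
  exists T' t, [/\ t <= 2 * size v + 1, runs copy_input T T' t & copying inp (u ++ v) [::] T'].
Proof.
elim: v u T => [|b v IHv] u T cT.
  exists T, 1; rewrite cats0; split=> //; apply: RunsStop.
  by rewrite ffunE; have /= [->] := cT ord0.
have sT : scan_of T ord0 = bsym b by rewrite ffunE; have /= [->] := cT ord0.
have [|T' [t [le_t rT cT']]] := IHv (rcons u b)
  (do_act (if true then fun i : 'I_k.+1 => if i == 0 :> nat then (None, MoveRight)
                      else if i == 3 :> nat then (scan_of T ord0, MoveRight)
                      else (scan_of T i, Stay) else idle (scan_of T)) T).
  move=> i; have := cT i; rewrite /do_act.
  case: (altP (_ =P 0)) => [i0 | i0] /=.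
    case: (T i) => l a r [/= _ sr sl]; split.
    + by rewrite -nth0 sr.
    + by move=> j; rewrite nth_behead sr.
    + by case.
  case: eqP => _ /=; last by rewrite rep_stay.
  by rewrite sT; apply: rep_counter_append.
exists T', (1 + 1 + t); split; first by rewrite /=; lia.
  apply: RunsLoop rT; first by rewrite sT.
  exact: RunsAct.
by rewrite -cat_rcons.
Qed.

Definition input_tapes (xs : seq word) : tapes :=
  fun i => tape_of (cmachine finish) (nth [::] xs i).

(** [y] and [z] stay on tapes 1 and 2, where the machine receives them; [x] has been copied to tape
    3, and tape 0 is left to the output. *)
Definition inputs (x y z : word) (r : nat) : word :=
  nth [::] [:: [::]; y; z; x] r.

Lemma setup_runs x y z : exists T' t, [/\ t <= 4 * size x + 8,
  runs setup (input_tapes [:: x; y; z]) T' t &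
  rep (inputs x y z) (fun=> 0, [::]) T'].
Proof.
set T := input_tapes _.
pose T1 := do_act (fun i : 'I_k.+1 =>
  (scan_of T i, if i == 0 :> nat then Stay else MoveLeft)) T.
pose T2 := do_act (fun i : 'I_k.+1 => if i == 0 :> nat then (scan_of T1 i, Stay)
  else (marker, if i == 3 :> nat then MoveRight else Stay)) T1.
have nth_head_behead (s : seq sym) j : nth None (head None s :: behead s) j = nth None s j.
  by case: s j => [|a s] [|[|j]].
have cT : copying (inputs x y z) [::] x T2.
  move=> i; rewrite /T2 /T1 /do_act /T /input_tapes /tape_of.
  case: (altP (_ =P 0)) => [i0 | i0].
    rewrite /= /scan_of !ffunE /= i0 /=; split=> //=.
    + by move=> j; rewrite nth_behead.
    + by move=> j; rewrite nth_nil.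
  case: eqP => i3.
    rewrite /= /scan_of !ffunE /= i3 /=; split=> //=; last by case=> [|[|j]].
    by move=> j; rewrite /content add1n /= !nth_nil.
  rewrite /=; split=> //=.
  - move=> j; rewrite ffunE /= nth_head_behead.
    case: (i : nat) i0 i3 => [|[|[|[|j']]]] //= _ _.
    by rewrite /content /inputs /= !nth_nil.
  - by move=> j; rewrite nth_nil.
have [T3 [t3 [le3 r3 c3]]] := copy_runs cT.
have rep3 : rep (inputs x y z) (upd (fun=> 0) 3 (size x).+1, [::]) T3.
  move=> i; have := c3 i; case: (altP (_ =P 0)) => [i0 | i0] /=.
    by case=> s0 sr sl; split=> // j; rewrite sr nth_nil.
  by rewrite updE; case: eqP => [->|].
have k3' : 0 < 3 <= k by lia.
have [T4 [t4 [le4 r4 rep4]]] := @does_clear (inputs x y z) 3 _ [::] k3' T3 rep3.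
exists T4, (1 + (1 + (t3 + t4))); split.
- by move: le4; rewrite updE eqxx; lia.
- by apply: RunsSeq (RunsAct _ _) (RunsSeq (RunsAct _ _) (RunsSeq r3 r4)).
- by rewrite upd_upd upd_id in rep4.
Qed.

(** The output grows at its front, so the letters are produced from the last to the first: counter 4
    runs down from the length, and after its decrement it is the position of the next letter. *)
Definition program (eN eb : term) : cmd :=
  Seq setup (Seq (comp eN [::] 5 4)
    (Seq (loop 4 (Seq (dec 4) (Seq (comp eb [:: 4] 6 5) (Seq (push 5) (clear 5)))))
      finish)).

Lemma program_runs eN eb : 6 + width eN + width eb <= k ->
  exists p, forall x y z, let n := (size x + size y + size z).+2 in
  let inp := inputs x y z in
  exists T' t, [/\ t <= n ^ p, runs (program eN eb) (input_tapes [:: x; y; z]) T' t &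
    forall j, nth None (scanned (T' ord0) :: cells_right (T' ord0)) j =
      nth None (map bsym (mkseq (fun i => eval inp eb [:: i] != 0) (eval inp eN [::]))) j].
Proof.
move=> wk; have [pN HN] := comp_does eN; have [pb Hb] := comp_does eb.
exists (pN + pN.+1 * pb + 6) => x y z n inp.
have sz i : size (inp i) <= n.
  by rewrite /inp /inputs /n; case: i => [|[|[|[|i]]]] //=; rewrite ?nth_nil //=; lia.
have [T1 [t1 [le1 r1 rep1]]] := setup_runs x y z.
have fi1 : fits [::] 5 4 (fun=> 0) by split.
have [] := HN inp n [::] 5 4 (fun=> 0) [::] isT sz isT fi1; first by lia.
move=> /=; set N := eval _ _ _; rewrite add0n => leN D1.
pose b i := eval inp eb [:: i] != 0.
have k4 : 0 < 4 <= k by lia. have k5 : 0 < 5 <= k by lia.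
(* After [i] rounds the output consists of the last [i] of the [N] letters. *)
pose F i := (upd (fun=> 0) 4 (N - i), [seq b j | j <- iota (N - i) i]) : store.
set q := pN.+1 * pb.
have nn : n * n ^ pN = n ^ pN.+1 by rewrite expnS.
have np1 : 0 < n ^ pN by rewrite expn_gt0.
have n2 : 1 < n by [].
have body i : i < N -> does inp (Seq (dec 4) (Seq (comp eb [:: 4] 6 5) (Seq (push 5) (clear 5))))
    (F i) (F i.+1) (1 + (n ^ q + (1 + (n ^ q * 2).+1))).
  move=> ltiN.
  have fi2 : fits [:: 4] 6 5 (upd (fun=> 0) 4 (N - i.+1)).
    by split=> // r; rewrite updE; case: eqP => // ->.
  have [] := Hb inp (n ^ pN.+1) [:: 4] 6 5 (upd (fun=> 0) 4 (N - i.+1)) 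
    [seq b j | j <- iota (N - i) i] _ _ _ fi2.
  - by nia.
  - by move=> j; apply: leq_trans (sz j) _; nia.
  - by rewrite /= updE eqxx andbT; nia.
  - by lia.
  rewrite /= !updE eqxx /= add0n -expnM -/q; set v := eval _ _ _ => lev D2.
  apply: does_le (_ : 1 + (n ^ q + (1 + (v * 2).+1)) <= _); last by lia.
  apply: does_seq (_ : does _ _ _ (upd (fun=> 0) 4 (N - i.+1), (F i).2) _) _.
    by apply: does_conv (does_dec k4) _ _ (leqnn _) => //= r; rewrite upd_upd subnS.
  apply: does_seq D2 _; apply: does_seq (does_push k5) _.
  apply: does_conv (does_clear k5) _ _ _ => //=.
  - by move=> r; rewrite upd_upd /upd; repeat (case: eqP => ?); subst.
  - by rewrite subnSK.
have [T2 [t2 [le2 r2 rep2]]] := D1 T1 rep1.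
have rep2' : rep inp (F 0) T2 by rewrite /F subn0.
have D3 := @does_loop inp 4 _ F N _ k4 _ body.
have [|T3 [t3 [le3 r3 rep3]]] := D3 _ T2 rep2'.
  by move=> i _; rewrite /F /= updE.
eexists; exists (t1 + (t2 + (t3 + 1))); split.
- have n6 : 20 * n ^ (pN + q) <= n ^ (pN + q + 6) by apply: scale_pow.
  have n3 : N * n ^ q <= n ^ (pN + q) by rewrite expnD leq_mul2r leN orbT.
  have a1 : n ^ pN <= n ^ (pN + q) by apply: pow_mono; lia.
  have n7 : 16 * n <= n ^ (pN + q + 6).
    by apply: leq_trans (_ : n ^ (1 + 4) <= _); [apply: (@scale_pow 16 n 1 4) | apply: pow_mono; lia].
  have sx : size x <= n by rewrite /n; lia.
  have n1 : 64 * n ^ (pN + q) <= n ^ (pN + q + 6) by apply: scale_pow.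
  by lia.
- by apply: RunsSeq r1 (RunsSeq r2 (RunsSeq r3 (RunsAct _ _))).
- have := rep3 ord0; rewrite /F /= subnn /do_act /mkseq => -[s0 sr sl].
  move=> j; case: (T3 ord0) s0 sr sl => l a r /= s0 sr sl.
  by rewrite -sr; case: r {sr sl} => [|c r]; case: j => [|[|j]].
Qed.

End TapePrograms.

(** * From terms to polynomial-time functions and relations *)

Theorem polytime_terms (eN eb : term) : exists (M : machine) (p : {poly nat}),
  forall x y z, outputs_within M p.[(size x + size y + size z)%N]%R [:: x; y; z]
    (mkseq (fun i => eval (inputs x y z) eb [:: i] != 0) (eval (inputs x y z) eN [::])).
Proof.
pose k := 6 + width eN + width eb.
have k3 : 2 < k by rewrite /k; lia.
have [p Hp] := program_runs k3 (leqnn k).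
(* The base of the time bound is the total input size plus 2, so that it is at least 2 even for
   empty words. *)
exists (cmachine (program k eN eb)), (('X + 2%:P) ^+ p)%R => x y z.
set n := (size x + size y + size z)%N.
have -> : ((('X + 2%:P) ^+ p).[n])%R = n.+2 ^ p.
  have n2 : (('X + 2%:P).[n])%R = n.+2.
    by rewrite hornerD hornerX hornerC; apply: addn2.
  by rewrite horner_exp n2; elim: p {Hp} => // p IHp; rewrite GRing.exprS IHp expnS.
have [T' [t [le_t rT oT]]] := Hp x y z.
rewrite /outputs_within; have -> : init (cmachine (program k eN eb)) [:: x; y; z] =
          cconf (program k eN eb) 0 (input_tapes [:: x; y; z]).
  by rewrite /init /cconf; congr Config; apply/val_inj; rewrite /= inordK.
have [-> hT] := runs_halts rT le_t.
split=> //; rewrite /output.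
by apply: (@read_bits_nth (cmachine (program k eN eb))) => j; apply: oT.
Qed.

Corollary polytime_rel_term (eb : term) (R : word -> word -> word -> bool) :
  (forall x y z, (eval (inputs x y z) eb [:: 0] != 0) = R x y z) -> polytime_rel R.
Proof.
move=> eR; have [M [p HM]] := polytime_terms One eb.
by exists M, p => x y z; rewrite -eR; apply: HM.
Qed.

Corollary polytime_fun_terms (eN eb : term) (f : word -> word) :
  (forall x, f x = mkseq (fun i => eval (inputs x [::] [::]) eb [:: i] != 0)
                         (eval (inputs x [::] [::]) eN [::])) -> polytime_fun f.
Proof.
move=> ef; have [M [p HM]] := polytime_terms eN eb.
exists M, p => x; have := HM x [::] [::]; rewrite ef /= !addn0 /outputs_within.
(* Inputs that are absent are read as empty words, so both initial configurations coincide. *)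
suff -> : init M [:: x; [::]; [::]] = init M [:: x] by [].
rewrite /init; congr Config; apply: functional_extensionality => i.
by case: (i : nat) => [|[|[|j]]] //=; rewrite !nth_nil.
Qed.

(** * Definable functions *)

Definition Zero := Le (Add One One) One.

Fixpoint lift (d : nat) (e : term) : term :=
  match e with
  | One => One
  | Var i => Var (if i < d then i else i.+1)
  | Len i => Len i
  | Bit i e => Bit i (lift d e)
  | Add e1 e2 => Add (lift d e1) (lift d e2)
  | Le e1 e2 => Le (lift d e1) (lift d e2)
  | Sum e b => Sum (lift d e) (lift d.+1 b)
  end.

Lemma eval_lift c e d s : eval c (lift d e) s = eval c e (take d s ++ drop d.+1 s).
Proof.
elim: e d s => //= [i|i e IH|e1 IH1 e2 IH2|e1 IH1 e2 IH2|e1 IH1 e2 IH2] d s;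
  rewrite ?IH ?IH1 ?IH2 //; last by apply: eq_bigr => i _; rewrite IH2.
rewrite nth_cat size_take nth_drop; case: (ltnP d (size s)) => ds.
  case: (ltnP i d) => id; first by rewrite nth_take.
  by congr nth; lia.
case: (ltnP i d) => id.
  case: (ltnP i (size s)) => si; first by rewrite nth_take.
  by rewrite !nth_default //; lia.
have -> : (i < size s) = false by lia.
by rewrite !nth_default //; lia.
Qed.

Fixpoint tsubst (ts : seq term) (e : term) : term :=
  match e with
  | One => One
  | Var i => nth Zero ts i
  | Len i => Len i
  | Bit i e => Bit i (tsubst ts e)
  | Add e1 e2 => Add (tsubst ts e1) (tsubst ts e2)
  | Le e1 e2 => Le (tsubst ts e1) (tsubst ts e2)
  | Sum e b => Sum (tsubst ts e) (tsubst (Var 0 :: map (lift 0) ts) b)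
  end.

Lemma eval_subst c e ts s : eval c (tsubst ts e) s = eval c e [seq eval c t s | t <- ts].
Proof.
elim: e ts s => //= [i|i e IH|e1 IH1 e2 IH2|e1 IH1 e2 IH2|e1 IH1 e2 IH2] ts s;
  rewrite ?IH ?IH1 ?IH2 //.
  by elim: ts i => [|t ts IHt] [|i] //=.
apply: eq_bigr => i _; rewrite IH2 /= -map_comp; congr (eval _ _ (_ :: _)).
by apply: eq_map => t /=; rewrite eval_lift take0 /= drop0.
Qed.

Definition ctx := nat -> word.

(* In a context the words number 1, 2, 3 are y, z, x, which are indexed by the
   ordinals 0, 1, 2 in terms. *)
Definition dfn (F : ctx -> seq nat -> nat) : Prop :=
  exists e, forall c s, eval c e s = F c s.

Definition dfnb (P : ctx -> seq nat -> bool) : Prop :=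
  dfn (fun c s => nat_of_bool (P c s)).

Lemma dfn_ext F G : dfn F -> (forall c s, F c s = G c s) -> dfn G.
Proof. by case=> e eF FG; exists e => c s; rewrite eF. Qed.

(** Variables have the form in which the bodies of sums, stated through [head] and [behead], mention
    them. *)
Lemma dfn_var n : dfn (fun c s => head 0 (iter n behead s)).
Proof.
exists (Var n) => c s /=.
by elim: n s => [|n IHn] [|x s] //=; rewrite -?iterS ?iterSr //= ?IHn ?nth_nil // -IHn nth_nil.
Qed.

Lemma dfn_one : dfn (fun _ _ => 1). Proof. by exists One. Qed.

Lemma dfn_add F G : dfn F -> dfn G -> dfn (fun c s => F c s + G c s).
Proof. by case=> e eF [f eG]; exists (Add e f) => c s /=; rewrite eF eG. Qed.

Lemma dfn_le F G : dfn F -> dfn G -> dfnb (fun c s => F c s <= G c s).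
Proof. by case=> e eF [f eG]; exists (Le e f) => c s /=; rewrite eF eG. Qed.

Lemma dfn_S F : dfn F -> dfn (fun c s => (F c s).+1).
Proof. by move=> dF; apply: dfn_ext (dfn_add dF dfn_one) _ => c s; rewrite addn1. Qed.

Lemma dfn_const n : dfn (fun _ _ => n).
Proof.
elim: n => [|n IHn]; last exact: dfn_S.
by apply: dfn_ext (dfn_le (dfn_S dfn_one) dfn_one) _.
Qed.

Lemma dfn_weak F : dfn F -> dfn (fun c s => F c (behead s)).
Proof.
by case=> e eF; exists (lift 0 e) => c s; rewrite eval_lift take0 eF drop1.
Qed.

Lemma dfn_sum F (B : ctx -> seq nat -> nat -> nat) : dfn F ->
  dfn (fun c s => B c (behead s) (head 0 s)) -> dfn (fun c s => \sum_(i < F c s) B c s i).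
Proof.
case=> e eF [b eB]; exists (Sum e b) => c s /=; rewrite eF.
by apply: eq_bigr => i _; rewrite eB.
Qed.

Lemma dfn_sum_nat F (B : ctx -> seq nat -> nat -> nat) : dfn F ->
  dfn (fun c s => B c (behead s) (head 0 s)) ->
  dfn (fun c s => \sum_(0 <= i < F c s) B c s i).
Proof.
by move=> dF dB; apply: dfn_ext (dfn_sum (B := B) dF dB) _ => c s; rewrite big_mkord.
Qed.

Lemma dfn_mul F G : dfn F -> dfn G -> dfn (fun c s => F c s * G c s).
Proof.
move=> dF dG; apply: dfn_ext (dfn_sum (B := fun c s _ => G c s) dF (dfn_weak dG)) _ => c s.
by rewrite sum_nat_const card_ord.
Qed.

Lemma dfnb_and P Q : dfnb P -> dfnb Q -> dfnb (fun c s => P c s && Q c s).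
Proof. by move=> dP dQ; apply: dfn_ext (dfn_mul dP dQ) _ => c s; rewrite mulnb. Qed.

Lemma dfnb_not P : dfnb P -> dfnb (fun c s => ~~ P c s).
Proof.
by move=> dP; apply: dfn_ext (dfn_le dP (dfn_const 0)) _ => c s; case: (P c s).
Qed.

Lemma dfnb_or P Q : dfnb P -> dfnb Q -> dfnb (fun c s => P c s || Q c s).
Proof.
move=> dP dQ; apply: dfn_ext (dfnb_not (dfnb_and (dfnb_not dP) (dfnb_not dQ))) _ => c s.
by rewrite negb_and !negbK.
Qed.

Lemma dfnb_imp P Q : dfnb P -> dfnb Q -> dfnb (fun c s => P c s ==> Q c s).
Proof.
by move=> dP dQ; apply: dfn_ext (dfnb_or (dfnb_not dP) dQ) _ => c s; rewrite implybE.
Qed.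

Lemma dfnb_eqb P Q : dfnb P -> dfnb Q -> dfnb (fun c s => P c s == Q c s).
Proof.
move=> dP dQ; apply: dfn_ext (dfnb_and (dfnb_imp dP dQ) (dfnb_imp dQ dP)) _ => c s.
by case: (P c s); case: (Q c s).
Qed.

Lemma dfnb_const b : dfnb (fun _ _ => b).
Proof. exact: dfn_const. Qed.

Lemma dfnb_eq F G : dfn F -> dfn G -> dfnb (fun c s => F c s == G c s).
Proof.
move=> dF dG; apply: dfn_ext (dfnb_and (dfn_le dF dG) (dfn_le dG dF)) _ => c s.
by rewrite eqn_leq.
Qed.

Lemma dfn_if P F G : dfnb P -> dfn F -> dfn G -> dfn (fun c s => if P c s then F c s else G c s).
Proof.
move=> dP dF dG.
apply: dfn_ext (dfn_add (dfn_mul dP dF) (dfn_mul (dfnb_not dP) dG)) _ => c s.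
by case: (P c s); rewrite /= mul1n mul0n ?addn0.
Qed.

Lemma dfnb_if P Q R : dfnb P -> dfnb Q -> dfnb R -> dfnb (fun c s => if P c s then Q c s else R c s).
Proof.
by move=> dP dQ dR; apply: dfn_ext (dfn_if dP dQ dR) _ => c s; case: (P c s).
Qed.

Lemma dfnb_has F (P : ctx -> seq nat -> nat -> bool) : dfn F ->
  dfnb (fun c s => P c (behead s) (head 0 s)) ->
  dfnb (fun c s => has (P c s) (iota 0 (F c s))).
Proof.
move=> dF dP; apply: dfn_ext (dfn_le dfn_one (dfn_sum (B := fun c s i => P c s i) dF dP)) _.
move=> c s; rewrite has_count -sum1_count.
rewrite -[in RHS](subn0 (F c s)) -/(index_iota 0 (F c s)) big_mkord.
by congr (nat_of_bool (0 < _)); rewrite [RHS]big_mkcond; apply: eq_bigr => i _; case: (P c s i).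
Qed.

Lemma dfnb_all F (P : ctx -> seq nat -> nat -> bool) : dfn F ->
  dfnb (fun c s => P c (behead s) (head 0 s)) ->
  dfnb (fun c s => all (P c s) (iota 0 (F c s))).
Proof.
move=> dF dP; have dnP := dfnb_not dP.
have H := dfnb_has (P := fun c s i => ~~ P c s i) dF dnP.
apply: dfn_ext (dfnb_not H) _.
by move=> c s; rewrite -all_predC; congr nat_of_bool; apply: eq_all => i /=; rewrite negbK.
Qed.

(** The truncated difference of [a] and [b] is the number of [i < a] with [b + i < a]. *)
Lemma dfn_sub F G : dfn F -> dfn G -> dfn (fun c s => F c s - G c s).
Proof.
move=> dF dG; apply: dfn_ext (dfn_sum (B := fun c s i => G c s + i < F c s) dF _) _.
  exact: dfn_le (dfn_S (dfn_add (dfn_weak dG) (dfn_var 0))) (dfn_weak dF).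
move=> c s; move: (F c s) (G c s) => a b.
have -> : \sum_(i < a) (b + i < a) = \sum_(i < a | i < a - b) 1.
  by rewrite [RHS]big_mkcond; apply: eq_bigr => i _; rewrite ltn_subRL; case: ifP.
by rewrite (big_ord_narrow (leq_subr b a)) sum1_card card_ord.
Qed.

Lemma dfn_pred F : dfn F -> dfn (fun c s => (F c s).-1).
Proof. by move=> dF; apply: dfn_ext (dfn_sub dF dfn_one) _ => c s; rewrite subn1. Qed.

(** The quotient of [a] by a positive [b] is the number of [i < a] with [i.+1 * b <= a]; the factor
    [1 <= b] covers division by zero. *)
Lemma dfn_div F G : dfn F -> dfn G -> dfn (fun c s => F c s %/ G c s).
Proof.
move=> dF dG; apply: dfn_ext (dfn_mul (dfn_le dfn_one dG)
  (dfn_sum (B := fun c s i => i.+1 * G c s <= F c s) dF _)) _.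
  exact: dfn_le (dfn_mul (dfn_S (dfn_var 0)) (dfn_weak dG)) (dfn_weak dF).
move=> c s; move: (F c s) (G c s) => a [|b] //; rewrite mul1n.
have le_d : a %/ b.+1 <= a by apply: leq_div.
have -> : \sum_(i < a) (i.+1 * b.+1 <= a) = \sum_(i < a | i < a %/ b.+1) 1.
  by rewrite [RHS]big_mkcond; apply: eq_bigr => i _; rewrite leq_divRL //; case: ifP.
by rewrite (big_ord_narrow le_d) sum1_card card_ord.
Qed.

Lemma dfn_mod F G : dfn F -> dfn G -> dfn (fun c s => F c s %% G c s).
Proof.
move=> dF dG; apply: dfn_ext (dfn_sub dF (dfn_mul (dfn_div dF dG) dG)) _ => c s.
by rewrite {1}(divn_eq (F c s) (G c s)) addKn.
Qed.

Lemma dfn_len (i : 'I_3) : dfn (fun c s => size (c i.+1)).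
Proof. by exists (Len i). Qed.

Lemma dfn_bit (i : 'I_3) F : dfn F -> dfnb (fun c s => nth false (c i.+1) (F c s)).
Proof. by case=> e eF; exists (Bit i e) => c s /=; rewrite eF. Qed.

(** Composition by substitution, for predicates whose definability is known only at variables. *)
Lemma dfn_app2 (g : ctx -> nat -> nat -> nat) F1 F2 :
  dfn (fun c s => g c (head 0 s) (head 0 (behead s))) ->
  dfn F1 -> dfn F2 -> dfn (fun c s => g c (F1 c s) (F2 c s)).
Proof.
case=> e eg [f1 e1] [f2 e2]; exists (tsubst [:: f1; f2] e) => c s.
by rewrite eval_subst eg /= e1 e2.
Qed.

Lemma dfn_nth_nil D F : dfn D -> dfn (fun c s => nth (D c s) [::] (F c s)).
Proof. by move=> dD; apply: dfn_ext dD _ => c s; rewrite nth_nil. Qed.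

Lemma dfn_nth_cons D F G (L : ctx -> seq nat -> seq nat) : dfn F -> dfn G ->
  dfn (fun c s => nth (D c s) (L c s) (F c s).-1) ->
  dfn (fun c s => nth (D c s) (G c s :: L c s) (F c s)).
Proof.
move=> dF dG dL; apply: dfn_ext (dfn_if (dfnb_eq dF (dfn_const 0)) dG dL) _ => c s.
by case: (F c s).
Qed.

(** Here the list does not depend on the input, so the disjunction is written out in the term. The
    finitely many labels of a fixed machine are handled in this way. *)
Lemma dfnb_has_const A (P : A -> ctx -> seq nat -> bool) (r : seq A) :
  (forall a, dfnb (P a)) -> dfnb (fun c s => has (fun a => P a c s) r).
Proof.
move=> dP; elim: r => [|a r IHr] /=; first exact: dfnb_const.
exact: dfnb_or.
Qed.

Lemma dfn_poly (p : {poly nat}) F : dfn F -> dfn (fun c s => p.[F c s]%R).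
Proof.
move=> dF; elim/poly_ind: p => [|p a IHp].
  by apply: dfn_ext (dfn_const 0) _ => c s; rewrite horner0.
apply: dfn_ext (dfn_add (dfn_mul IHp dF) (dfn_const a)) _ => c s.
by rewrite hornerMXaddC.
Qed.

(** * Forests *)

Section Forests.

Variables (V : finType) (G : sgraph V).

(* The neighbour of smaller rank is the parent. *)
Definition ranking (rk : V -> nat) : Prop :=
  (forall u v, G u v -> rk u != rk v) /\
  (forall u v w, G u v -> G u w -> rk v < rk u -> rk w < rk u -> v = w).

(** On a cycle of length at least 3, a vertex of largest rank would have two different neighbours of
    smaller rank. *)
Lemma ranking_forest rk : ranking rk -> is_forest G.
Proof.
move=> [rk_neq rk_par] c; case: c => // x0 c0; set c := x0 :: c0 => cyc_c.
have [u uc max_u] : exists2 u, u \in c & forall v, v \in c -> rk v <= rk u.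
  case: (@arg_maxnP _ x0 (mem c) rk (mem_head _ _)) => u uc mu.
  by exists u => // v /mu.
have [i s rot_c] := rot_to uc.
have := cyc_c; rewrite -(rot_ucycle i) rot_c => /andP[cyc uniq_s].
rewrite -(size_rot i) rot_c.
have mem_s v : v \in u :: s -> rk v <= rk u by rewrite -rot_c mem_rot; apply: max_u.
case: s cyc uniq_s mem_s {rot_c} => // a s /=; rewrite rcons_path => /and3P[ua _ zu] us mem_s.
case: s zu us mem_s => // b s zu us mem_s.
have lt v : v \in [:: u, a, b & s] -> G u v -> rk v < rk u.
  by move=> /mem_s le uv; rewrite ltn_neqAle le andbT eq_sym rk_neq.
have az : a = last b s.
  have uz : G u (last b s) by rewrite adj_sym.
  apply: (rk_par u) => //; apply: lt => //; first by rewrite !inE eqxx orbT.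
  by rewrite 2!inE mem_last !orbT.
by move: us; rewrite /= az mem_last andbF.
Qed.

(** If every vertex of [A] had two neighbours in [A], a path could be prolonged at its front for
    ever: a neighbour of the front other than the second vertex is new, since otherwise a cycle
    closes. The length of the path then exceeds the number of vertices. *)
Lemma forest_leaf (A : {set V}) : is_forest G -> A != set0 ->
  exists2 v, v \in A & forall x y, x \in A -> y \in A -> G v x -> G v y -> x = y.
Proof.
move=> forestG /set0Pn[a0 Aa0].
have [/existsP[v /andP[Av /forallP leaf]]|no_leaf] := boolP [exists v : V, (v \in A) &&
    [forall x, forall y, [&& x \in A, y \in A, G v x & G v y] ==> (x == y)]].
  exists v => // x y Ax Ay vx vy; apply/eqP; have /forallP/(_ y)/implyP := leaf x; apply.
  exact/and4P.
have two v : v \in A -> forall x, exists2 w, w \in A & G v w && (w != x).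
  move=> Av x; move: no_leaf => /existsPn/(_ v); rewrite Av /=.
  move=> /forallPn[w /forallPn[w']]; rewrite negb_imply => /andP[/and4P[Aw Aw' vw vw'] ww'].
  case: (eqVneq w x) => [wx|wx]; last by exists w; rewrite ?vw.
  by exists w' => //; rewrite vw' -wx eq_sym.
have long n : exists v p, [/\ size p = n, {subset v :: p <= A}, uniq (v :: p) & path G v p].
  elim: n => [|n [v [p [szp pA up pathp]]]].
    by exists a0, [::]; split=> // x; rewrite inE => /eqP->.
  have Av : v \in A by apply: pA; rewrite mem_head.
  have [w Aw /andP[vw neq]] := two v Av (head v p).
  have wv : w != v by apply/eqP => wv; rewrite wv adj_irr in vw.
  case: (boolP (w \in p)) => wp; last first.
    exists w, (v :: p); split.
    - by rewrite /= szp.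
    - by move=> x; rewrite inE => /predU1P[->|/pA].
    - by rewrite cons_uniq inE negb_or wv wp.
    - by rewrite /= adj_sym vw.
  case/splitPr: wp up pathp neq {szp pA} => p1 p2 up pathp neq.
  case: p1 up pathp neq => [|b p1] up pathp neq; first by rewrite /= eqxx in neq.
  have := forestG (v :: rcons (b :: p1) w); rewrite /= size_rcons.
  suff cyc : ucycle G (v :: rcons (b :: p1) w) by move/(_ cyc).
  apply/andP; split.
    rewrite /cycle rcons_path last_rcons adj_sym vw andbT.
    by move: pathp; rewrite -cat_rcons cat_path => /andP[].
  by move: up; rewrite -cat_rcons -cat_cons cat_uniq => /andP[].
have [v [p [szp _ up _]]] := long #|V|.
by have := max_card (mem (v :: p)); rewrite (card_uniqP up) /= szp ltnn.
Qed.

(** A leaf is removed and receives the largest rank, so that its only remaining neighbour becomes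
    its parent. The bound on the ranks is what allows them to be part of a certificate. *)
Lemma forest_ranking : is_forest G -> exists2 rk, ranking rk & forall v, rk v < #|V|.
Proof.
move=> forestG.
have [rk [rkA _ [rkG1 rkG2]]] : exists rk : V -> nat,
    [/\ {in [set: V], forall v, rk v < #|[set: V]|}, {in [set: V] &, injective rk} &
      (forall u v, u \in [set: V] -> v \in [set: V] -> G u v -> rk u != rk v) /\
      (forall u v w, u \in [set: V] -> v \in [set: V] -> w \in [set: V] ->
         G u v -> G u w -> rk v < rk u -> rk w < rk u -> v = w)].
  move: [set: V] => A; move En: #|A| => n.
  elim: n A En => [|n IHn] A cA.
    move/eqP: cA; rewrite cards_eq0 => /eqP ->.
    exists (fun=> 0); split=> [v|u v|]; rewrite ?inE //.
    by split=> [u v|u v w]; rewrite inE.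
  have A0 : A != set0 by rewrite -cards_eq0 cA.
  have [v Av leaf] := forest_leaf forestG A0.
  have cAv : #|A :\ v| = n by have := cardsD1 v A; rewrite Av cA => -[].
  have [rk [lt_rk inj_rk [neq_rk par_rk]]] := IHn _ cAv.
  pose rk' u := if u == v then n else rk u.
  have rkv u : u != v -> u \in A -> rk u < n.
    by move=> uv uA; apply: lt_rk; rewrite !inE uv.
  exists rk'; split.
  - by move=> u uA; rewrite /rk'; case: eqVneq => // uv; rewrite ltnW // ltnS rkv.
  - move=> u w uA wA; rewrite /rk'; case: (eqVneq u v) => [->|uv]; case: (eqVneq w v) => [->|wv] //.
    + by move=> E; have := rkv w wv wA; rewrite -E ltnn.
    + by move=> E; have := rkv u uv uA; rewrite E ltnn.
    + by apply: inj_rk; rewrite !inE ?uv ?wv.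
  - split=> [u w uA wA uw|u w w' uA wA wA' uw uw'].
      rewrite /rk'; case: (eqVneq u v) => [uv|uv]; case: (eqVneq w v) => [wv|wv].
      + by rewrite uv wv adj_irr in uw.
      + by rewrite gtn_eqF // rkv.
      + by rewrite ltn_eqF // rkv.
      + by apply: neq_rk uw; rewrite !inE ?uv ?wv.
    rewrite /rk'; case: (eqVneq u v) => [uv|uv].
      by rewrite uv in uw uw' => _ _; apply: leaf.
    have ltu := rkv u uv uA.
    case: (eqVneq w v) => [wv|wv]; first by rewrite ltnNge (ltnW ltu).
    case: (eqVneq w' v) => [wv'|wv']; first by rewrite [n < _]ltnNge (ltnW ltu).
    by apply: par_rk; rewrite ?inE ?uv ?wv ?wv'.
exists rk; last by move=> v; rewrite -cardsT; apply: rkA; rewrite inE.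
split=> [u v|u v w]; first by apply: rkG1; rewrite inE.
by apply: rkG2; rewrite inE.
Qed.

End Forests.

Ltac solve_neq := repeat match goal with
  | H : is_true (_ && _) |- _ => case/andP: H => ? ?
  | H : is_true (_ != _) |- _ => move/eqP: H => H
  end; repeat (apply/andP; split); apply/eqP; congruence.

(** * Gadgets *)

Section Gadgets.

Variable T : eqType.
Implicit Types (A B L W Q : seq T) (a b r x y : T).

Definition triple L := uniq L && (size L == 3).

Lemma pick_avoid L (D : seq T) : uniq L -> size D < size L -> exists2 x, x \in L & x \notin D.
Proof.
move=> uL ltDL; case: (boolP (has (fun x => x \notin D) L)) => [/hasP[x]|]; first by exists x.
rewrite -all_predC => /allP sLD; suff: size L <= size D by rewrite leqNgt ltDL.
by apply: uniq_leq_size => // x /sLD /=; rewrite negbK.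
Qed.

Lemma pick1 L x : triple L -> exists2 y, y \in L & y != x.
Proof.
move=> /andP[uL /eqP sL]; have [|y yL] := @pick_avoid L [:: x] uL; first by rewrite sL.
by rewrite inE; exists y.
Qed.

Lemma pick2 L x x' : triple L -> exists2 y, y \in L & (y != x) && (y != x').
Proof.
move=> /andP[uL /eqP sL]; have [|y yL] := @pick_avoid L [:: x; x'] uL; first by rewrite sL.
by rewrite !inE negb_or; exists y.
Qed.

(* The triangle w1 w2 w3 with w1, w2, w3 attached to u, t and to a vertex of
   colour r excludes only one pair of colours (s, d) of (u, t). *)
Lemma triangle_wire W1 W2 W3 r : triple W1 -> triple W2 -> triple W3 ->
  exists s d, forall cu ct, (cu != s) || (ct != d) -> exists w1 w2 w3,
    [/\ w1 \in W1, w2 \in W2 & w3 \in W3] /\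
    [&& w1 != w2, w2 != w3, w1 != w3, w1 != cu, w2 != ct & w3 != r].
Proof.
move=> tW1 tW2 tW3; have [p pW pr] := pick1 r tW3; have [q qW /andP[qr qp]] := pick2 r p tW3.
have [s sW /andP[sp sq]] := pick2 p q tW1; have [d dW /andP[dp dq]] := pick2 p q tW2.
exists s, d => cu ct /orP[cus|ctd].
  have [w2 w2W /andP[w2t w2s]] := pick2 ct s tW2.
  case: (eqVneq w2 p) => [w2p|w2p].
    by exists s, w2, q; split=> //; solve_neq.
  by exists s, w2, p; split=> //; solve_neq.
have [w1 w1W /andP[w1u w1d]] := pick2 cu d tW1.
case: (eqVneq w1 p) => [w1p|w1p].
  by exists w1, d, q; split=> //; solve_neq.
by exists w1, d, p; split=> //; solve_neq.
Qed.

(** If [a] and [b] are the only colours left at a vertex, its two neighbours of colours [x] and [y]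
    use up both. *)
Definition blocked a b x y := (a == x) && (b == y) || (a == y) && (b == x).

Lemma blocked_neq a b x y : a != b -> blocked a b x y -> x <> y.
Proof. by rewrite /blocked; repeat (case: eqP => ? //=); congruence. Qed.

Lemma blocked_other a b x y x' y' :
  blocked a b x y -> blocked a b x' y' -> x' != x -> y' = x.
Proof. by rewrite /blocked; repeat (case: eqP => ? //=); congruence. Qed.

Lemma blocked_same a b x y y' : a != b -> blocked a b x y -> blocked a b x y' -> y = y'.
Proof. by rewrite /blocked; repeat (case: eqP => ? //=); congruence. Qed.

Lemma pick_unblocked L a b x y : a \in L -> b \in L -> a != b -> ~~ blocked a b x y ->
  exists2 q, q \in L & (q != x) && (q != y).
Proof.
move=> aL bL ab nbl; case: (boolP ((a != x) && (a != y))) => [na|na]; first by exists a.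
exists b => //; move: na nbl ab; rewrite /blocked.
by repeat (case: eqP => ? //=); congruence.
Qed.

(* An edge whose ends have three and two colours left can be coloured by at least
   three different pairs, and a page excludes at most one of them. *)
Lemma edge_two_pages A b1 b2 Q0 Q1 d0 d1 : triple A -> triple Q0 -> triple Q1 -> b1 != b2 ->
  exists a b q0 q1, [/\ a \in A, b \in [:: b1; b2], q0 \in Q0 & q1 \in Q1] /\
    [&& a != b, q0 != a, q0 != b, q1 != a, q1 != b, q0 != d0 & q1 != d1].
Proof.
move=> tA tQ0 tQ1 b12.
suff: exists a b, [/\ a \in A, b \in [:: b1; b2], a != b,
    exists2 q, q \in filter (predC1 d0) Q0 & (q != a) && (q != b) &
    exists2 q, q \in filter (predC1 d1) Q1 & (q != a) && (q != b)].
  move=> [a [b [aA bb ab [q0 + /andP[q0a q0b]] [q1 + /andP[q1a q1b]]]]].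
  rewrite !mem_filter /= => /andP[q0d q0Q] /andP[q1d q1Q].
  exists a, b, q0, q1; split=> //.
  by rewrite ab q0a q0b q1a q1b q0d q1d.
have two Q d : triple Q -> exists p p', [/\ p \in filter (predC1 d) Q,
    p' \in filter (predC1 d) Q & p != p'].
  move=> tQ; have [p pQ pd] := pick1 d tQ; have [p' p'Q /andP[p'd p'p]] := pick2 d p tQ.
  by exists p, p'; rewrite !mem_filter /= pd p'd eq_sym.
have [p0 [p0' [P0 P0' pp0]]] := two Q0 d0 tQ0; have [p1 [p1' [P1 P1' pp1]]] := two Q1 d1 tQ1.
suff [a [b [aA bb ab B0 B1]]] : exists a b, [/\ a \in A, b \in [:: b1; b2], a != b,
    ~~ blocked p0 p0' a b & ~~ blocked p1 p1' a b].
  exists a, b; split=> //.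
    exact: pick_unblocked P0 P0' pp0 B0.
  exact: pick_unblocked P1 P1' pp1 B1.
(* If [b] lies outside the pair of one page, that page is never blocked, and [a] has to miss only
   [b] and at most one colour on account of the other page. *)
have free u u' v v' b : u != u' -> v != v' -> b \in [:: b1; b2] -> b != u -> b != u' ->
    exists a, [/\ a \in A, a != b, ~~ blocked u u' a b & ~~ blocked v v' a b].
  move=> uu vv bb bu bu'; have [a aA /andP[ab av]] := pick2 b (if b == v then v' else v) tA.
  exists a; split=> //; rewrite /blocked; move: bu bu' ab av vv; clear.
    by repeat (case: eqP => ? //=); congruence.
  by case: (eqVneq b v) => ?; repeat (case: eqP => ? //=); congruence.
have b1b : b1 \in [:: b1; b2] by rewrite mem_head.
have b2b : b2 \in [:: b1; b2] by rewrite !inE eqxx orbT.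
have try b u u' v v' : b \in [:: b1; b2] -> u != u' -> v != v' -> (b != u) && (b != u') ->
    exists a b, [/\ a \in A, b \in [:: b1; b2], a != b,
      ~~ blocked u u' a b & ~~ blocked v v' a b].
  move=> bb uu vv /andP[bu bu']; have [a [aA ab B0 B1]] := free u u' v v' b uu vv bb bu bu'.
  by exists a, b.
case: (boolP ((b1 != p0) && (b1 != p0'))) => [nb|b1p0]; first exact: try nb.
case: (boolP ((b2 != p0) && (b2 != p0'))) => [nb|b2p0]; first exact: try nb.
case: (boolP ((b1 != p1) && (b1 != p1'))) => [nb|b1p1].
  by have [a [b [? ? ? ? ?]]] := try _ _ _ _ _ b1b pp1 pp0 nb; exists a, b.
case: (boolP ((b2 != p1) && (b2 != p1'))) => [nb|b2p1].
  by have [a [b [? ? ? ? ?]]] := try _ _ _ _ _ b2b pp1 pp0 nb; exists a, b.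
(* Now [b1] and [b2] lie in both pairs, so each pair is made of these two colours; a third colour
   for [a] blocks neither page. *)
have [a aA /andP[ab1 ab2]] := pick2 b1 b2 tA; exists a, b1; split=> //.
  by move: ab1 ab2 b1p0 b2p0 b12; rewrite /blocked; clear;
    repeat (case: eqP => ? //=); congruence.
by move: ab1 ab2 b1p1 b2p1 b12; rewrite /blocked; clear;
  repeat (case: eqP => ? //=); congruence.
Qed.

(** [DA] and [DB] are the colours that the ends lose to wires and to the root, [d0] and [d1] the
    emitting colours of the pages, and [val] tells whether the output may be true. If it is false,
    one end loses nothing and the other at most one colour, which is the situation of
    [edge_two_pages]; if it is true, the pages need no protection. *)
Lemma gate A B Q0 Q1 (DA DB : seq T) d0 d1 (val : bool) :
  triple A -> triple B -> triple Q0 -> triple Q1 -> size DA <= 2 -> size DB <= 1 ->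
  (~~ val -> DA = [::] \/ (size DA <= 1 /\ DB = [::])) ->
  exists a b q0 q1, [/\ a \in A, b \in B, q0 \in Q0 & q1 \in Q1] /\
    [&& a \notin DA, b \notin DB, a != b, q0 != a, q0 != b, q1 != a, q1 != b,
        val || (q0 != d0) & val || (q1 != d1)].
Proof.
move=> tA tB tQ0 tQ1 sDA sDB; case: val => [_|/(_ isT) sD].
  have [/andP[uA /eqP sA] /andP[uB /eqP sB]] := (tA, tB).
  have [|a aA aD] := @pick_avoid A DA uA; first by rewrite sA.
  have [|b bB] := @pick_avoid B (a :: DB) uB; first by rewrite sB.
  rewrite inE negb_or => /andP[ba bD].
  have [q0 q0Q /andP[q0a q0b]] := pick2 a b tQ0; have [q1 q1Q /andP[q1a q1b]] := pick2 a b tQ1.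
  by exists a, b, q0, q1; split=> //; rewrite aD bD eq_sym ba q0a q0b q1a q1b.
have two L (D : seq T) : triple L -> size D <= 1 -> exists x y,
    [/\ x != y, x \in L, y \in L, x \notin D & y \notin D].
  move=> /andP[uL /eqP sL] sD1; have [|x xL xD] := @pick_avoid L D uL; first by rewrite sL; lia.
  have [|y yL] := @pick_avoid L (x :: D) uL; first by rewrite sL /=; lia.
  by rewrite inE negb_or => /andP[yx yD]; exists x, y; rewrite eq_sym.
case: sD => [DA0|[sDA1 DB0]].
  have [b1 [b2 [b12 B1 B2 D1 D2]]] := two B DB tB sDB.
  have [a [b [q0 [q1 [[aA bb Hq0 Hq1] /and5P[ab q0a q0b q1a /and3P[q1b q0d q1d]]]]]]] :=
    edge_two_pages d0 d1 tA tQ0 tQ1 b12.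
  have [bB bD] : b \in B /\ b \notin DB by move: bb; rewrite !inE => /orP[]/eqP->.
  by exists a, b, q0, q1; split=> //; rewrite DA0 bD ab q0a q0b q1a q1b q0d q1d.
have [a1 [a2 [a12 A1 A2 D1 D2]]] := two A DA tA sDA1.
have [b [a [q0 [q1 [[bB aa Hq0 Hq1] /and5P[ab q0b q0a q1b /and3P[q1a q0d q1d]]]]]]] :=
  edge_two_pages d0 d1 tB tQ0 tQ1 a12.
have [aA aD] : a \in A /\ a \notin DA by move: aa; rewrite !inE => /orP[]/eqP->.
by exists a, b, q0, q1; split=> //; rewrite DB0 aD eq_sym ab q0a q0b q1a q1b q0d q1d.
Qed.

(* In a 4-cycle with lists of size two, the forced colour of a vertex and the
   forced colour of the opposite vertex exclude each other. *)
Lemma forall_cycle T1 N1 T0 N2 r h1 h0 :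
  triple T1 -> triple N1 -> triple T0 -> triple N2 ->
  exists (z : bool) t1 n1 t0 n2, [/\ t1 \in T1, n1 \in N1, t0 \in T0 & n2 \in N2] /\
    [&& t1 != r, n1 != r, t0 != r & n2 != r] /\
    [&& t1 != n1, n1 != t0, t0 != n2, n2 != t1 & (if z then t0 != h0 else t1 != h1)].
Proof.
move=> tT1 tN1 tT0 tN2.
have [x xT /andP[xr xh]] := pick2 r h1 tT1; have [x' xT' /andP[xr' xx]] := pick2 r x tT1.
have [y1 y1T y1r] := pick1 r tT0; have [y2 y2T /andP[y2r y21]] := pick2 r y1 tT0.
have two L : triple L -> exists p p', [/\ p \in filter (predC1 r) L,
    p' \in filter (predC1 r) L & p != p'].
  move=> tQ; have [p pQ pd] := pick1 r tQ; have [p' p'Q /andP[p'd p'p]] := pick2 r p tQ.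
  by exists p, p'; rewrite !mem_filter /= pd p'd eq_sym.
have [n [n' [nN nN' nn]]] := two N1 tN1; have [m [m' [mN mN' mm]]] := two N2 tN2.
have extend t1 t0 (z : bool) : t1 \in T1 -> t0 \in T0 -> t1 != r -> t0 != r ->
    ~~ blocked n n' t1 t0 -> ~~ blocked m m' t1 t0 -> (if z then t0 != h0 else t1 != h1) ->
    exists (z : bool) t1 n1 t0 n2, [/\ t1 \in T1, n1 \in N1, t0 \in T0 & n2 \in N2] /\
    [&& t1 != r, n1 != r, t0 != r & n2 != r] /\
    [&& t1 != n1, n1 != t0, t0 != n2, n2 != t1 & (if z then t0 != h0 else t1 != h1)].
  move=> t1T t0T t1r t0r bn bm hz.
  have [n1 + /andP[n1t1 n1t0]] := pick_unblocked nN nN' nn bn.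
  have [n2 + /andP[n2t1 n2t0]] := pick_unblocked mN mN' mm bm.
  rewrite !mem_filter /= => /andP[n2r n2N] /andP[n1r n1N].
  exists z, t1, n1, t0, n2; split=> //; rewrite t1r n1r t0r n2r n1t0 n2t1 hz.
  by rewrite ![_ == n1]eq_sym n1t1 ![_ == n2]eq_sym n2t0.
(* The colour [x] for [t1] emits no signal. If it fails with both [y1] and [y2], it fails at
   different neighbours, whose pairs are then [x, y1] and [x, y2]; so [x'] is compatible with [y1]
   and with [y2], and one of these emits no signal at [t0]. *)
case: (boolP (blocked n n' x y1 || blocked m m' x y1)) => [bl1|]; last first.
  by move=> /norP[? ?]; apply: (extend x y1 false).
case: (boolP (blocked n n' x y2 || blocked m m' x y2)) => [bl2|]; last first.
  by move=> /norP[? ?]; apply: (extend x y2 false).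
have [y [yT yr yh yy]] : exists y, [/\ y \in T0, y != r, y != h0 & (y == y1) || (y == y2)].
  case: (eqVneq y1 h0) => [E|?]; last by exists y1; rewrite eqxx.
  by exists y2; rewrite eqxx orbT -E.
have free k k' i j : k != k' -> blocked k k' x i -> j = y1 \/ j = y2 ->
    x <> y1 -> x <> y2 -> ~~ blocked k k' x' j.
  move=> kk ki jy n1 n2; apply/negP => /(blocked_other ki)/(_ xx) E.
  by case: jy; congruence.
have yy' : y = y1 \/ y = y2 by case/orP: yy => /eqP; [left | right].
case/orP: bl1 => bl1; case/orP: bl2 => bl2.
- by rewrite (blocked_same nn bl1 bl2) eqxx in y21.
- have [n1 n2] := (blocked_neq nn bl1, blocked_neq mm bl2).
  by apply: (extend x' y true) => //; [apply: free nn bl1 _ _ _ | apply: free mm bl2 _ _ _].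
- have [n1 n2] := (blocked_neq mm bl1, blocked_neq nn bl2).
  by apply: (extend x' y true) => //; [apply: free nn bl2 _ _ _ | apply: free mm bl1 _ _ _].
- by rewrite (blocked_same mm bl1 bl2) eqxx in y21.
Qed.

(** Besides the root, only an end whose bit may not be set has to avoid its signal; the other end
    still has two colours and adapts. *)
Lemma exists_edge T1 T0 r h1 h0 (b1 b0 : bool) : triple T1 -> triple T0 -> b1 || b0 ->
  exists t1 t0, [/\ t1 \in T1 & t0 \in T0] /\
    [&& t1 != r, t0 != r, t1 != t0, b1 || (t1 != h1) & b0 || (t0 != h0)].
Proof.
move=> tT1 tT0; case: b0 => [_|]; last rewrite orbF => ->.
  have [t1 t1T /andP[t1r t1h]] := pick2 r h1 tT1; have [t0 t0T /andP[t0r t01]] := pick2 r t1 tT0.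
  by exists t1, t0; split=> //; rewrite t1r t0r eq_sym t01 t1h orbT.
have [t0 t0T /andP[t0r t0h]] := pick2 r h0 tT0; have [t1 t1T /andP[t1r t01]] := pick2 r t0 tT1.
by exists t1, t0; split=> //; rewrite t1r t0r t01 t0h.
Qed.

End Gadgets.

(** * From games to graphs *)

Section Game.

Variables (N : nat) (ax kill univ exis : pred nat) (rule : nat -> nat -> nat -> bool).

(* The facts [f] and [f.+1] stand for the two values of a bit, which is set by
   [Y] if [univ f] and by [V] if [exis f]. *)
Definition model (Y V : pred nat) : Prop :=
  [/\ forall f, f < N -> ax f -> V f,
      forall f, f < N -> kill f -> ~~ V f,
      forall u v w, u < N -> v < N -> w < N -> rule u v w -> V u -> V v -> V w,
      forall f, univ f -> if Y f then V f else V f.+1 &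
      forall f, exis f -> V f || V f.+1].

Definition EN := N * N * N.
(* Vertex [l] of node [e] in block [f] of copy [c]. The blocks [f < N] are the
   disjunctions of all ways to obtain the fact [f]; node [e] of block [N] is the
   conjunction for the rule given by the three base-[N] digits of [e]. *)
Definition enc c f e l := ((c * N.+1 + f) * EN + e) * 20 + l.
Definition lb v := v %% 20.
Definition eb v := v %/ 20 %% EN.
Definition fb v := v %/ 20 %/ EN %% N.+1.
Definition cb v := v %/ 20 %/ EN %/ N.+1.
Definition VN := 3 * N.+1 * EN * 20.
Definition ru e := e %/ N %/ N.
Definition rv e := e %/ N %% N.
Definition rw e := e %% N.
Definition act e := rule (ru e) (rv e) (rw e).

(* The source of the wire into slot [k], or [self] if there is none. The nodes of
   a block are linked in a cycle, so that a signal that enters at one node is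
   available at all of them. *)
Definition src c f e k self : nat :=
  if f < N then
    if k == 0 then enc c f (if e == 0 then EN.-1 else e.-1) 2
    else if k == 1 then
      (* Slot 1 is where a fact is established. Nodes 0 to 3 are free for the choices and node 4 for
         an axiom, because a rule with a number below 5 would have equal premises. *)
      if act e && (rw e == f) then enc c N e 2
      else if (e == 0) && univ f then enc c f 0 13
      else if (e == 1) && ((0 < f) && univ f.-1) then enc c f.-1 0 15
      else if (e == 2) && exis f then enc c f 0 17
      else if (e == 3) && ((0 < f) && exis f.-1) then enc c f.-1 0 18
      else self
    else self
  else if act e then
    if k == 0 then enc c (ru e) e 3
    else if k == 2 then enc c (rv e) e 3
    else self
  else self.

(* Labels: 0, 1 the ends of the gate edge; 2, 3 its pages; 4-6, 7-9, 10-12 the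
   triangles of the wires into slots 0, 1 (at end 0) and 2 (at end 1); 13-16 the
   cycle of a universal choice; 17, 18 the edge of an existential choice; the
   root is vertex 19. A vertex that is its own parent has no parent. *)
Definition par1_at c f e l : nat :=
  let x := enc c f e in
  nth (x l) [:: (if (f < N) && ((e == 4) && ax f) then 19 else x 0); x 0; x 0; x 1;
    src c f e 0 (x 4); x 6; x 4; src c f e 1 (x 7); x 9; x 7; src c f e 2 (x 10); x 12; x 10;
    19; x 13; 19; x 15; 19; 19] l.

Definition par2_at c f e l : nat :=
  let x := enc c f e in
  nth (x l) [:: x 3; (if f < N then 19 else x 1); x 1;
    (if (f < N) && ((e == 0) && kill f) then 19 else x 3);
    x 5; x 0; 19; x 8; x 0; 19; x 11; x 1; 19;
    x 16; 19; x 14; 19; x 18] l.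

Definition par1 v := par1_at (cb v) (fb v) (eb v) (lb v).
Definition par2 v := par2_at (cb v) (fb v) (eb v) (lb v).

Definition proper_along (T : eqType) (par : nat -> nat) (col : nat -> T) : Prop :=
  forall v, v < VN -> par v != v -> col v != col (par v).

(** With equal premises, both wires of a rule would start at the same page, which can be kept from
    only one emitting colour. *)
Hypotheses (N5 : 4 < N) (rule_neq : forall u v w, rule u v w -> u != v).
Hypotheses (univ_lt : forall f, univ f -> f.+1 < N) (exis_lt : forall f, exis f -> f.+1 < N).

Lemma EN_gt4 : 4 < EN.
Proof. by rewrite /EN; nia. Qed.

Definition valid c f e := [&& c < 3, f <= N & e < EN].

Lemma decode c f e l : f <= N -> e < EN -> l < 20 ->
  [/\ cb (enc c f e l) = c, fb (enc c f e l) = f, eb (enc c f e l) = e & lb (enc c f e l) = l].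
Proof.
move=> fN eE l20; have E0 : 0 < EN by apply: leq_trans EN_gt4.
rewrite /cb /fb /eb /lb /enc divnMDl // modnMDl (divn_small l20) (modn_small l20) addn0.
rewrite divnMDl // modnMDl (divn_small eE) (modn_small eE) addn0.
by rewrite divnMDl // modnMDl divn_small ?ltnS // modn_small ?ltnS // addn0.
Qed.

Lemma enc_lt c f e l : valid c f e -> l < 20 -> enc c f e l < VN.
Proof.
move=> /and3P[c3 fN eE] l20; rewrite /VN /enc.
apply: leq_trans (_ : ((c * N.+1 + f) * EN + e).+1 * 20 <= _).
  by rewrite mulSn addnC ltn_add2r.
rewrite leq_mul2r /=; apply: leq_trans (_ : (c * N.+1 + f).+1 * EN <= _).
  by rewrite mulSn addnC ltn_add2r.
by rewrite leq_mul2r; apply/orP; right; nia.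
Qed.

Lemma encodeP v : v < VN -> exists c f e l,
  [/\ valid c f e, l < 20 & v = enc c f e l].
Proof.
move=> vV; have E0 : 0 < EN by apply: leq_trans EN_gt4.
exists (cb v), (fb v), (eb v), (lb v); split; last first.
- by rewrite /enc /cb /fb /eb /lb -!divn_eq.
- exact: ltn_pmod.
apply/and3P; split; last exact: ltn_pmod.
  by rewrite /cb !ltn_divLR //; move: vV; rewrite /VN; lia.
by rewrite -ltnS ltn_pmod.
Qed.

Lemma root_lt : 19 < VN.
Proof. by have := EN_gt4; rewrite /VN; nia. Qed.

(** Below [N] the two leading base-[N] digits, which number the premises, are both 0. *)
Lemma act_gt4 e : act e -> 4 < e.
Proof.
rewrite ltnNge /act => /rule_neq neq; apply/negP => e4; case/eqP: neq.
by rewrite /ru /rv !(@divn_small e) ?div0n ?mod0n //; lia.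
Qed.

Lemma ru_lt e : e < EN -> ru e < N.
Proof. by rewrite /EN /ru => eE; have N0 : 0 < N by [lia]; rewrite !ltn_divLR. Qed.
Lemma rv_lt e : rv e < N. Proof. by rewrite ltn_pmod; lia. Qed.
Lemma rw_lt e : rw e < N. Proof. by rewrite ltn_pmod; lia. Qed.

Definition next e := if e == EN.-1 then 0 else e.+1.
Definition prev e := if e == 0 then EN.-1 else e.-1.

Lemma prevK e : e < EN -> next (prev e) = e.
Proof.
rewrite /next /prev => eE; case: (altP (e =P 0)) => [->|e0]; first by rewrite eqxx.
by have -> : (e.-1 == EN.-1) = false by [apply/eqP; lia]; lia.
Qed.

Lemma prev_lt e : e < EN -> prev e < EN.
Proof. by rewrite /prev => eE; case: eqP => ?; lia. Qed.

Lemma src_wire c f e k self : valid c f e -> src c f e k self != self ->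
  exists c' f' e' l', [/\ src c f e k self = enc c' f' e' l', valid c' f' e' &
    l' \in [:: 2; 3; 13; 15; 17; 18]].
Proof.
case/and3P=> c3 fN eE; have E0 : 0 < EN by apply: leq_trans EN_gt4.
rewrite /src /valid; case: (ltnP f N) => ltf.
  case: (k =P 0) => _.
    by exists c, f, (prev e), 2; rewrite c3 fN prev_lt.
  case: (k =P 1) => _; last by rewrite eqxx.
  case: ifP => _; first by exists c, N, e, 2; rewrite c3 leqnn.
  case: ifP => _; first by exists c, f, 0, 13; rewrite c3 fN.
  case: ifP => _; first by exists c, f.-1, 0, 15; rewrite c3 (leq_trans (leq_pred f)).
  case: ifP => _; first by exists c, f, 0, 17; rewrite c3 fN.
  case: ifP => _; first by exists c, f.-1, 0, 18; rewrite c3 (leq_trans (leq_pred f)).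
  by rewrite eqxx.
case: ifP => _; last by rewrite eqxx.
case: (k =P 0) => _; first by exists c, (ru e), e, 3; rewrite c3 (ltnW (ru_lt eE)).
case: (k =P 2) => _; last by rewrite eqxx.
by exists c, (rv e), e, 3; rewrite c3 (ltnW (rv_lt e)).
Qed.

(** * Colouring from arbitrary lists when the game is won *)

Section Colouring.

Variables (T : eqType) (L : nat -> seq T).
Hypothesis tripleL : forall v, v < VN -> triple (L v).
Hypothesis winning : forall Y, exists V, model Y V.

(** The order of the choices matters: the root, then the forbidden pair of each wire, which depends
    only on lists and root, then the bits that the 4-cycles impose, and only then the model that
    answers these bits. The gates follow, and the triangles come last. *)
Lemma game_colouring : exists col : nat -> T,
  [/\ forall v, v < VN -> col v \in L v, proper_along par1 col & proper_along par2 col].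
Proof.
have tL c f e l : valid c f e -> l < 20 -> triple (L (enc c f e l)).
  by move=> val l20; apply: tripleL; apply: enc_lt.
have [rho rhoL _] : exists2 rho, rho \in L 19 & rho \notin [::].
  have /andP[uL /eqP sL] := tripleL root_lt.
  by apply: pick_avoid => //; rewrite sL.
have [|sd sdP] := @functional_choice (nat * nat * nat * nat) (T * T) (fun t p =>
    let: (c, f, e, k) := t in valid c f e -> k < 3 -> forall cu ct,
    (cu != p.1) || (ct != p.2) -> exists w : T * T * T,
    [/\ w.1.1 \in L (enc c f e (4 + 3 * k)), w.1.2 \in L (enc c f e (5 + 3 * k)) &
        w.2 \in L (enc c f e (6 + 3 * k))] /\
    [&& w.1.1 != w.1.2, w.1.2 != w.2, w.1.1 != w.2, w.1.1 != cu, w.1.2 != ct & w.2 != rho]).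
  move=> -[[[c f] e] k].
  case: (boolP (valid c f e && (k < 3))) => [/andP[val k3]|nval]; last first.
    by exists (rho, rho) => vl k3; rewrite vl k3 in nval.
  have [] := @triangle_wire T (L (enc c f e (4 + 3 * k))) (L (enc c f e (5 + 3 * k)))
    (L (enc c f e (6 + 3 * k))) rho; try by apply: tL => //; lia.
  move=> s [d sdP]; exists (s, d) => _ _ cu ct /sdP[w1 [w2 [w3 H]]].
  by exists (w1, w2, w3).
pose s c f e k := (sd (c, f, e, k)).1; pose d c f e k := (sd (c, f, e, k)).2.
have [|ua uaP] := @functional_choice (nat * nat * nat) (bool * (T * T * T * T)) (fun t p =>
    let: (c, f, e) := t in let: (z, (t1, n1, t0, n2)) := p in valid c f e ->
    [/\ t1 \in L (enc c f e 13), n1 \in L (enc c f e 14), t0 \in L (enc c f e 15) &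
        n2 \in L (enc c f e 16)] /\
    [&& t1 != rho, n1 != rho, t0 != rho & n2 != rho] /\
    [&& t1 != n1, n1 != t0, t0 != n2, n2 != t1 &
        (if z then t0 != s c f.+1 1 1 else t1 != s c f 0 1)]).
  move=> -[[c f] e].
  case: (boolP (valid c f e)) => [val|nval]; last first.
    by exists (true, (rho, rho, rho, rho)) => vl; case/negP: nval.
  have [] := @forall_cycle T (L (enc c f e 13)) (L (enc c f e 14)) (L (enc c f e 15))
    (L (enc c f e 16)) rho (s c f 0 1) (s c f.+1 1 1); try by apply: tL.
  by move=> z [t1 [n1 [t0 [n2 H]]]]; exists (z, (t1, n1, t0, n2)).
(* Each copy has its own bits and hence its own model. *)
have [|V0 modelV] := @functional_choice nat (pred nat) (fun c p => model (fun f => (ua (c, f, 0)).1) p).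
  by move=> c; apply: winning.
pose V c f := V0 c f.
have [|ea eaP] := @functional_choice (nat * nat * nat) (T * T) (fun t p =>
    let: (c, f, e) := t in valid c f e ->
    [/\ p.1 \in L (enc c f e 17) & p.2 \in L (enc c f e 18)] /\
    [&& p.1 != rho, p.2 != rho, p.1 != p.2,
        exis f ==> (V c f || (p.1 != s c f 2 1)) &
        exis f ==> (V c f.+1 || (p.2 != s c f.+1 3 1))]).
  move=> -[[c f] e].
  case: (boolP (valid c f e)) => [val|nval]; last first.
    by exists (rho, rho) => vl; case/negP: nval.
  have [|||t1 [t0 [[t1L t0L] H]]] := @exists_edge T (L (enc c f e 17)) (L (enc c f e 18)) rho
    (s c f 2 1) (s c f.+1 3 1) (exis f ==> V c f) (exis f ==> V c f.+1).
  - exact: tL.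
  - exact: tL.
  - by case: (boolP (exis f)) => //= ef; case: (modelV c) => _ _ _ _; apply.
  exists (t1, t0) => _; split=> //=; move: H.
  by case: (exis f).
pose val c f e := if f < N then V c f else V c (ru e) && V c (rv e).
pose DA c f e := if f < N then
    if V c f then [:: d c f e 0; if (e == 4) && ax f then rho else d c f e 1] else [::]
  else if V c (ru e) then [:: d c f e 0] else [::].
pose DB c f e := if f < N then [:: rho] else if V c (rv e) then [:: d c f e 2] else [::].
(* Each page is the source of at most one wire: the first page leads to the next node of the cycle
   or to the conclusion of the rule, the second one to the rule that uses the fact. At node 0, where
   no rule is active, the second page may be attached to the root instead. *)
pose d0 c f e := if f < N then s c f (next e) 0 else s c (rw e) e 1.
pose d1 c f e := if (f < N) && ((e == 0) && kill f) then rho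
  else if ru e == f then s c N e 0 else s c N e 2.
have [|ga gaP] := @functional_choice (nat * nat * nat) (T * T * T * T) (fun t p =>
    let: (c, f, e) := t in let: (a, b, q0, q1) := p in valid c f e ->
    [/\ a \in L (enc c f e 0), b \in L (enc c f e 1), q0 \in L (enc c f e 2) &
        q1 \in L (enc c f e 3)] /\
    [&& a \notin DA c f e, b \notin DB c f e, a != b, q0 != a, q0 != b, q1 != a, q1 != b,
        val c f e || (q0 != d0 c f e) & val c f e || (q1 != d1 c f e)]).
  move=> -[[c f] e].
  case: (boolP (valid c f e)) => [vl|nval]; last first.
    by exists (rho, rho, rho, rho) => vl; case/negP: nval.
  have [|||||||a [b [q0 [q1 H]]]] := @gate T (L (enc c f e 0)) (L (enc c f e 1)) (L (enc c f e 2))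
    (L (enc c f e 3)) (DA c f e) (DB c f e) (d0 c f e) (d1 c f e) (val c f e); try by apply: tL.
  - by rewrite /DA; case: ifP => _; case: ifP.
  - by rewrite /DB; case: ifP => _ //; case: ifP.
  - rewrite /val /DA /DB; case: ifP => _; first by move/negbTE => ->; left.
    by rewrite negb_and; case: (V c (ru e)) => /=; [move/negbTE => ->; right | left].
  by exists (a, b, q0, q1).
pose gA t := (ga t).1.1.1; pose gB t := (ga t).1.1.2; pose gQ0 t := (ga t).1.2; pose gQ1 t := (ga t).2.
have gP c f e : valid c f e ->
    [/\ gA (c, f, e) \in L (enc c f e 0), gB (c, f, e) \in L (enc c f e 1),
        gQ0 (c, f, e) \in L (enc c f e 2) & gQ1 (c, f, e) \in L (enc c f e 3)] /\
    [/\ gA (c, f, e) \notin DA c f e, gB (c, f, e) \notin DB c f e, gA (c, f, e) != gB (c, f, e),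
        [&& gQ0 (c, f, e) != gA (c, f, e), gQ0 (c, f, e) != gB (c, f, e),
            gQ1 (c, f, e) != gA (c, f, e) & gQ1 (c, f, e) != gB (c, f, e)] &
        (val c f e || (gQ0 (c, f, e) != d0 c f e)) && (val c f e || (gQ1 (c, f, e) != d1 c f e))].
  move=> vl; have := gaP (c, f, e); rewrite /gA /gB /gQ0 /gQ1.
  case: (ga (c, f, e)) => [[[a b] q0] q1] /(_ vl)[mem /and5P[aD bD ab q0a /and5P[q0b q1a q1b z0 z1]]].
  by split=> //; split; rewrite ?q0a ?q0b ?q1a ?q1b ?z0 ?z1.
pose uT1 t := (ua t).2.1.1.1; pose uN1 t := (ua t).2.1.1.2; pose uT0 t := (ua t).2.1.2; pose uN2 t := (ua t).2.2.
have uP c f e : valid c f e ->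
    [/\ uT1 (c, f, e) \in L (enc c f e 13), uN1 (c, f, e) \in L (enc c f e 14),
        uT0 (c, f, e) \in L (enc c f e 15) & uN2 (c, f, e) \in L (enc c f e 16)] /\
    [/\ [&& uT1 (c, f, e) != rho, uN1 (c, f, e) != rho, uT0 (c, f, e) != rho & uN2 (c, f, e) != rho],
        [&& uT1 (c, f, e) != uN1 (c, f, e), uN1 (c, f, e) != uT0 (c, f, e),
            uT0 (c, f, e) != uN2 (c, f, e) & uN2 (c, f, e) != uT1 (c, f, e)] &
        if (ua (c, f, e)).1 then uT0 (c, f, e) != s c f.+1 1 1 else uT1 (c, f, e) != s c f 0 1].
  move=> vl; have := uaP (c, f, e); rewrite /uT1 /uN1 /uT0 /uN2.
  case: (ua (c, f, e)) => [z [[[t1 n1] t0] n2]] /(_ vl)[mem [nr /and5P[a1 a2 a3 a4 az]]].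
  by split=> //; split; rewrite ?a1 ?a2 ?a3.
(* All colours except those of the triangles. Wires start only at vertices coloured here, so the
   triangles can be filled in afterwards. *)
pose bcol v := let t := (cb v, fb v, eb v) in
  nth rho [:: gA t; gB t; gQ0 t; gQ1 t; rho; rho; rho; rho; rho; rho; rho; rho; rho;
    uT1 t; uN1 t; uT0 t; uN2 t; (ea t).1; (ea t).2] (lb v).
have bcolE c f e l : f <= N -> e < EN -> l < 20 -> bcol (enc c f e l) = let t := (c, f, e) in
  nth rho [:: gA t; gB t; gQ0 t; gQ1 t; rho; rho; rho; rho; rho; rho; rho; rho; rho;
    uT1 t; uN1 t; uT0 t; uN2 t; (ea t).1; (ea t).2] l.
  by move=> fN eE l20; rewrite /bcol; have [-> -> -> ->] := @decode c f e l fN eE l20.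
have E4 := EN_gt4.
(* If the premise that a wire carries is true, its target avoids the forbidden colour, since a true
   gate reserves that colour; if it is false, its source does not emit. The forbidden pair never
   occurs. *)
have wire_ok c f e k self : valid c f e -> k < 3 -> src c f e k self != self ->
    (bcol (src c f e k self) != s c f e k) ||
    ((if k == 2 then gB (c, f, e) else gA (c, f, e)) != d c f e k).
  move=> vl k3; case/and3P: (vl) => c3 fN eE.
  have [_ [aD bD _ _ _]] := gP c f e vl.
  have [mAx mKill mRule mUniv0 mExis] := modelV c.
  have mUniv : forall f, univ f -> if (ua (c, f, 0)).1 then V c f else V c f.+1 := mUniv0.
  rewrite /src; case: (ltnP f N) => ltf.
    rewrite /DA ltf in aD.
    case: (altP (k =P 0)) => [-> _|k0] /=.
      have vp : valid c f (prev e) by rewrite /valid c3 fN prev_lt.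
      rewrite -/(prev e) bcolE ?prev_lt //=; case: (boolP (V c f)) => Vf.
        by rewrite Vf !inE negb_or in aD; case/andP: aD => -> _; rewrite orbT.
      have [_ [_ _ _ _ /andP[+ _]]] := gP c f (prev e) vp.
      by rewrite /val ltf (negbTE Vf) /= /d0 ltf prevK // => ->.
    case: (altP (k =P 1)) => [-> | k1] /=; last by rewrite eqxx.
    have safe : V c f -> (e == 4) && ax f = false -> gA (c, f, e) != d c f e 1.
      by move=> Vf e4; move: aD; rewrite Vf e4 !inE negb_or => /andP[].
    case: ifP => [/andP[ae /eqP rwf] _|_].
      have e5 := act_gt4 ae.
      have ne4 : (e == 4) && ax f = false by rewrite gtn_eqF.
      rewrite bcolE //=; case: (boolP (V c (ru e) && V c (rv e))) => Vuv.
        have /andP[Vu Vv] := Vuv.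
        rewrite safe ?orbT // -rwf; apply: mRule ae Vu Vv; rewrite ?ru_lt ?rv_lt ?rw_lt //.
      have vN : valid c N e by rewrite /valid c3 leqnn eE.
      have [_ [_ _ _ _ /andP[+ _]]] := gP c N e vN.
      by rewrite /val ltnn (negbTE Vuv) /= /d0 ltnn rwf => ->.
    case: ifP => [/andP[/eqP e0 uf] _|_].
      rewrite bcolE ?(leq_trans _ E4) //=; have v0 : valid c f 0 by rewrite -e0.
      have [_ [_ _ hz]] := uP c f 0 v0; have := mUniv f uf.
      case: (boolP (V c f)) => Vf; first by rewrite safe ?orbT // e0.
      rewrite e0.
      by move: hz; case: (ua _).1 => // ->.
    case: ifP => [/andP[/eqP e1 /andP[f0 uf]] _|_].
      rewrite bcolE ?(leq_trans _ E4) ?(leq_trans (leq_pred f)) //=.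
      have v0 : valid c f.-1 0 by rewrite /valid c3 (leq_trans (leq_pred f)) // (leq_trans _ E4).
      have [_ [_ _ hz]] := uP c f.-1 0 v0; have := mUniv f.-1 uf; rewrite prednK // in hz *.
      case: (boolP (V c f)) => Vf; first by rewrite safe ?orbT // e1.
      rewrite e1.
      by move: hz; case: (ua _).1 => // ->.
    case: ifP => [/andP[/eqP e2 ef] _|_].
      rewrite bcolE ?(leq_trans _ E4) //=.
      have v0 : valid c f 0 by rewrite /valid c3 fN (leq_trans _ E4).
      have [_ /and5P[_ _ _ hz _]] := eaP (c, f, 0) v0.
      case: (boolP (V c f)) => Vf; first by rewrite safe ?orbT // e2.
      rewrite e2.
      by move: hz; rewrite ef (negbTE Vf) /= => ->.
    case: ifP => [/andP[/eqP e3 /andP[f0 ef]] _|_]; last by rewrite eqxx.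
    rewrite bcolE ?(leq_trans _ E4) ?(leq_trans (leq_pred f)) //=.
    have v0 : valid c f.-1 0 by rewrite /valid c3 (leq_trans (leq_pred f)) // (leq_trans _ E4).
    have [_ /and5P[_ _ _ _ hz]] := eaP (c, f.-1, 0) v0; rewrite prednK // in hz.
    case: (boolP (V c f)) => Vf; first by rewrite safe ?orbT // e3.
      rewrite e3.
    by move: hz; rewrite ef (negbTE Vf) /= => ->.
  have fE : f = N by apply/eqP; rewrite eqn_leq fN ltf.
  rewrite /DA /DB fE ltnn in aD bD *.
  case: ifP => [ae|_]; last by rewrite eqxx.
  have e5 := act_gt4 ae; have e0 : (e == 0) = false by rewrite gtn_eqF // ltnW // ltnW // ltnW // ltnW.
  case: (altP (k =P 0)) => [-> _|k0] /=.
    rewrite bcolE ?(ltnW (ru_lt eE)) //=; case: (boolP (V c (ru e))) => Vu.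
      by rewrite Vu inE in aD; rewrite aD orbT.
    have vu : valid c (ru e) e by rewrite /valid c3 (ltnW (ru_lt eE)).
    have [_ [_ _ _ _ /andP[_ +]]] := gP c (ru e) e vu.
    by rewrite /val ru_lt // (negbTE Vu) /d1 e0 andbF eqxx /= => ->.
  case: (altP (k =P 2)) => [-> _|k2] /=; last by rewrite eqxx.
  rewrite bcolE ?(ltnW (rv_lt e)) //=; case: (boolP (V c (rv e))) => Vv.
    by rewrite Vv inE in bD; rewrite bD orbT.
  have vu : valid c (rv e) e by rewrite /valid c3 (ltnW (rv_lt e)).
  have [_ [_ _ _ _ /andP[_ +]]] := gP c (rv e) e vu.
  by rewrite /val rv_lt // (negbTE Vv) /d1 e0 andbF (negbTE (rule_neq ae)) /= => ->.
have [|wa waP] := @functional_choice (nat * nat * nat * nat) (T * T * T) (fun t w =>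
    let: (c, f, e, k) := t in let self := enc c f e (4 + 3 * k) in valid c f e -> k < 3 ->
    [/\ w.1.1 \in L self, w.1.2 \in L (enc c f e (5 + 3 * k)) &
        w.2 \in L (enc c f e (6 + 3 * k))] /\
    [/\ [&& w.1.1 != w.1.2, w.1.2 != w.2 & w.1.1 != w.2],
        src c f e k self != self -> w.1.1 != bcol (src c f e k self),
        w.1.2 != (if k == 2 then gB (c, f, e) else gA (c, f, e)) & w.2 != rho]).
  move=> [[[c f] e] k].
  case: (boolP (valid c f e && (k < 3))) => [/andP[vl k3]|nval]; last first.
    by exists (rho, rho, rho) => /= vl k3; rewrite vl k3 in nval.
  set self := enc _ _ _ _.
  (* An empty slot has no source; some colour that does not emit stands in for it. *)
  have [cu cuE] : exists cu, (src c f e k self != self -> cu = bcol (src c f e k self)) /\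
      ((cu != s c f e k) || ((if k == 2 then gB (c, f, e) else gA (c, f, e)) != d c f e k)).
    case: (altP (src c f e k self =P self)) => [Es|nEs].
      by have [cu _ cus] := pick1 (s c f e k) (tripleL root_lt); exists cu; rewrite cus.
    by exists (bcol (src c f e k self)); split=> //; apply: wire_ok.
  have [w [mem /and5P[w12 w23 w13 w1c /andP[w2c w3r]]]] := sdP (c, f, e, k) vl k3 _ _ (proj2 cuE).
  exists w => /= _ _; split=> //; split=> //; first by rewrite w12 w23.
  by case: cuE => cuE _ /cuE <-.
(* Apart from the root, vertices with label 19 are isolated and take any colour of their lists. *)
pose col v := let c := cb v in let f := fb v in let e := eb v in let t := (c, f, e) in
  nth (if v == 19 then rho else head rho (L v)) [:: gA t; gB t; gQ0 t; gQ1 t;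
    (wa (c, f, e, 0)).1.1; (wa (c, f, e, 0)).1.2; (wa (c, f, e, 0)).2;
    (wa (c, f, e, 1)).1.1; (wa (c, f, e, 1)).1.2; (wa (c, f, e, 1)).2;
    (wa (c, f, e, 2)).1.1; (wa (c, f, e, 2)).1.2; (wa (c, f, e, 2)).2;
    uT1 t; uN1 t; uT0 t; uN2 t; (ea t).1; (ea t).2] (lb v).
have colE c f e l : valid c f e -> l < 20 -> col (enc c f e l) = let t := (c, f, e) in
  nth (if enc c f e l == 19 then rho else head rho (L (enc c f e l))) [:: gA t; gB t; gQ0 t; gQ1 t;
    (wa (c, f, e, 0)).1.1; (wa (c, f, e, 0)).1.2; (wa (c, f, e, 0)).2;
    (wa (c, f, e, 1)).1.1; (wa (c, f, e, 1)).1.2; (wa (c, f, e, 1)).2;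
    (wa (c, f, e, 2)).1.1; (wa (c, f, e, 2)).1.2; (wa (c, f, e, 2)).2;
    uT1 t; uN1 t; uT0 t; uN2 t; (ea t).1; (ea t).2] l.
  by move=> /and3P[_ fN eE] l20; rewrite /col; have [-> -> -> ->] := @decode c f e l fN eE l20.
have colR : col 19 = rho by [].
have col_src c f e k self : valid c f e -> src c f e k self != self ->
    col (src c f e k self) = bcol (src c f e k self).
  move=> vl /(src_wire vl)[c' [f' [e' [l' [-> vl' ll]]]]]; case/and3P: (vl') => _ fN eE.
  have l20 : l' < 20 by move: ll; rewrite !inE; do ![case/predU1P=> [->|]] => // /eqP->.
  rewrite colE ?bcolE //.
  by move: ll; rewrite !inE; do ![case/predU1P=> [->|]] => // /eqP->.
exists col; split.
- move=> v /encodeP[c [f [e [l [vl l20 ->]]]]].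
  have [[a1 a2 a3 a4] _] := gP c f e vl; have [[u1 u2 u3 u4] _] := uP c f e vl.
  have [[e1 e2] _] := eaP (c, f, e) vl.
  have [[w1 w2 w3] _] := waP (c, f, e, 0) vl isT.
  have [[w4 w5 w6] _] := waP (c, f, e, 1) vl isT.
  have [[w7 w8 w9] _] := waP (c, f, e, 2) vl isT.
  rewrite colE //; move: l20.
  do 19! [case: l => [|l] //]; case: l => [|l] //= _.
  case: eqP => [->|_] //; have := tL c f e 19 vl isT.
  by case: (L _) => [|x r] //= _; rewrite mem_head.
- move=> v /encodeP[c [f [e [l [vl l20 ->]]]]]; case/and3P: (vl) => c3 fN eE.
  rewrite /par1; have [-> -> -> ->] := @decode c f e l fN eE l20.
  have [_ [aD bD ab /and4P[qa qb q1a q1b] _]] := gP c f e vl.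
  have [_ [/and4P[u1 u2 u3 u4] /and4P[u5 u6 u7 u8] _]] := uP c f e vl.
  have [_ /and5P[e1 e2 e3 _ _]] := eaP (c, f, e) vl.
  have [_ [/and3P[w1 w2 w3] s0 t0 r0]] := waP (c, f, e, 0) vl isT.
  have [_ [/and3P[w4 w5 w6] s1 t1 r1]] := waP (c, f, e, 1) vl isT.
  have [_ [/and3P[w7 w8 w9] s2 t2 r2]] := waP (c, f, e, 2) vl isT.
  rewrite /par1_at; move: l20.
  case: l => [|l] /=.
    move=> _; case: ifP => [/andP[ltf /andP[e4 axf]] _|_]; last by rewrite eqxx.
    have [mAx _ _ _ _] := modelV c; have Vf : V c f := mAx f ltf axf.
    rewrite colR colE //=; move: aD; rewrite /DA ltf Vf e4 axf !inE negb_or => /andP[_ ->] //.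
  do 18! [case: l => [|l] /=; first by
    move=> _ H; rewrite ?colR ?(col_src _ _ _ _ _ vl H) !colE //=;
    try (by [|rewrite eq_sym]); (try by apply: s0); (try by apply: s1); (try by apply: s2)].
  by case: l => [|l] //= _; rewrite eqxx.
- move=> v /encodeP[c [f [e [l [vl l20 ->]]]]]; case/and3P: (vl) => c3 fN eE.
  rewrite /par2; have [-> -> -> ->] := @decode c f e l fN eE l20.
  have [_ [aD bD ab /and4P[qa qb q1a q1b] /andP[_ dq1]]] := gP c f e vl.
  have [_ [/and4P[u1 u2 u3 u4] /and4P[u5 u6 u7 u8] _]] := uP c f e vl.
  have [_ /and5P[e1 e2 e3 _ _]] := eaP (c, f, e) vl.
  have [_ [/and3P[w1 w2 w3] s0 t0 r0]] := waP (c, f, e, 0) vl isT.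
  have [_ [/and3P[w4 w5 w6] s1 t1 r1]] := waP (c, f, e, 1) vl isT.
  have [_ [/and3P[w7 w8 w9] s2 t2 r2]] := waP (c, f, e, 2) vl isT.
  rewrite /par2_at; move: l20.
  case: l => [|l] /=; first by move=> _ _; rewrite !colE //= eq_sym.
  case: l => [|l] /=.
    move=> _; case: ifP => [ltf _|_]; last by rewrite eqxx.
    by rewrite colR colE //=; move: bD; rewrite /DB ltf inE.
  case: l => [|l] /=; first by move=> _ _; rewrite !colE.
  case: l => [|l] /=.
    move=> _; case: ifP => [/andP[ltf /andP[e0 kf]] _|_]; last by rewrite eqxx.
    have [_ mKill _ _ _] := modelV c; have Vf : ~~ V c f := mKill f ltf kf.
    by rewrite colR colE //=; move: dq1; rewrite /val /d1 ltf (negbTE Vf) e0 kf.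
  do 14! [case: l => [|l] /=; first by
    move=> _ H; rewrite ?colR !colE //=; try (by [|rewrite eq_sym])].
  by do 2! [case: l => [|l] /=; first by rewrite eqxx].
Qed.

End Colouring.

(** The colour 5 is the signal. The root has the default list 0, 1, 2, and a vertex attached to it
    has the number [c] of its copy as third colour, which it loses if the root has colour [c]. Then
    a 4-cycle is left with the lists 3 5, 3 4, 4 6, 3 6 in cyclic order; the colour 3 at the first
    vertex would force 6 at both of the last two, so that vertex has colour 5. [Y] decides which of
    two opposite vertices it is. *)
Definition bad_list (Y : pred nat) (v : nat) : seq nat :=
  let c := cb v in let f := fb v in let e := eb v in
  nth [:: 0; 1; 2] [:: (if (f < N) && ((e == 4) && ax f) then [:: 3; 4; c] else [:: 3; 4; 5]);
    (if f < N then [:: 3; 4; c] else [:: 3; 4; 5]); [:: 3; 4; 5];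
    (if (f < N) && ((e == 0) && kill f) then [:: 3; 4; c] else [:: 3; 4; 5]);
    [:: 3; 4; 5]; [:: 3; 4; 5]; [:: 3; 4; c]; [:: 3; 4; 5]; [:: 3; 4; 5]; [:: 3; 4; c];
    [:: 3; 4; 5]; [:: 3; 4; 5]; [:: 3; 4; c];
    (if Y f then [:: 3; 5; c] else [:: 4; 6; c]); [:: 3; 4; c];
    (if Y f then [:: 4; 6; c] else [:: 3; 5; c]); [:: 3; 6; c];
    [:: 3; 5; c]; [:: 3; 5; c]] (lb v).

Lemma bad_list_triple Y v : v < VN -> triple (bad_list Y v).
Proof.
move=> /encodeP[c [f [e [l [/and3P[c3 fN eE] l20 ->]]]]].
rewrite /bad_list; have [-> -> -> ->] := @decode c f e l fN eE l20.
move: l20; clear -c3; case: c c3 => [|[|[|c]]] // _;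
do 20! [case: l => [|l] /=; first by repeat case: ifP]; by [].
Qed.

(* In a colouring from these lists whose root has colour [i], the colour 5 of a
   page of copy [i] is forced exactly like a derived fact. *)
Lemma colouring_model (Y : pred nat) (col : nat -> nat) :
  (forall v, v < VN -> col v \in bad_list Y v) ->
  proper_along par1 col -> proper_along par2 col -> exists V, model Y V.
Proof.
(* The colour of the root selects the copy in which the lists are effective. *)
move=> mem_col prop1 prop2; pose i := col 19.
have i3 : i < 3.
  have := mem_col 19 root_lt; rewrite /bad_list /= !inE -/i.
  by case/or3P => /eqP ->.
have vld f e : f <= N -> e < EN -> valid i f e by move=> fN eE; rewrite /valid i3 fN eE.
have memL f e l : f <= N -> e < EN -> l < 20 -> col (enc i f e l) \in
    nth [:: 0; 1; 2] [:: (if (f < N) && ((e == 4) && ax f) then [:: 3; 4; i] else [:: 3; 4; 5]);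
    (if f < N then [:: 3; 4; i] else [:: 3; 4; 5]); [:: 3; 4; 5];
    (if (f < N) && ((e == 0) && kill f) then [:: 3; 4; i] else [:: 3; 4; 5]);
    [:: 3; 4; 5]; [:: 3; 4; 5]; [:: 3; 4; i]; [:: 3; 4; 5]; [:: 3; 4; 5]; [:: 3; 4; i];
    [:: 3; 4; 5]; [:: 3; 4; 5]; [:: 3; 4; i];
    (if Y f then [:: 3; 5; i] else [:: 4; 6; i]); [:: 3; 4; i];
    (if Y f then [:: 4; 6; i] else [:: 3; 5; i]); [:: 3; 6; i];
    [:: 3; 5; i]; [:: 3; 5; i]] l.
  move=> fN eE l20; have := mem_col _ (enc_lt (vld _ _ fN eE) l20).
  by rewrite /bad_list; have [-> -> -> ->] := @decode i f e l fN eE l20.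
have neq1 f e l : f <= N -> e < EN -> l < 20 -> par1_at i f e l != enc i f e l ->
    col (enc i f e l) <> col (par1_at i f e l).
  move=> fN eE l20; have [E1 E2 E3 E4] := @decode i f e l fN eE l20.
  by have := prop1 _ (enc_lt (vld _ _ fN eE) l20); rewrite /par1 E1 E2 E3 E4 => H /H/eqP.
have neq2 f e l : f <= N -> e < EN -> l < 20 -> par2_at i f e l != enc i f e l ->
    col (enc i f e l) <> col (par2_at i f e l).
  move=> fN eE l20; have [E1 E2 E3 E4] := @decode i f e l fN eE l20.
  by have := prop2 _ (enc_lt (vld _ _ fN eE) l20); rewrite /par2 E1 E2 E3 E4 => H /H/eqP.
have root_neq f e l : l != 19 -> l < 20 -> (19 == enc i f e l) = false.
  by move=> l19 l20; apply/eqP; rewrite /enc; lia.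
have enc_neq f e l l' : (enc i f e l == enc i f e l') = (l == l').
  by rewrite /enc eqn_add2l.
(* The vertex attached to the root has 3 or 4. If source and target both had 5, the whole triangle
   would be restricted to these two colours. *)
have wire f e k : f <= N -> e < EN -> k < 3 -> src i f e k (enc i f e (4 + 3 * k)) != enc i f e (4 + 3 * k) ->
    col (src i f e k (enc i f e (4 + 3 * k))) = 5 -> col (enc i f e (if k == 2 then 1 else 0)) <> 5.
  move=> fN eE k3 nself c5.
  suff [m1 m2 m3 [[n12 n23 n31] [n1s n2t n3r]]] : [/\ col (enc i f e (4 + 3 * k)) \in [:: 3; 4; 5],
      col (enc i f e (5 + 3 * k)) \in [:: 3; 4; 5], col (enc i f e (6 + 3 * k)) \in [:: 3; 4; i] &
      [/\ col (enc i f e (4 + 3 * k)) <> col (enc i f e (5 + 3 * k)),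
          col (enc i f e (5 + 3 * k)) <> col (enc i f e (6 + 3 * k)) &
          col (enc i f e (6 + 3 * k)) <> col (enc i f e (4 + 3 * k))] /\
      [/\ col (enc i f e (4 + 3 * k)) <> 5,
          col (enc i f e (5 + 3 * k)) <> col (enc i f e (if k == 2 then 1 else 0)) &
          col (enc i f e (6 + 3 * k)) <> i]].
    by move: m1 m2 m3; rewrite !inE; lia.
  split.
  - by have := memL f e (4 + 3 * k) fN eE; case: (k) k3 => [|[|[|]]] //= _; apply.
  - by have := memL f e (5 + 3 * k) fN eE; case: (k) k3 => [|[|[|]]] //= _; apply.
  - by have := memL f e (6 + 3 * k) fN eE; case: (k) k3 => [|[|[|]]] //= _; apply.
  split; split.
  - have := neq2 f e (4 + 3 * k) fN eE; case: (k) k3 => [|[|[|]]] //= _; apply=> //;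
    by rewrite /par2_at /= enc_neq.
  - have := neq1 f e (5 + 3 * k) fN eE; case: (k) k3 => [|[|[|]]] //= _; apply=> //;
    by rewrite /par1_at /= enc_neq.
  - have := neq1 f e (6 + 3 * k) fN eE; case: (k) k3 => [|[|[|]]] //= _; apply=> //;
    by rewrite /par1_at /= enc_neq.
  - rewrite -c5; have := neq1 f e (4 + 3 * k) fN eE; move: nself {c5}.
    by case: k k3 => [|[|[|]]] //= _ nself; apply.
  - have := neq2 f e (5 + 3 * k) fN eE; case: (k) k3 => [|[|[|]]] //= _; apply=> //;
    by rewrite /par2_at /= enc_neq.
  - have := neq2 f e (6 + 3 * k) fN eE; case: (k) k3 => [|[|[|]]] //= _; apply=> //;
    by rewrite /par2_at /= root_neq.
(* If the first end is not 5, the two ends use up 3 and 4, so both pages are 5. A page attached to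
   the root cannot be 5, which excludes the facts in [kill]. *)
have page f e : f < N -> e < EN -> col (enc i f e 0) <> 5 ->
    col (enc i f e 2) = 5 /\ (((e == 0) && kill f) = false /\ col (enc i f e 3) = 5).
  move=> ltf eE a5; have fN := ltnW ltf.
  have ra : (e == 4) && ax f -> col (enc i f e 0) <> i.
    move=> h; have := neq1 f e 0 fN eE isT; rewrite /par1_at ltf h /=.
    by apply; rewrite root_neq.
  have rb : col (enc i f e 1) <> i.
    by have := neq2 f e 1 fN eE isT; rewrite /par2_at ltf /=; apply; rewrite root_neq.
  have rq : (e == 0) && kill f -> col (enc i f e 3) <> i.
    move=> h; have := neq2 f e 3 fN eE isT; rewrite /par2_at ltf h /=.
    by apply; rewrite root_neq.
  have ba : col (enc i f e 1) <> col (enc i f e 0).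
    by apply: (neq1 f e 1 fN eE isT); rewrite enc_neq.
  have q0a : col (enc i f e 2) <> col (enc i f e 0).
    by apply: (neq1 f e 2 fN eE isT); rewrite enc_neq.
  have q1b : col (enc i f e 3) <> col (enc i f e 1).
    by apply: (neq1 f e 3 fN eE isT); rewrite enc_neq.
  have aq1 : col (enc i f e 0) <> col (enc i f e 3).
    by apply: (neq2 f e 0 fN eE isT); rewrite enc_neq.
  have q0b : col (enc i f e 2) <> col (enc i f e 1).
    by apply: (neq2 f e 2 fN eE isT); rewrite enc_neq.
  have := memL f e 0 fN eE isT; have := memL f e 1 fN eE isT.
  have := memL f e 2 fN eE isT; have := memL f e 3 fN eE isT.
  rewrite /= ltf /=; move: ra rq; case: (_ && kill f); case: (_ && ax f) => ra rq;
    rewrite !inE; move: a5 rb ba q0a q1b aq1 q0b; [have := ra isT; have := rq isT | 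
      have := rq isT | have := ra isT | idtac]; clear; lia.
have pageN e : e < EN -> col (enc i N e 0) <> 5 -> col (enc i N e 1) <> 5 -> col (enc i N e 2) = 5.
  move=> eE a5 b5; have fN := leqnn N.
  have ba : col (enc i N e 1) <> col (enc i N e 0).
    by apply: (neq1 N e 1 fN eE isT); rewrite enc_neq.
  have q0a : col (enc i N e 2) <> col (enc i N e 0).
    by apply: (neq1 N e 2 fN eE isT); rewrite enc_neq.
  have q0b : col (enc i N e 2) <> col (enc i N e 1).
    by apply: (neq2 N e 2 fN eE isT); rewrite enc_neq.
  have := memL N e 0 fN eE isT; have := memL N e 1 fN eE isT; have := memL N e 2 fN eE isT.
  by rewrite /= ltnn /= !inE; lia.
have step f e : f < N -> e < EN -> col (enc i f (prev e) 2) = 5 -> col (enc i f e 0) <> 5.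
  move=> ltf eE q5; have := wire f e 0 (ltnW ltf) eE isT; rewrite /src ltf /= -/(prev e).
  apply=> //; apply/eqP => E; have := @decode i f (prev e) 2 (ltnW ltf) (prev_lt eE) isT.
  have [_ _ _ E4] := @decode i f e 4 (ltnW ltf) eE isT.
  by move=> [_ _ _]; rewrite E E4.
have E4 := EN_gt4.
(* A fact is read off at node 0. The next two claims carry the signal round the cycle, from node 0
   to any node and from any node back. *)
pose V f := col (enc i f 0 2) == 5.
have V_all f e : f < N -> V f -> e < EN -> col (enc i f e 0) <> 5.
  move=> ltf /eqP Vf; elim: e => [|e IHe] eE; last first.
    apply: (step f e.+1 ltf eE); rewrite /prev /=.
    by have [] := page f e ltf (ltnW eE) (IHe (ltnW eE)).
  apply: (step f 0 ltf eE); rewrite /prev /=.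
  have up e : e < EN -> col (enc i f e 2) = 5.
    elim: e => // e IHe ltE; apply: (proj1 (page f e.+1 ltf ltE _)).
    by apply: (step f e.+1 ltf ltE); rewrite /prev /=; apply: IHe; apply: ltnW.
  by apply: up; lia.
have V_some f e : f < N -> e < EN -> col (enc i f e 0) <> 5 -> V f.
  move=> ltf eE a5; have q5 := proj1 (page f e ltf eE a5).
  have up j : e + j < EN -> col (enc i f (e + j) 2) = 5.
    elim: j => [|j IHj] ltE; first by rewrite addn0.
    apply: (proj1 (page f (e + j.+1) ltf ltE _)); apply: (step f _ ltf ltE).
    by rewrite addnS /prev /=; apply: IHj; lia.
  have lastq : col (enc i f EN.-1 2) = 5 by have := up (EN.-1 - e); rewrite subnKC; [apply; lia | lia].
  have E0 : 0 < EN by lia.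
  by apply/eqP; apply: (proj1 (page f 0 ltf E0 (step f 0 ltf E0 lastq))).
have src_neq f e k c' f' e' l' : f <= N -> e < EN -> f' <= N -> e' < EN -> l' < 20 -> l' != 4 + 3 * k -> k < 3 ->
    enc c' f' e' l' != enc i f e (4 + 3 * k).
  move=> fN eE fN' eE' l20 ll k3; apply/eqP => E.
  have lk : 4 + 3 * k < 20 by lia.
  have [_ _ _ E1] := @decode i f e _ fN eE lk; have [_ _ _ E2] := @decode c' f' e' _ fN' eE' l20.
  by rewrite -E2 E E1 eqxx in ll.
exists V; split.
- move=> f ltf axf; apply: (V_some f 4) => //.
  have := memL f 4 0 (ltnW ltf) E4 isT; have := neq1 f 4 0 (ltnW ltf) E4 isT.
  by rewrite /par1_at ltf axf /= root_neq //= !inE -/i; lia.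
- move=> f ltf kf; apply/negP => Vf; have E0 : 0 < EN by lia.
  have := page f 0 ltf E0 (V_all f 0 ltf Vf E0).
  by rewrite kf => -[_ []].
- move=> u v w ltu ltv ltw r Vu Vv.
  pose e := (u * N + v) * N + w.
  have N0 : 0 < N by lia.
  have eE : e < EN by rewrite /e /EN; nia.
  have [Eu Ev Ew] : [/\ ru e = u, rv e = v & rw e = w].
    rewrite /ru /rv /rw /e !divnMDl // !modnMDl (divn_small ltw) (modn_small ltw) addn0.
    by rewrite divnMDl // modnMDl (divn_small ltv) (modn_small ltv) addn0.
  have ae : act e by rewrite /act Eu Ev Ew.
  have e5 := act_gt4 ae.
  have [_ [_ qu]] := page u e ltu eE (V_all u e ltu Vu eE).
  have [_ [_ qv]] := page v e ltv eE (V_all v e ltv Vv eE).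
  have a5 : col (enc i N e 0) <> 5.
    have := wire N e 0 (leqnn N) eE isT; rewrite /src ltnn ae /= Eu; apply=> //.
    by apply: (src_neq N e 0) => //; apply: ltnW.
  have b5 : col (enc i N e 1) <> 5.
    have := wire N e 2 (leqnn N) eE isT; rewrite /src ltnn ae /= Ev; apply=> //.
    by apply: (src_neq N e 2) => //; apply: ltnW.
  apply: (V_some w e) => //.
  have := wire w e 1 (ltnW ltw) eE isT; rewrite /src ltw ae Ew !eqxx /=; apply.
    by apply: (src_neq w e 1) => //; apply: ltnW.
  exact: pageN.
- move=> f uf; have ltf1 := univ_lt uf; have ltf := ltnW ltf1; have fN := ltnW ltf.
  have E0 : 0 < EN by lia. have E1 : 1 < EN by lia.
  have act0 : act 0 = false by apply/negP => /act_gt4.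
  have act1 : act 1 = false by apply/negP => /act_gt4.
  have := memL f 0 13 fN E0 isT; have := memL f 0 14 fN E0 isT.
  have := memL f 0 15 fN E0 isT; have := memL f 0 16 fN E0 isT.
  have r1 : col (enc i f 0 13) <> i by apply: (neq1 f 0 13 fN E0 isT); rewrite root_neq.
  have r2 : col (enc i f 0 14) <> i by apply: (neq2 f 0 14 fN E0 isT); rewrite root_neq.
  have r3 : col (enc i f 0 15) <> i by apply: (neq1 f 0 15 fN E0 isT); rewrite root_neq.
  have r4 : col (enc i f 0 16) <> i by apply: (neq2 f 0 16 fN E0 isT); rewrite root_neq.
  have n1 : col (enc i f 0 14) <> col (enc i f 0 13).
    by apply: (neq1 f 0 14 fN E0 isT); rewrite enc_neq.
  have n2 : col (enc i f 0 16) <> col (enc i f 0 15).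
    by apply: (neq1 f 0 16 fN E0 isT); rewrite enc_neq.
  have n3 : col (enc i f 0 13) <> col (enc i f 0 16).
    by apply: (neq2 f 0 13 fN E0 isT); rewrite enc_neq.
  have n4 : col (enc i f 0 15) <> col (enc i f 0 14).
    by apply: (neq2 f 0 15 fN E0 isT); rewrite enc_neq.
  have w1 := wire f 0 1 fN E0 isT; have w0 := wire f.+1 1 1 ltf E1 isT.
  rewrite /src ltf act0 uf /= in w1; rewrite /src ltf1 act1 uf /= in w0.
  case: (Y f); rewrite /= !inE => m4 m3 m2 m1.
    apply: (V_some f 0) => //; apply: w1; last by move: r1 r2 r3 r4 n1 n2 n3 n4 m1 m2 m3 m4; clear; lia.
    by apply: (src_neq f 0 1).
  apply: (V_some f.+1 1) => //; apply: w0; last by move: r1 r2 r3 r4 n1 n2 n3 n4 m1 m2 m3 m4; clear; lia.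
  by apply: (src_neq f.+1 1 1).
- move=> f ef; have ltf1 := exis_lt ef; have ltf := ltnW ltf1; have fN := ltnW ltf.
  have E0 : 0 < EN by lia. have E2 : 2 < EN by lia. have E3 : 3 < EN by lia.
  have act2 : act 2 = false by apply/negP => /act_gt4.
  have act3 : act 3 = false by apply/negP => /act_gt4.
  have := memL f 0 17 fN E0 isT; have := memL f 0 18 fN E0 isT; rewrite /= !inE => m2 m1.
  have r1 : col (enc i f 0 17) <> i by apply: (neq1 f 0 17 fN E0 isT); rewrite root_neq.
  have r2 : col (enc i f 0 18) <> i by apply: (neq1 f 0 18 fN E0 isT); rewrite root_neq.
  have n1 : col (enc i f 0 17) <> col (enc i f 0 18).
    by apply: (neq2 f 0 17 fN E0 isT); rewrite enc_neq.
  have w1 := wire f 2 1 fN E2 isT; have w0 := wire f.+1 3 1 ltf E3 isT.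
  rewrite /src ltf act2 ef /= in w1; rewrite /src ltf1 act3 ef /= in w0.
  have [c5|c5] : col (enc i f 0 17) = 5 \/ col (enc i f 0 18) = 5.
    by move: r1 r2 n1 m1 m2; clear; lia.
    apply/orP; left; apply: (V_some f 2) => //; apply: w1 => //.
    by apply: (src_neq f 2 1).
  apply/orP; right; apply: (V_some f.+1 3) => //; apply: w0 => //.
  by apply: (src_neq f.+1 3 1).
Qed.

(** Depths that depend on the label alone and decrease towards parents. The root has the default 0,
    and in the first forest the entry of a wire, of rank 4, lies above every possible source. *)
Definition rank1 l := nth 0 [:: 1; 2; 3; 3; 4; 6; 5; 4; 6; 5; 4; 6; 5; 1; 2; 1; 2; 1; 1] l.
Definition rank2 l := nth 0 [:: 2; 1; 2; 1; 4; 3; 1; 4; 3; 1; 4; 3; 1; 2; 1; 2; 1; 2; 1] l.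

Lemma par1_lt v : v < VN -> par1 v < VN.
Proof.
move=> /encodeP[c [f [e [l [vl l20 ->]]]]]; case/and3P: (vl) => c3 fN eE.
rewrite /par1; have [-> -> -> ->] := @decode c f e l fN eE l20.
have ltsrc k : k < 3 -> src c f e k (enc c f e (4 + 3 * k)) < VN.
  move=> k3; have l1 : 4 + 3 * k < 20 by lia.
  case: (eqVneq (src c f e k (enc c f e (4 + 3 * k))) (enc c f e (4 + 3 * k))) => [->|].
    exact: enc_lt.
  move=> /(src_wire vl)[c' [f' [e' [l' [-> vl' ll]]]]]; apply: enc_lt => //.
  by move: ll; rewrite !inE; do ![case/predU1P=> [->|]] => // /eqP->.
have s0 := ltsrc 0 isT; have s1 := ltsrc 1 isT; have s2 := ltsrc 2 isT.
have rt := root_lt; have el k : k < 20 -> enc c f e k < VN by apply: enc_lt.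
rewrite /par1_at; move: l20.
do 20! [case: l => [|l] /=; first by move=> _; try case: ifP => _; rewrite ?rt ?el]; by [].
Qed.

Lemma par2_lt v : v < VN -> par2 v < VN.
Proof.
move=> /encodeP[c [f [e [l [vl l20 ->]]]]]; case/and3P: (vl) => c3 fN eE.
rewrite /par2; have [-> -> -> ->] := @decode c f e l fN eE l20.
have rt := root_lt; have el k : k < 20 -> enc c f e k < VN by apply: enc_lt.
rewrite /par2_at; move: l20.
do 20! [case: l => [|l] /=; first by move=> _; try case: ifP => _; rewrite ?rt ?el]; by [].
Qed.

Lemma par1_rank v : v < VN -> par1 v != v -> rank1 (lb (par1 v)) < rank1 (lb v).
Proof.
move=> /encodeP[c [f [e [l [vl l20 ->]]]]]; case/and3P: (vl) => c3 fN eE.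
rewrite /par1; have [-> -> -> ->] := @decode c f e l fN eE l20.
have el k : k < 20 -> lb (enc c f e k) = k by move=> k20; have [] := @decode c f e k fN eE k20.
have ltsrc k : k < 3 -> src c f e k (enc c f e (4 + 3 * k)) != enc c f e (4 + 3 * k) ->
    rank1 (lb (src c f e k (enc c f e (4 + 3 * k)))) < 4.
  move=> k3 /(src_wire vl)[c' [f' [e' [l' [-> /and3P[_ fN' eE'] ll]]]]].
  have l20' : l' < 20 by move: ll; rewrite !inE; do ![case/predU1P=> [->|]] => // /eqP->.
  have [_ _ _ ->] := @decode c' f' e' l' fN' eE' l20'.
  by move: ll; rewrite !inE; do ![case/predU1P=> [->|]] => // /eqP->.
have s0 := ltsrc 0 isT; have s1 := ltsrc 1 isT; have s2 := ltsrc 2 isT.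
rewrite /par1_at; move: l20.
do 20! [case: l => [|l] /=; first by move=> _; try case: ifP => _; rewrite ?el ?eqxx]; by [].
Qed.

Lemma par2_rank v : v < VN -> par2 v != v -> rank2 (lb (par2 v)) < rank2 (lb v).
Proof.
move=> /encodeP[c [f [e [l [vl l20 ->]]]]]; case/and3P: (vl) => c3 fN eE.
rewrite /par2; have [-> -> -> ->] := @decode c f e l fN eE l20.
have el k : k < 20 -> lb (enc c f e k) = k by move=> k20; have [] := @decode c f e k fN eE k20.
rewrite /par2_at; move: l20.
do 20! [case: l => [|l] /=; first by move=> _; try case: ifP => _; rewrite ?el ?eqxx]; by [].
Qed.

End Game.

(** * Graphs given by parent functions *)

Section ParentGraphs.

Variables (n : nat) (par : nat -> nat).

Definition par_adj (u v : nat) : bool := (u != v) && ((par u == v) || (par v == u)).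

Lemma par_adj_sym : symmetric (fun u v : 'I_n => par_adj u v).
Proof. by move=> u v; rewrite /par_adj eq_sym orbC. Qed.

Lemma par_adj_irr : irreflexive (fun u v : 'I_n => par_adj u v).
Proof. by move=> u; rewrite /par_adj eqxx. Qed.

Definition par_graph : sgraph 'I_n := SGraph par_adj_sym par_adj_irr.

Lemma par_forest (rk : nat -> nat) :
  (forall v, v < n -> par v != v -> rk (par v) < rk v) -> is_forest par_graph.
Proof.
move=> rkP; have lt u v : u < n -> u != v -> par u == v -> rk v < rk u.
  by move=> un uv /eqP E; rewrite -E rkP // E eq_sym.
apply: (@ranking_forest _ _ (fun v : 'I_n => rk v)); split=> [u v|u v w] /=.
  rewrite /par_adj => /andP[uv /orP[] H]; first by rewrite gtn_eqF ?lt.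
  by rewrite ltn_eqF ?lt // eq_sym.
have down x : par_adj u x -> x < n -> rk x < rk u -> par u = x.
  move=> /andP[ux /orP[/eqP //|xu]] xn ltx; have := lt x u xn.
  by rewrite eq_sym => /(_ ux xu); rewrite ltnNge (ltnW ltx).
by move=> /down Ev /down Ew ltv ltw; apply: val_inj; rewrite /= -Ev // -Ew.
Qed.

End ParentGraphs.

Lemma game_choosable N (ax kill univ exis : pred nat) (rule : nat -> nat -> nat -> bool) :
  4 < N -> (forall u v w, rule u v w -> u != v) ->
  (forall f, univ f -> f.+1 < N) -> (forall f, exis f -> f.+1 < N) ->
  let F1 := par_graph (VN N) (par1 N ax univ exis rule) in
  let F2 := par_graph (VN N) (par2 N kill) in
  [/\ is_forest F1, is_forest F2 & choosable 3 (graph_union F1 F2) <->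
      forall Y, exists V, model N ax kill univ exis rule Y V].
Proof.
move=> N5 rn ul el F1 F2.
have lt1 := @par1_lt N ax univ exis rule N5.
have lt2 := @par2_lt N kill N5.
split.
- by apply: (@par_forest _ _ (fun v => rank1 (lb v))) => v; apply: par1_rank.
- by apply: (@par_forest _ _ (fun v => rank2 (lb v))) => v; apply: par2_rank.
split=> [ch Y|win S cardS].
  (* The worst lists consist of natural numbers, which [Posz] embeds into the integers. *)
  have memS (v : 'I_(VN N)) x : (x \in seq_fset tt [seq Posz y | y <- bad_list N ax kill Y v]) =
      (x \in [seq Posz y | y <- bad_list N ax kill Y v]) by rewrite seq_fsetE.
  have [|c [cS cE]] := ch (fun v => seq_fset tt [seq Posz y | y <- bad_list N ax kill Y v]).
    move=> v; have /andP[ub /eqP sb] := bad_list_triple ax kill N5 Y (ltn_ord v).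
    by rewrite size_seq_fset undup_id ?size_map // map_inj_uniq // => ? ? [].
  pose col v := if insub v is Some i then absz (c i) else 0.
  have colE (v : 'I_(VN N)) : Posz (col v) = c v.
    rewrite /col valK; have := cS v; rewrite memS => /mapP[x _ ->] //.
  have prop par : (forall v, v < VN N -> par v < VN N) ->
      (forall u v : 'I_(VN N), par_adj par u v -> c u != c v) -> proper_along N par col.
    move=> parlt parE v vV pv.
    have := parE (Ordinal vV) (Ordinal (parlt v vV)); rewrite -!colE /par_adj /= eq_sym pv eqxx.
    by move/(_ isT).
  apply: (@colouring_model N ax kill univ exis rule N5 rn ul el Y col).
  - move=> v vV; have := cS (Ordinal vV); rewrite memS -colE /= mem_map // => ? ? [] //.
  - by apply: prop => // u v uv; apply: cE; apply/orP; left.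
  - by apply: prop => // u v uv; apply: cE; apply/orP; right.
pose L v : seq int := if insub v is Some i then enum_fset (S (i : 'I_(VN N))) else [::].
have LE (v : 'I_(VN N)) : L v = enum_fset (S v) by rewrite /L valK.
have [|col [colL col1 col2]] := @game_colouring N ax kill univ exis rule N5 rn int L _ win.
  move=> v vV; rewrite /triple -[v]/(val (Ordinal vV)) LE; apply/andP; split; first exact: fset_uniq.
  by apply/eqP; apply: cardS.
exists (fun v : 'I_(VN N) => col v); split=> [v|u v].
  by have := colL v (ltn_ord v); rewrite LE.
case/orP => /andP[uv /orP[]/eqP E].
- by rewrite -E; apply: col1; rewrite // E eq_sym.
- by rewrite -E eq_sym; apply: col1; rewrite // E.
- by rewrite -E; apply: col2; rewrite // E eq_sym.
- by rewrite -E eq_sym; apply: col2; rewrite // E.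
Qed.

(** * From machines to games *)

Section Tableau.

Variables (M : machine) (x : word) (m T : nat).

Notation K := (tm_tapes M).
Notation Sym := (symbol (tm_work M)).
Notation situation := (tm_state M * {ffun 'I_K.+1 -> Sym})%type.

(* Labels of facts: [inl (inl tt)]: a dummy fact that always holds;
   [inl (inr (i, (q, g)))]: the state is q and tapes 0..i-1 scan the symbols given
   by g; [inr (i, a)]: a cell of tape i contains a. *)
Definition label : finType := (unit + 'I_K.+2 * situation + 'I_K.+4 * Sym)%type.
Definition Top : label := inl (inl tt).
(** A rule has only two premises, so a guessed vector of scanned symbols is confirmed tape by tape,
    with [i] as the progress. *)
Definition Ctl i al : label := inl (inr (i, al)).
(** The index ranges over more than the tapes of the machine, so that cells for [y] and [z] exist
    even if there is only one tape. *)
Definition Cell i a : label := inr (i, a).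
Definition bit (b : bool) : Sym := Some (inl b).

Definition flip (a : label) : label :=
  if a is inr (i, Some (inl b)) then Cell i (bit (~~ b)) else a.
Definition is_zero (a : label) : bool :=
  if a is inr (_, Some (inl false)) then true else false.

Lemma flipK : involutive flip.
Proof. by case=> [[]|[i [[b|w]|]]] //=; rewrite negbK. Qed.

(* A cell containing 0 is numbered next to the same cell containing 1, because
   the game chooses between [f] and [f.+1]. *)
Definition idx (a : label) : nat :=
  (enum_rank (if is_zero a then flip a else a)).*2 + is_zero a.
Definition L := #|label|.*2.

Lemma idx_lt a : idx a < L.
Proof.
rewrite /idx /L; case: (enum_rank _) => r rl /=; have {rl} : r < #|label| by exact: rl.
by move: #|label| => n; case: (is_zero a) => /=; lia.
Qed.

Lemma idx_inj : injective idx.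
Proof.
move=> a b E; have Ez : is_zero a = is_zero b.
  have := congr1 odd E; rewrite /idx !oddD !odd_double.
  by case: (is_zero a); case: (is_zero b).
have : enum_rank (if is_zero b then flip a else a) = enum_rank (if is_zero b then flip b else b).
  by apply: val_inj; move: E; rewrite /idx Ez /=; lia.
by move/enum_rank_inj; case: (is_zero b) => // /(inv_inj flipK).
Qed.

Lemma idx_zero i : idx (Cell i (bit false)) = (idx (Cell i (bit true))).+1.
Proof. by rewrite /idx /= addn0 addn1. Qed.

(** The position of the head on every tape. On both sides there is room for the at most [T] moves,
    and on the right for the [m] letters of a chosen word. *)
Definition mid := T + m + 1.
Definition J := mid.*2.+1.
Definition num t j a := (t * J + j) * L + idx a.
Definition tf f := f %/ L %/ J.
Definition jf f := f %/ L %% J.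
Definition lf f := f %% L.
Definition NF := T.+1 * J * L.

Lemma num_zero t j i : num t j (Cell i (bit false)) = (num t j (Cell i (bit true))).+1.
Proof. by rewrite /num idx_zero addnS. Qed.

Definition labelled (P : label -> nat -> nat -> bool) (f : nat) : bool :=
  has (fun a => (lf f == idx a) && P a (tf f) (jf f)) (enum label).

Lemma num_decode t j a : j < J -> [/\ tf (num t j a) = t, jf (num t j a) = j & lf (num t j a) = idx a].
Proof.
move=> jJ; have L0 : 0 < L by apply: leq_ltn_trans (idx_lt a).
rewrite /tf /jf /lf /num divnMDl // modnMDl (divn_small (idx_lt a)) (modn_small (idx_lt a)) addn0.
by rewrite divnMDl // modnMDl (divn_small jJ) (modn_small jJ) addn0.
Qed.

Lemma labelledE (P : label -> nat -> nat -> bool) t j a : j < J -> labelled P (num t j a) = P a t j.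
Proof.
move=> jJ; rewrite /labelled; have [-> -> ->] := num_decode t a jJ.
apply/hasP/idP => [[b _ /andP[/eqP/idx_inj <-]] //|Pa].
by exists a; rewrite ?mem_enum // eqxx.
Qed.

Lemma labelledP (P : label -> nat -> nat -> bool) f :
  reflect (exists a, f = num (tf f) (jf f) a /\ P a (tf f) (jf f)) (labelled P f).
Proof.
apply: (iffP hasP) => [[a _ /andP[/eqP la Pa]]|[a [fE Pa]]].
  by exists a; split=> //; rewrite /num -la /tf /jf /lf -!divn_eq.
exists a; rewrite ?mem_enum // Pa andbT {1}fE.
by have [_ _ ->] := @num_decode (tf f) (jf f) a (ltn_pmod _ (ltn0Sn _)).
Qed.

Lemma jf_lt f : jf f < J. Proof. exact: ltn_pmod. Qed.

Lemma num_lt t j a : t <= T -> j < J -> num t j a < NF.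
Proof.
move=> tT jJ; apply: leq_trans (_ : (t * J + j).+1 * L <= _).
  by rewrite mulSnr ltn_add2l idx_lt.
rewrite leq_mul2r; apply/orP; right; apply: leq_trans (_ : t.+1 * J <= _).
  by rewrite mulSnr ltn_add2l.
by rewrite leq_mul2r ltnS tT orbT.
Qed.

(** A halted machine repeats its configuration, so that every run can be judged at time [T]. *)
Definition effect (al : situation) : tm_state M * ('I_K.+1 -> Sym * move) :=
  if tm_halt al.1 then (al.1, fun i => (al.2 i, Stay)) else tm_trans al.1 al.2.

(* Position [j] relative to the head after the move is position [j'] before. *)
Definition shifted (mv : move) (j j' : nat) : bool :=
  match mv with
  | MoveLeft => j == j'.+1
  | Stay => j == j'
  | MoveRight => j.+1 == j'
  end.

Definition input_symbol (a : Sym) (p : nat) : bool :=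
  match a with
  | Some (inl b) => (p < size x) && (nth false x p == b)
  | Some (inr _) => false
  | None => size x <= p
  end.

(** The initial control facts carry arbitrary guesses of the scanned symbols. The first [m] cells of
    [y] and of [z] get no axiom; their contents come from the choices. *)
Definition ax_at (a : label) (t j : nat) : bool :=
  match a with
  | inl (inl _) => (t == 0) && (j == 0)
  | inl (inr (i, al)) => [&& t == 0, j == 0, i == 0 :> nat & al.1 == tm_start M]
  | inr (i, a) => (t == 0) &&
      (if (mid <= j) && (i == 0 :> nat) then input_symbol a (j - mid)
       else if (mid <= j) && ((j < mid + m) && ((i == 1 :> nat) || (i == 2 :> nat))) then false
       else a == None)
  end.

Definition kill_at (a : label) (t j : nat) : bool :=
  if a is inr (i, a) then (t == T) && ((j == mid) && ((i == 0 :> nat) && (a != bit true))) else false.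

Definition input_at (r : nat) (a : label) (t j : nat) : bool :=
  if a is inr (i, a) then
    (t == 0) && ((mid <= j) && ((j < mid + m) && ((i == r :> nat) && (a == bit true))))
  else false.

(** The four cases are: one more scanned symbol is confirmed; the next state begins with fresh
    guesses; the cell under the head is rewritten; any other cell is kept but moves relative to the
    head. [Top] fills the second premise in the middle two cases. *)
Definition rule_at (a b c : label) (ta ja tb jb tc jc : nat) : bool :=
  match a, b, c with
  | inl (inr (i, al)), inr (i', s), inl (inr (i2, al')) =>
      [&& (i < K.+1) && (i' == i :> nat), i2 == i.+1 :> nat, al == al' & s == al.2 (inord i)] &&
      ((ta == tb) && ((ta == tc) && ((ja == 0) && ((jb == mid) && (jc == 0)))))
  | inl (inr (i, al)), inl (inl _), inl (inr (i2, al')) =>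
      [&& i == K.+1 :> nat, i2 == 0 :> nat & al'.1 == (effect al).1] &&
      ((tc == ta.+1) && ((tb == 0) && ((ja == 0) && ((jb == 0) && (jc == 0)))))
  | inl (inr (i, al)), inl (inl _), inr (i', s) =>
      [&& i == K.+1 :> nat, i' < K.+1 & s == ((effect al).2 (inord i')).1] &&
      ((tc == ta.+1) && ((tb == 0) && ((ja == 0) && ((jb == 0) &&
        shifted ((effect al).2 (inord i')).2 jc mid))))
  | inl (inr (i, al)), inr (i', s), inr (i2, s') =>
      [&& i == K.+1 :> nat, i' < K.+1, i2 == i' & s == s'] &&
      ((tc == ta.+1) && ((tb == ta) && ((ja == 0) && ((jb != mid) &&
        shifted ((effect al).2 (inord i')).2 jc jb))))
  | _, _, _ => false
  end.

Definition ax := labelled ax_at.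
Definition kill := labelled kill_at.
Definition univ := labelled (input_at 1).
Definition exis := labelled (input_at 2).
Definition rule (u v w : nat) : bool :=
  has (fun a => has (fun b => has (fun c =>
    [&& lf u == idx a, lf v == idx b, lf w == idx c &
        rule_at a b c (tf u) (jf u) (tf v) (jf v) (tf w) (jf w)])
    (enum label)) (enum label)) (enum label).

Lemma ruleP u v w : reflect (exists a b c, [/\ u = num (tf u) (jf u) a, v = num (tf v) (jf v) b,
    w = num (tf w) (jf w) c & rule_at a b c (tf u) (jf u) (tf v) (jf v) (tf w) (jf w)]) (rule u v w).
Proof.
have decode f a : lf f = idx a -> f = num (tf f) (jf f) a.
  by move=> la; rewrite /num -la /tf /jf /lf -!divn_eq.
have encode f a : f = num (tf f) (jf f) a -> lf f = idx a.
  by move=> {1}->; have [_ _ ->] := @num_decode (tf f) (jf f) a (jf_lt f).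
apply: (iffP hasP) => [[a _ /hasP[b _ /hasP[c _ /and4P[/eqP la /eqP lb /eqP lc r]]]]|].
  by exists a, b, c; split=> //; apply: decode.
move=> [a [b [c [/encode la /encode lb /encode lc r]]]].
exists a; rewrite ?mem_enum //; apply/hasP; exists b; rewrite ?mem_enum //.
by apply/hasP; exists c; rewrite ?mem_enum // la lb lc !eqxx.
Qed.

Lemma rule_intro a b c ta ja tb jb tc jc : ja < J -> jb < J -> jc < J ->
  rule_at a b c ta ja tb jb tc jc -> rule (num ta ja a) (num tb jb b) (num tc jc c).
Proof.
move=> jaJ jbJ jcJ r; apply/ruleP; exists a, b, c.
have [-> -> _] := num_decode ta a jaJ; have [-> -> _] := num_decode tb b jbJ.
by have [-> -> _] := num_decode tc c jcJ.
Qed.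

Lemma rule_neq u v w : rule u v w -> u != v.
Proof.
case/ruleP=> a [b [c [uE vE _ r]]]; apply/eqP => uv.
have ab : a = b.
  apply: idx_inj; have [_ _ <-] := num_decode (tf u) a (jf_lt u).
  by have [_ _ <-] := num_decode (tf v) b (jf_lt v); rewrite -uE -vE uv.
by move: r; rewrite ab; case: b {ab vE} => [[[]|[i al]]|[i s]]; case: c => [[[]|[i' al']]|[i' s']].
Qed.

Lemma mid_lt : mid < J. Proof. by rewrite /J; lia. Qed.

Lemma input_lt r f : labelled (input_at r) f -> f.+1 < NF.
Proof.
case/labelledP=> a [fE]; rewrite /input_at; case: a fE => // -[i a] fE.
case/and5P=> /eqP t0 _ _ _ /eqP aE; rewrite fE aE -num_zero.
by apply: num_lt; rewrite ?jf_lt // t0.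
Qed.

Lemma NF_gt4 : 4 < NF.
Proof.
have : 1 < L.
  have : 0 < #|label| by apply/card_gt0P; exists Top.
  by rewrite /L; lia.
by rewrite /NF /J /mid; nia.
Qed.

Definition cell (tp : tape Sym) (j : nat) : Sym :=
  if j < mid then nth None (cells_left tp) (mid - j.+1)
  else if j == mid then scanned tp else nth None (cells_right tp) (j - mid.+1).

Lemma cell_mid tp : cell tp mid = scanned tp.
Proof. by rewrite /cell ltnn eqxx. Qed.

Lemma cell_init w j :
  cell (tape_of M w) j = if mid <= j then nth None (map bit w) (j - mid) else None.
Proof.
rewrite /cell /tape_of /= nth_nil -nth0; case: ltngtP => // [ltj|<-]; last by rewrite subnn.
by rewrite nth_behead subnSK.
Qed.

Lemma cell_step tp a mv j j' : shifted mv j j' ->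
  cell (tape_move None mv (tape_write a tp)) j = if j' == mid then a else cell tp j'.
Proof.
case: tp => l b r; rewrite /cell; case: mv => /= /eqP jj.
- rewrite jj nth_behead -nth0; case: (ltngtP j' mid) => [lt|gt|eq].
  + case: (ltngtP j'.+1 mid) => [?|?|?]; [by congr nth; lia | by lia | by congr nth; lia].
  + have -> : (j'.+1 < mid) = false by lia.
    have -> : (j'.+1 == mid) = false by lia.
    by have -> : j'.+1 - mid.+1 = (j' - mid.+1).+1 by lia.
  + have -> : (j'.+1 < mid) = false by lia.
    have -> : (j'.+1 == mid) = false by lia.
    by have -> : j'.+1 - mid.+1 = 0 by lia.
- rewrite jj; case: (ltngtP j' mid) => //.
- rewrite -jj nth_behead -nth0; case: (ltngtP j mid) => [lt|gt|eq].
  + case: (ltngtP j.+1 mid) => [lt'|?|eq']; [| by lia |].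
      by have -> : mid - j.+1 = (mid - j.+2).+1 by lia.
    by have -> : mid - j.+1 = 0 by lia.
  + have -> : (j.+1 < mid) = false by lia.
    have -> : (j.+1 == mid) = false by lia.
    by congr nth; lia.
  + have -> : (j.+1 < mid) = false by lia.
    have -> : (j.+1 == mid) = false by lia.
    by congr nth; lia.
Qed.

(** * Comparison of the tableau with the actual run *)

Section Run.

Variables (y z : word).
Hypotheses (szy : size y = m) (szz : size z = m).

Let xs := [:: x; y; z].
Let cfg t := iter t (@step M) (init M xs).
Let scans t : {ffun 'I_K.+1 -> Sym} := [ffun i => scanned (ctape (cfg t) i)].
Let sit t : situation := (cstate (cfg t), scans t).

Lemma cfg_step t : cstate (cfg t.+1) = (effect (sit t)).1 /\
  forall i, ctape (cfg t.+1) i = tape_move None ((effect (sit t)).2 i).2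
                                  (tape_write ((effect (sit t)).2 i).1 (ctape (cfg t) i)).
Proof.
have -> : cfg t.+1 = step (cfg t) by [].
rewrite /step /effect /halted /=; case: ifP => _ /=.
  by split=> // i; rewrite /scans ffunE; case: (ctape _ _).
by rewrite /sit /scans /=; case: (tm_trans _ _).
Qed.

Lemma cfg_cell0 i j : cell (ctape (cfg 0) i) j =
  if mid <= j then nth None (map bit (nth [::] xs i)) (j - mid) else None.
Proof. by rewrite /cfg /= cell_init. Qed.

Lemma input_symbolE a p : input_symbol a p = (a == nth None (map bit x) p).
Proof.
rewrite /input_symbol; case: (ltnP p (size x)) => px; last first.
  by rewrite [nth None _ _]nth_default ?size_map //; case: a => [[b|w]|].
by rewrite (nth_map false) //; case: a => [[b|w]|] //=; rewrite eq_sym.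
Qed.

Section Derived.

Variables (Y V : pred nat).
Hypothesis modelV : model NF ax kill univ exis rule Y V.
Hypothesis yE : forall j, j < m -> forall i : 'I_K.+4, i = 1 :> nat ->
  nth false y j = Y (num 0 (mid + j) (Cell i (bit true))).
Hypothesis zE : forall j, j < m -> forall i : 'I_K.+4, i = 2 :> nat ->
  nth false z j = V (num 0 (mid + j) (Cell i (bit true))).

Lemma axiom_holds a j : j < J -> ax_at a 0 j -> V (num 0 j a).
Proof.
move=> jJ axj; have [mAx _ _ _ _] := modelV.
by apply: mAx; [apply: num_lt | rewrite /ax labelledE].
Qed.

(** Every model contains the facts of the run, within a window around the head that loses one cell
    on each side per step. At time [T] the cell under the head remains, and this is the one that
    [kill] inspects. *)
Lemma run_derived t : t <= T ->
  (forall g, V (num t 0 (Ctl ord0 (cstate (cfg t), g)))) /\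
  (forall (i : 'I_K.+1) j, mid <= j + (T - t) -> j <= mid + (T - t) ->
     V (num t j (Cell (inord i) (cell (ctape (cfg t) i) j)))).
Proof.
have [mAx mKill mRule mUniv mExis] := modelV.
have J0 : 0 < J by [].
elim: t => [|t IHt] tT.
  split=> [g|i j]; first by apply: axiom_holds => //=; rewrite !eqxx.
  rewrite subn0 => lo hi; have jJ : j < J by move: hi; rewrite /J /mid; lia.
  have iK : i < K.+4 by have := ltn_ord i; lia.
  rewrite cfg_cell0; case: (boolP ((mid <= j) && ((j < mid + m) &&
      (((inord i : 'I_K.+4) == 1 :> nat) || ((inord i : 'I_K.+4) == 2 :> nat))))) => inp; last first.
    apply: axiom_holds => //=; rewrite (negbTE inp) inordK //.
    case: (leqP mid j) => midj //=; rewrite midj /= inordK // in inp.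
    case: (altP (i =P 0 :> nat)) => [-> | i0] /=; first by rewrite input_symbolE.
    rewrite negb_and negb_or -leqNgt in inp; case/orP: inp => [jm|/andP[i1 i2]].
      by rewrite nth_default // size_map; case: (i : nat) i0 => [|[|[|[|k]]]] //= _; rewrite ?nth_nil ?szy ?szz //=; lia.
    by case: (i : nat) i0 i1 i2 => [|[|[|[|k]]]] //= _ _ _; rewrite !nth_nil.
  case/and3P: inp => midj jm; rewrite midj inordK // => ir.
  have jE : mid + (j - mid) = j by rewrite subnKC.
  have ltj : j - mid < m by lia.
  have inp r : i = r :> nat -> labelled (input_at r) (num 0 j (Cell (inord i) (bit true))).
    by move=> E; rewrite labelledE //= midj jm inordK // E !eqxx.
  case/orP: ir => /eqP ir.
    have := mUniv _ (inp 1 ir); rewrite ir /= (nth_map false) ?szy // (yE ltj (i := inord 1)) ?inordK //.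
    by rewrite jE -num_zero; case: (Y _).
  have := mExis _ (inp 2 ir); rewrite ir /= (nth_map false) ?szz // (zE ltj (i := inord 2)) ?inordK //.
  by rewrite jE -num_zero; case E : (V (num 0 j (Cell _ (bit true)))).
have [IHc IHx] := IHt (ltnW tT).
(* Among all guesses, the true one passes the confirmation at every tape. *)
have ctl i : i <= K.+1 -> V (num t 0 (Ctl (inord i) (sit t))).
  elim: i => [|i IHi] iK.
    have -> : inord 0 = ord0 :> 'I_K.+2 by apply: val_inj; rewrite /= inordK.
    exact: IHc.
  have iK' : i < K.+1 by [].
  have Vi := IHi (ltnW iK).
  have Vx := IHx (inord i) mid (leq_addr _ _) (leq_addr _ _).
  rewrite cell_mid in Vx; apply: mRule Vi Vx; rewrite ?num_lt ?mid_lt ?(ltnW tT) //.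
  have e1 : (inord i : 'I_K.+2) = i :> nat by rewrite inordK; lia.
  have e2 : (inord i.+1 : 'I_K.+2) = i.+1 :> nat by rewrite inordK; lia.
  have e3 : (inord i : 'I_K.+1) = i :> nat by rewrite inordK.
  have e4 : (inord i : 'I_K.+4) = i :> nat by rewrite inordK; lia.
  by apply: rule_intro; rewrite ?mid_lt //= e1 e2 e3 e4 iK' !eqxx /scans ffunE eqxx.
have Vtop : V (num 0 0 Top) by apply: axiom_holds.
have [cE tE] := cfg_step t; split=> [g|i j lo hi].
  apply: mRule (ctl K.+1 (leqnn _)) Vtop; rewrite ?num_lt ?(ltnW tT) //.
  by apply: rule_intro => //=; rewrite inordK // cE !eqxx.
have iK : i < K.+4 by have := ltn_ord i; lia.
have jJ : j < J by move: hi; rewrite /J /mid; lia.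
have [j' jj'] : exists j', shifted ((effect (sit t)).2 i).2 j j'.
  case: ((effect (sit t)).2 i).2 => /=; [exists j.-1 | by exists j | by exists j.+1].
  by move: lo; rewrite /mid; lia.
have lo' : mid <= j' + (T - t).
  by move: lo jj'; case: ((effect (sit t)).2 i).2 => /= lo /eqP; lia.
have hi' : j' <= mid + (T - t).
  by move: hi jj'; case: ((effect (sit t)).2 i).2 => /= hi /eqP; lia.
have jJ' : j' < J by move: hi'; rewrite /J /mid; lia.
rewrite tE (cell_step _ _ jj'); case: (altP (j' =P mid)) => [jm|jm].
  apply: mRule (ctl K.+1 (leqnn _)) Vtop; rewrite ?num_lt ?(ltnW tT) //.
  apply: rule_intro => //=; rewrite !inordK // ltn_ord inord_val !eqxx /=.
  by rewrite -jm.
apply: mRule (ctl K.+1 (leqnn _)) (IHx i j' lo' hi'); rewrite ?num_lt ?(ltnW tT) //.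
by apply: rule_intro => //=; rewrite !inordK // ltn_ord inord_val !eqxx /= jm.
Qed.

Lemma run_accepts (b : bool) : outputs_within M T xs [:: b] -> b.
Proof.
move=> [_]; rewrite -/(cfg T) /output /=.
have [_ /(_ ord0 mid (leq_addr _ _) (leq_addr _ _))] := run_derived (leqnn T).
rewrite cell_mid; have [_ mKill _ _ _] := modelV.
set s := scanned _ => Vs; have := mKill (num T mid (Cell (inord (ord0 : 'I_K.+1)) s)).
rewrite num_lt ?mid_lt // /kill labelledE ?mid_lt //= inordK // !eqxx /= => /(_ isT) H.
case: (altP (s =P bit true)) H => [-> _ [<-] //|_ /(_ isT)].
by rewrite Vs.
Qed.

End Derived.

(** The set of facts played by the existential player: what is true in the run. A control fact is
    tested only on the tapes that it has confirmed, and cells of tapes that the machine lacks keep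
    their initial word. *)
Definition trace_at (a : label) (t j : nat) : bool :=
  match a with
  | inl (inl _) => (t == 0) && (j == 0)
  | inl (inr (i, al)) => [&& j == 0, al.1 == cstate (cfg t) &
      [forall i' : 'I_K.+1, (i' < i) ==> (al.2 i' == scans t i')]]
  | inr (i, a) => a == (if i < K.+1 then cell (ctape (cfg t) (inord i)) j
                        else cell (tape_of M (nth [::] xs i)) j)
  end.

Lemma trace_cell0 i a j : trace_at (Cell i a) 0 j =
  (a == if mid <= j then nth None (map bit (nth [::] xs i)) (j - mid) else None).
Proof.
rewrite /trace_at /=; case: ltnP => iK; last by rewrite cell_init.
by rewrite cfg_cell0 inordK.
Qed.

Lemma trace_full (i : 'I_K.+2) al t j : K < i -> trace_at (Ctl i al) t j -> al = sit t /\ j = 0.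
Proof.
move=> iK /and3P[/eqP j0 /eqP a1 /forallP a2]; split=> //; case: al a1 a2 => q g /= -> a2.
congr (_, _); apply/ffunP => i'; have /implyP := a2 i'.
by rewrite (leq_trans (ltn_ord i')) // => /(_ isT)/eqP.
Qed.

(** The clauses preserve truth in the run, the choices agree with the letters of [y] and [z], and
    acceptance puts the bit 1 under the head of tape 0 at time [T]. *)
Lemma trace_model (Y : pred nat) (b : bool) :
  (forall j, j < m -> forall i : 'I_K.+4, i = 1 :> nat ->
     nth false y j = Y (num 0 (mid + j) (Cell i (bit true)))) ->
  outputs_within M T xs [:: b] -> b -> model NF ax kill univ exis rule Y (labelled trace_at).
Proof.
move=> yE [_ out] bT; rewrite bT {b bT} in out.
have accept : scanned (ctape (cfg T) ord0) = bit true.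
  move: out; rewrite -/(cfg T) /output /=.
  by case: (scanned _) => [[[]|]|] //= [].
split.
- move=> f _ /labelledP[a [fE axa]]; apply/labelledP; exists a; split=> //.
  move: axa; case: a fE => [[[]|[i al]]|[i a]] fE //.
    case/and4P=> /eqP t0 /eqP j0 /eqP i0 /eqP q0.
    rewrite /trace_at t0 j0 q0 !eqxx /=; apply/forallP => i'.
    by rewrite i0 ltn0.
  case/andP=> /eqP t0; rewrite t0 trace_cell0; case: (leqP mid (jf f)) => //= midj.
  case: (altP (i =P 0 :> nat)) => [-> |i0]; first by rewrite input_symbolE.
  case: ifP => // inp /eqP ->; apply/eqP; rewrite nth_default // size_map.
  move: inp; case: (i : nat) i0 => [|[|[|[|k]]]] //= _; rewrite ?andbT ?szy ?szz ?nth_nil //=; lia.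
- move=> f _ /labelledP[a [fE ka]]; apply/negP; rewrite fE labelledE ?jf_lt //.
  case: a ka {fE} => [//|[i a]] /and4P[/eqP t0 /eqP j0 /eqP i0 aT].
  rewrite /trace_at i0 /= t0 j0 cell_mid.
  have -> : inord 0 = ord0 :> 'I_K.+1 by apply: val_inj; rewrite /= inordK.
  by rewrite accept (negbTE aT).
- move=> u v w _ _ _ /ruleP[a [b [c [uE vE wE r]]]].
  rewrite uE vE wE !labelledE ?jf_lt //; move: r {uE vE wE}.
  move: (tf u) (jf u) (tf v) (jf v) (tf w) (jf w) => ta ja tb jb tc jc.
  have inord_lt (i : 'I_K.+4) : i < K.+1 -> nat_of_ord (inord i : 'I_K.+1) = i.
    by move=> iK; rewrite inordK.
  case: a => [[[]|[i al]]|[i s]] //; case: b => [[[]|[i' al']]|[i' s']] //;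
    case: c => [[[]|[i2 al2]]|[i2 s2]] //.
  + case/andP=> /and3P[/eqP iK /eqP i20 /eqP q2] /andP[/eqP tE /and4P[_ _ _ /eqP j0]].
    move=> /trace_full[|alE _]; first by rewrite iK.
    move=> _; rewrite /trace_at tE j0 q2 alE (proj1 (cfg_step ta)) !eqxx /=.
    by apply/forallP => i''; rewrite i20.
  + case/andP=> /and3P[/eqP iK i2K /eqP s2E] /andP[/eqP tE /and4P[_ _ _ sh]].
    move=> /trace_full[|alE _]; first by rewrite iK.
    move=> _; rewrite /trace_at i2K tE (proj2 (cfg_step ta)) -alE.
    by rewrite (cell_step _ _ sh) eqxx s2E.
  + case/andP=> /and4P[/andP[iK /eqP i'i] /eqP i2E /eqP alE /eqP sE].
    case/andP=> /eqP tE /and4P[/eqP tE' _ /eqP jm /eqP j0].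
    case/and3P=> _ /eqP q1 /forallP al1; rewrite /trace_at i'i iK jm cell_mid => /eqP s'E.
    rewrite -alE -tE' j0 q1 !eqxx /=; apply/forallP => i''; apply/implyP; rewrite i2E ltnS leq_eqVlt.
    case/predU1P => [E|]; last by move/implyP: (al1 i'').
    have -> : i'' = inord i by apply: val_inj; rewrite /= inordK // E.
    by rewrite -sE s'E /scans ffunE tE eqxx.
  + case/andP=> /and4P[/eqP iK i'K /eqP i2E /eqP sE] /andP[/eqP tE /and4P[/eqP tE' _ jm sh]].
    move=> /trace_full[|alE _]; first by rewrite iK.
    rewrite /trace_at i2E i'K tE tE' (proj2 (cfg_step ta)) -alE -sE.
    by rewrite (cell_step _ _ sh) (negbTE jm).
- move=> f /labelledP[a [fE]]; case: a fE => [//|[i a]] fE.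
  case/and5P=> /eqP t0 midj jm /eqP i1 /eqP aE.
  rewrite t0 aE in fE; have trE b : labelled trace_at (num 0 (jf f) (Cell i (bit b))) =
      (b == Y f).
    rewrite labelledE ?jf_lt // trace_cell0 midj i1 /= (nth_map false); last by rewrite szy; lia.
    rewrite (yE _ _ i) //; last by lia.
    by rewrite subnKC // -fE; case: (Y f); case: b.
  by rewrite {2 3}fE -num_zero !trE; case: (Y f).
- move=> f /labelledP[a [fE]]; case: a fE => [//|[i a]] fE.
  case/and5P=> /eqP t0 midj jm /eqP i2 /eqP aE.
  rewrite t0 aE in fE; have trE b : labelled trace_at (num 0 (jf f) (Cell i (bit b))) =
      (b == nth false z (jf f - mid)).
    rewrite labelledE ?jf_lt // trace_cell0 midj i2 /= (nth_map false); last by rewrite szz; lia.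
    by case: (nth _ _ _); case: b.
  by rewrite fE -num_zero !trE; case: (nth _ _ _).
Qed.

End Run.

Lemma tableau_correct (R : word -> word -> bool) :
  (forall y z, size y = m -> size z = m -> outputs_within M T [:: x; y; z] [:: R y z]) ->
  (forall y, size y = m -> exists2 z, size z = m & R y z) <->
  (forall Y, exists V, model NF ax kill univ exis rule Y V).
Proof.
move=> outR; split=> [win Y|win y szy].
  pose y := mkseq (fun j => Y (num 0 (mid + j) (Cell (inord 1) (bit true)))) m.
  have szy : size y = m by rewrite size_mkseq.
  have [z szz Rz] := win y szy; exists (labelled (trace_at y z)).
  apply: (trace_model szy szz) (outR y z szy szz) Rz => j jm i i1.
  by rewrite nth_mkseq // -i1 inord_val.
(* The position alone determines the letter: only cells of tape 1 at time 0 are universal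
   choices. *)
pose Y f := nth false y (jf f - mid).
have [V modelV] := win Y.
pose z := mkseq (fun j => V (num 0 (mid + j) (Cell (inord 2) (bit true)))) m.
have szz : size z = m by rewrite size_mkseq.
exists z => //; apply: (run_accepts szy szz modelV) (outR y z szy szz) => j jm i iE.
  rewrite /Y; have jJ : mid + j < J by rewrite /J /mid; lia.
  by have [_ -> _] := num_decode 0 (Cell i (bit true)) jJ; rewrite addKn.
by rewrite nth_mkseq // -iE inord_val.
Qed.

End Tableau.

(** * Hardness *)

(** Directed by the outermost operation of the body, so that unfolding a definition suffices to show
    it definable. Hence the tableau and the graph are written with boolean connectives, conditionals
    and entries of explicit lists. *)
Ltac dfn_step :=
  match goal with
  | |- forall _, _ => intro
  | |- dfnb (fun c s => _) => rewrite /dfnb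
  | |- dfn (fun c s => nat_of_bool (_ && _)) => apply: dfnb_and
  | |- dfn (fun c s => nat_of_bool (_ || _)) => apply: dfnb_or
  | |- dfn (fun c s => nat_of_bool (~~ _)) => apply: dfnb_not
  | |- dfn (fun c s => nat_of_bool (_ ==> _)) => apply: dfnb_imp
  | |- dfn (fun c s => nat_of_bool (if _ then _ else _)) => apply: dfnb_if
  | |- dfn (fun c s => nat_of_bool (@eq_op _ _ _)) => first [apply: dfnb_eq | apply: dfnb_eqb]
  | |- dfn (fun c s => nat_of_bool (leq _ _)) => apply: dfn_le
  | |- dfn (fun c s => nat_of_bool (all _ (iota 0 _))) => apply: dfnb_all
  | |- dfn (fun c s => nat_of_bool (has _ (iota 0 _))) => apply: dfnb_has
  | |- dfn (fun c s => nat_of_bool (nth false (_ 1) _)) => apply: (@dfn_bit (@Ordinal 3 0 isT))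
  | |- dfn (fun c s => nat_of_bool (nth false (_ 2) _)) => apply: (@dfn_bit (@Ordinal 3 1 isT))
  | |- dfn (fun c s => nat_of_bool (nth false (_ 3) _)) => apply: (@dfn_bit (@Ordinal 3 2 isT))
  | |- dfn (fun c s => size (_ 1)) => exact: (@dfn_len (@Ordinal 3 0 isT))
  | |- dfn (fun c s => size (_ 2)) => exact: (@dfn_len (@Ordinal 3 1 isT))
  | |- dfn (fun c s => size (_ 3)) => exact: (@dfn_len (@Ordinal 3 2 isT))
  | |- dfn (fun c s => head 0 s) => exact: (dfn_var 0)
  | |- dfn (fun c s => head 0 (behead s)) => exact: (dfn_var 1)
  | |- dfn (fun c s => head 0 (behead (behead s))) => exact: (dfn_var 2)
  | |- dfn (fun c s => head 0 (behead (behead (behead s)))) => exact: (dfn_var 3)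
  | |- dfn (fun c s => head 0 (behead (behead (behead (behead s))))) => exact: (dfn_var 4)
  | |- dfn (fun c s => addn _ _) => apply: dfn_add
  | |- dfn (fun c s => subn _ _) => apply: dfn_sub
  | |- dfn (fun c s => muln _ _) => apply: dfn_mul
  | |- dfn (fun c s => divn _ _) => apply: dfn_div
  | |- dfn (fun c s => modn _ _) => apply: dfn_mod
  | |- dfn (fun c s => predn _) => apply: dfn_pred
  | |- dfn (fun c s => if _ then _ else _) => apply: dfn_if
  | |- dfn (fun c s => nth _ [::] _) => apply: dfn_nth_nil
  | |- dfn (fun c s => nth _ (_ :: _) _) => apply: dfn_nth_cons
  | |- dfn (fun c s => bigop _ _ _) => apply: dfn_sum_nat
  | |- dfn (fun c s => nat_of_bool ?b) => exact: (dfnb_const b)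
  | |- dfn (fun c s => ?n) => exact: (dfn_const n)
  | |- dfn (fun c s => S _) => apply: dfn_S
  | |- dfn _ => assumption
  | H : _ |- dfn _ => solve [apply: H]
  end.

Ltac solve_dfn := cbv beta; repeat (dfn_step; cbv beta).

Section Reduction.

Variables (M : machine) (p q : {poly nat}).

Notation K := (tm_tapes M).

Definition choice_length (x : word) : nat := p.[size x]%R.
Definition running_time (x : word) : nat :=
  q.[(size x + choice_length x + choice_length x)%N]%R.

Let m x := choice_length x.
Let T x := running_time x.

Lemma dfn_m : dfn (fun c s => m (c 3)).
Proof. by rewrite /m /choice_length; apply: dfn_poly; solve_dfn. Qed.

Lemma dfn_T : dfn (fun c s => T (c 3)).
Proof.
have dm := dfn_m; rewrite /T /running_time; apply: dfn_poly.
by rewrite -/m; apply: dfn_add => //; apply: dfn_add => //; solve_dfn.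
Qed.

Lemma dfn_mid : dfn (fun c s => mid (m (c 3)) (T (c 3))).
Proof. by have dm := dfn_m; have dT := dfn_T; rewrite /mid; solve_dfn. Qed.

Lemma dfn_J : dfn (fun c s => J (m (c 3)) (T (c 3))).
Proof.
have dm := dfn_mid; apply: dfn_ext (dfn_S (dfn_add dm dm)) _ => c s.
by rewrite /J addnn.
Qed.

Lemma dfn_NF : dfn (fun c s => NF M (m (c 3)) (T (c 3))).
Proof. by have dT := dfn_T; have dJ := dfn_J; rewrite /NF; solve_dfn. Qed.

Lemma dfn_tf F : dfn F -> dfn (fun c s => tf M (m (c 3)) (T (c 3)) (F c s)).
Proof. by move=> dF; have dJ := dfn_J; rewrite /tf; solve_dfn. Qed.

Lemma dfn_jf F : dfn F -> dfn (fun c s => jf M (m (c 3)) (T (c 3)) (F c s)).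
Proof. by move=> dF; have dJ := dfn_J; rewrite /jf; solve_dfn. Qed.

Lemma dfn_lf F : dfn F -> dfn (fun c s => lf M (F c s)).
Proof. by move=> dF; rewrite /lf; solve_dfn. Qed.

Lemma dfn_labelled (P : ctx -> label M -> nat -> nat -> bool) F :
  (forall a, dfn (fun c s => nat_of_bool (P c a (head 0 s) (head 0 (behead s))))) -> dfn F ->
  dfn (fun c s => nat_of_bool (labelled (m (c 3)) (T (c 3)) (P c) (F c s))).
Proof.
move=> dP dF; rewrite /labelled; apply: (@dfnb_has_const _ (fun a c s =>
  (lf M (F c s) == idx a) && P c a (tf M (m (c 3)) (T (c 3)) (F c s)) (jf M (m (c 3)) (T (c 3)) (F c s)))).
move=> a; apply: dfnb_and; first by apply: dfnb_eq; [apply: dfn_lf | apply: dfn_const].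
apply: (@dfn_app2 (fun c t j => nat_of_bool (P c a t j))) => //.
  exact: dfn_tf.
exact: dfn_jf.
Qed.

Lemma dfn_ax F : dfn F -> dfn (fun c s => nat_of_bool (ax M (c 3) (m (c 3)) (T (c 3)) (F c s))).
Proof.
move=> dF; apply: (@dfn_labelled (fun c => ax_at (c 3) (m (c 3)) (T (c 3)))) => // a.
have dmid := dfn_mid; have dm := dfn_m.
case: a => [[[]|[i al]]|[i a]] /=; first by solve_dfn.
  by solve_dfn.
by rewrite /input_symbol; case: a => [[b|w]|]; solve_dfn.
Qed.

Lemma dfn_kill F : dfn F -> dfn (fun c s => nat_of_bool (kill M (m (c 3)) (T (c 3)) (F c s))).
Proof.
move=> dF; apply: (@dfn_labelled (fun c => @kill_at M (m (c 3)) (T (c 3)))) => // a.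
have dmid := dfn_mid; have dT := dfn_T.
by case: a => [[[]|[i al]]|[i a]] /=; solve_dfn.
Qed.

Lemma dfn_input r F : dfn F ->
  dfn (fun c s => nat_of_bool (labelled (m (c 3)) (T (c 3)) (@input_at M (m (c 3)) (T (c 3)) r) (F c s))).
Proof.
move=> dF; apply: (@dfn_labelled (fun c => @input_at M (m (c 3)) (T (c 3)) r)) => // a.
have dmid := dfn_mid; have dm := dfn_m.
by case: a => [[[]|[i al]]|[i a]] /=; solve_dfn.
Qed.

Lemma dfn_rule F G H : dfn F -> dfn G -> dfn H ->
  dfn (fun c s => nat_of_bool (rule M (m (c 3)) (T (c 3)) (F c s) (G c s) (H c s))).
Proof.
move=> dF dG dH; rewrite /rule.
apply: dfnb_has_const => a; apply: dfnb_has_const => b; apply: dfnb_has_const => d.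
have tF := dfn_tf dF; have tG := dfn_tf dG; have tH := dfn_tf dH.
have jF := dfn_jf dF; have jG := dfn_jf dG; have jH := dfn_jf dH.
have lF := dfn_lf dF; have lG := dfn_lf dG; have lH := dfn_lf dH.
have dmid := dfn_mid.
cbv beta; do 3 (apply: dfnb_and; first by apply: dfnb_eq; [assumption | apply: dfn_const]).
rewrite /rule_at; case: a => [[[]|[i al]]|[i a]]; try exact: dfnb_const;
  case: b => [[[]|[i' al']]|[i' a']]; try exact: dfnb_const;
  case: d => [[[]|[i2 al2]]|[i2 a2]]; try exact: dfnb_const.
- by solve_dfn.
- by rewrite /shifted; case: ((effect al).2 _).2; solve_dfn.
- by solve_dfn.
- by rewrite /shifted; case: ((effect al).2 _).2; solve_dfn.
Qed.

Let N x := NF M (m x) (T x).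
Let axR x := ax M x (m x) (T x).
Let killR x := kill M (m x) (T x).
Let univR x := univ M (m x) (T x).
Let exisR x := exis M (m x) (T x).
Let ruleR x := rule M (m x) (T x).

Definition parent1 x := par1 (N x) (axR x) (univR x) (exisR x) (ruleR x).
Definition parent2 x := par2 (N x) (killR x).
Definition vertices x := VN (N x).

Lemma dfn_N : dfn (fun c s => N (c 3)). Proof. exact: dfn_NF. Qed.

Lemma dfn_EN : dfn (fun c s => EN (N (c 3))).
Proof. by have dN := dfn_N; rewrite /EN; solve_dfn. Qed.

Lemma dfn_vertices : dfn (fun c s => vertices (c 3)).
Proof. by have dN := dfn_N; have dE := dfn_EN; rewrite /vertices /VN; solve_dfn. Qed.

Lemma dfn_enc C F E l : dfn C -> dfn F -> dfn E ->
  dfn (fun c s => enc (N (c 3)) (C c s) (F c s) (E c s) l).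
Proof. by move=> dC dF dE; have dN := dfn_N; have dEN := dfn_EN; rewrite /enc; solve_dfn. Qed.

Lemma dfn_src C F E k S : dfn C -> dfn F -> dfn E -> dfn S ->
  dfn (fun c s => src (N (c 3)) (univR (c 3)) (exisR (c 3)) (ruleR (c 3))
                      (C c s) (F c s) (E c s) k (S c s)).
Proof.
move=> dC dF dE dS; have dN := dfn_N; have dEN := dfn_EN.
have dru : dfn (fun c s => ru (N (c 3)) (E c s)) by rewrite /ru; solve_dfn.
have drv : dfn (fun c s => rv (N (c 3)) (E c s)) by rewrite /rv; solve_dfn.
have drw : dfn (fun c s => rw (N (c 3)) (E c s)) by rewrite /rw; solve_dfn.
have dact : dfn (fun c s => nat_of_bool (act (N (c 3)) (ruleR (c 3)) (E c s))).
  by rewrite /act; apply: dfn_rule.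
have dprev : dfn (fun c s => (F c s).-1) by solve_dfn.
have duniv := dfn_input 1 dF; have dexis := dfn_input 2 dF.
have duniv' := dfn_input 1 dprev; have dexis' := dfn_input 2 dprev.
have dpe : dfn (fun c s => if E c s == 0 then (EN (N (c 3))).-1 else (E c s).-1) by solve_dfn.
have d0 : dfn (fun _ _ => 0) by apply: dfn_const.
have e0 := dfn_enc 2 dC dF dpe; have e1 := dfn_enc 2 dC dN dE.
have e2 := dfn_enc 13 dC dF d0; have e3 := dfn_enc 15 dC dprev d0.
have e4 := dfn_enc 17 dC dF d0; have e5 := dfn_enc 18 dC dprev d0.
have e6 := dfn_enc 3 dC dru dE; have e7 := dfn_enc 3 dC drv dE.
by rewrite /src; solve_dfn.
Qed.

Lemma dfn_par1_at C F E Lb : dfn C -> dfn F -> dfn E -> dfn Lb ->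
  dfn (fun c s => par1_at (N (c 3)) (axR (c 3)) (univR (c 3)) (exisR (c 3)) (ruleR (c 3))
                      (C c s) (F c s) (E c s) (Lb c s)).
Proof.
move=> dC dF dE dL; have dN := dfn_N; have dEN := dfn_EN.
have el l := dfn_enc l dC dF dE; have sl k l := dfn_src k dC dF dE (el l).
have dax := dfn_ax dF.
have dself : dfn (fun c s => enc (N (c 3)) (C c s) (F c s) (E c s) (Lb c s)).
  by rewrite /enc; solve_dfn.
by rewrite /par1_at; cbv zeta beta; solve_dfn.
Qed.

Lemma dfn_par2_at C F E Lb : dfn C -> dfn F -> dfn E -> dfn Lb ->
  dfn (fun c s => par2_at (N (c 3)) (killR (c 3)) (C c s) (F c s) (E c s) (Lb c s)).
Proof.
move=> dC dF dE dL; have dN := dfn_N; have dEN := dfn_EN.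
have el l := dfn_enc l dC dF dE; have dkill := dfn_kill dF.
have dself : dfn (fun c s => enc (N (c 3)) (C c s) (F c s) (E c s) (Lb c s)).
  by rewrite /enc; solve_dfn.
by rewrite /par2_at; cbv zeta beta; solve_dfn.
Qed.

Lemma dfn_parent1 F : dfn F -> dfn (fun c s => parent1 (c 3) (F c s)).
Proof.
move=> dF; have dN := dfn_N; have dEN := dfn_EN.
by rewrite /parent1 /par1; apply: dfn_par1_at; rewrite /cb /fb /eb /lb; solve_dfn.
Qed.

Lemma dfn_parent2 F : dfn F -> dfn (fun c s => parent2 (c 3) (F c s)).
Proof.
move=> dF; have dN := dfn_N; have dEN := dfn_EN.
by rewrite /parent2 /par2; apply: dfn_par2_at; rewrite /cb /fb /eb /lb; solve_dfn.
Qed.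

End Reduction.

(** * Encodings computed letter by letter *)

Lemma mkseq_add (T : Type) (f : nat -> T) a b :
  mkseq f (a + b) = mkseq f a ++ mkseq (fun i => f (a + i)) b.
Proof. by rewrite /mkseq iotaD map_cat add0n -{2}[a]addn0 iotaDl -map_comp. Qed.

Lemma allpairs_mkseq (T : Type) (g : nat -> nat -> T) a n :
  [seq g u v | u <- iota 0 a, v <- iota 0 n] = mkseq (fun k => g (k %/ n) (k %% n)) (a * n).
Proof.
elim: a => [|a IHa] //; rewrite mulSnr mkseq_add -IHa -[a.+1]addn1 iotaD allpairs_cat.
congr (_ ++ _); rewrite allpairs1l add0n /mkseq; apply/eq_in_map => v.
rewrite mem_iota add0n => /= vn.
by rewrite divnMDl ?modnMDl 1?divn_small ?modn_small ?addn0 //; apply: leq_trans vn.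
Qed.

Lemma adjacency_bits_mkseq n (G : sgraph 'I_n) (g : nat -> nat -> bool) :
  (forall u v : 'I_n, G u v = g u v) ->
  adjacency_bits G = mkseq (fun k => g (k %/ n) (k %% n)) (n * n).
Proof.
move=> Gg; rewrite -allpairs_mkseq -!val_enum_ord allpairs_mapl allpairs_mapr.
by apply: eq_allpairs => // u v.
Qed.

(** The letter of an encoding at position [i]. Terms produce an output one letter at a time, so row
    and column are recovered by division. *)
Definition graph_bit n (g1 g2 : nat -> nat -> bool) (i : nat) : bool :=
  if i < n then true else if i == n then false else
  if i - n.+1 < n * n then g1 ((i - n.+1) %/ n) ((i - n.+1) %% n)
  else g2 ((i - n.+1 - n * n) %/ n) ((i - n.+1 - n * n) %% n).

Lemma encode_mkseq n (G1 G2 : sgraph 'I_n) (g1 g2 : nat -> nat -> bool) :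
  (forall u v : 'I_n, G1 u v = g1 u v) -> (forall u v : 'I_n, G2 u v = g2 u v) ->
  encode G1 G2 = mkseq (graph_bit n g1 g2) (n + (n * n + n * n).+1).
Proof.
move=> E1 E2; rewrite /encode (adjacency_bits_mkseq E1) (adjacency_bits_mkseq E2).
rewrite mkseq_add -addn1 addnC mkseq_add mkseq_add; congr (_ ++ _).
  apply: (@eq_from_nth _ true); rewrite ?size_nseq ?size_mkseq // => i ltin.
  by rewrite nth_nseq nth_mkseq // ltin /graph_bit ltin.
congr (_ :: _ ++ _); first by rewrite /graph_bit addn0 ltnn eqxx.
  apply/eq_in_map => k; rewrite mem_iota => /= kn; rewrite /graph_bit.
  have -> : (n + (1 + k) < n) = false by lia.
  have -> : (n + (1 + k) == n) = false by lia.
  by have -> : n + (1 + k) - n.+1 = k by [lia]; rewrite kn.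
apply/eq_in_map => k; rewrite mem_iota => /= kn; rewrite /graph_bit.
have -> : (n + (1 + (n * n + k)) < n) = false by lia.
have -> : (n + (1 + (n * n + k)) == n) = false by lia.
have -> : n + (1 + (n * n + k)) - n.+1 = n * n + k by lia.
by rewrite ltnNge leq_addr /= addKn.
Qed.

Lemma adjacency_bits_inj n (G H : sgraph 'I_n) :
  adjacency_bits G = adjacency_bits H -> forall u v, G u v = H u v.
Proof.
pose g (F : sgraph 'I_n) u v := [exists u' : 'I_n, exists v' : 'I_n,
  [&& u' == u :> nat, v' == v :> nat & F u' v']].
have gE (F : sgraph 'I_n) (u v : 'I_n) : F u v = g F u v.
  apply/idP/existsP => [uv|[u' /existsP[v' /and3P[/eqP/val_inj -> /eqP/val_inj -> //]]]].
  by exists u; apply/existsP; exists v; rewrite !eqxx.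
rewrite (adjacency_bits_mkseq (gE G)) (adjacency_bits_mkseq (gE H)) => E u v.
have ltuv : u * n + v < n * n.
  apply: leq_trans (_ : u.+1 * n <= _); first by rewrite mulSnr ltn_add2l.
  by rewrite leq_mul2r ltn_ord orbT.
have := congr1 (fun s => nth false s (u * n + v)) E; rewrite !nth_mkseq // !gE.
rewrite divnMDl ?modnMDl; last by apply: leq_ltn_trans (ltn_ord u).
by rewrite divn_small ?modn_small ?addn0.
Qed.

Lemma size_adjacency_bits n (G : sgraph 'I_n) : size (adjacency_bits G) = n * n.
Proof. by rewrite size_allpairs size_enum_ord. Qed.

(** The encoding is injective: its first 0 reveals the number of vertices, which splits the rest
    into the two matrices. So the graphs that witness membership have the adjacencies of the given
    ones. *)
Lemma language_encode n (F1 F2 : sgraph 'I_n) : is_forest F1 -> is_forest F2 ->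
  union_of_two_forests_3_choosability (encode F1 F2) <-> choosable 3 (graph_union F1 F2).
Proof.
move=> f1 f2; split=> [[n' [F1' [F2' [E _ _ ch]]]]|ch]; last by exists n, F1, F2.
have index_encode k (G1 G2 : sgraph 'I_k) : index false (encode G1 G2) = k.
  rewrite /encode index_cat size_nseq mem_nseq andbF /=.
  by rewrite addn0.
have nn' : n = n' by rewrite -(index_encode _ F1 F2) E index_encode.
move: nn' F1' F2' E ch => <- F1' F2' E ch.
have /eqP := E; rewrite /encode eqseq_cat // eqxx /= eqseq_cons eqxx /= eqseq_cat ?size_adjacency_bits //.
case/andP=> /eqP/adjacency_bits_inj E1 /eqP/adjacency_bits_inj E2.
move=> S cardS; have [c [cS cE]] := ch S cardS; exists c; split=> // u v uv.
by apply: cE; rewrite /= /union_adj -E1 -E2.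
Qed.

Theorem Pi2p_hard (A : language) : in_Pi2p A -> reduces A union_of_two_forests_3_choosability.
Proof.
move=> [R [p [[M [q HM]] HA]]].
pose F1 x := par_graph (vertices M p q x) (parent1 M p q x).
pose F2 x := par_graph (vertices M p q x) (parent2 M p q x).
exists (fun x => encode (F1 x) (F2 x)); split.
  have dV := dfn_vertices M p q.
  have [eN eNE] : dfn (fun c s => vertices M p q (c 3) +
      (vertices M p q (c 3) * vertices M p q (c 3) + vertices M p q (c 3) * vertices M p q (c 3)).+1).
    by solve_dfn.
  have [eb ebE] : dfnb (fun c s => graph_bit (vertices M p q (c 3))
      (par_adj (parent1 M p q (c 3))) (par_adj (parent2 M p q (c 3))) (head 0 s)).
    have d1 := @dfn_parent1 M p q; have d2 := @dfn_parent2 M p q.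
    rewrite /graph_bit /par_adj; cbv zeta beta.
    do ! [dfn_step; cbv beta]; try (by apply: d1; solve_dfn); by apply: d2; solve_dfn.
  apply: (@polytime_fun_terms eN eb) => x; rewrite eNE.
  rewrite (@encode_mkseq _ _ _ (par_adj (parent1 M p q x)) (par_adj (parent2 M p q x))) //.
  by apply: eq_mkseq => i; rewrite ebE /=; case: (graph_bit _ _ _ _).
move=> x; rewrite HA.
pose m := choice_length p x; pose T := running_time p q x.
have outR y z : size y = m -> size z = m -> outputs_within M T [:: x; y; z] [:: R x y z].
  by move=> sy sz; have := HM x y z; rewrite sy sz.
have [f1 f2 chE] := @game_choosable (NF M m T) (ax M x m T) (kill M m T) (univ M m T)
  (exis M m T) (rule M m T) (NF_gt4 M m T) (@rule_neq M m T)
  (@input_lt M m T 1) (@input_lt M m T 2).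
rewrite (language_encode f1 f2) chE.
exact: (tableau_correct outR).
Qed.

(** * Membership *)

(** The length of the longest prefix of ones, as the number of nonempty prefixes of ones, since
    terms can sum but not search. *)
Definition leading_ones (x : word) : nat :=
  \sum_(0 <= i < size x) all (fun j => nth false x j) (iota 0 i.+1).

Definition edge1 (x : word) (u v : nat) : bool :=
  nth false x (leading_ones x + (u * leading_ones x + v).+1).

Definition edge2 (x : word) (u v : nat) : bool :=
  nth false x (leading_ones x + (leading_ones x * leading_ones x + (u * leading_ones x + v)).+1).

Definition simple_relation (n : nat) (g : nat -> nat -> bool) : bool :=
  all (fun u => ~~ g u u && all (fun v => g u v == g v u) (iota 0 n)) (iota 0 n).

Definition well_formed (x : word) : bool :=
  let n := leading_ones x in
  [&& size x == n + (n * n + n * n).+1, simple_relation n (edge1 x) & simple_relation n (edge2 x)].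

(* The [u]-th number in a table of numbers at most [l], each one written as the
   number of ones in a block of length [l]; the table starts at position [o]. *)
Definition entry (w : word) (o l u : nat) : nat :=
  \sum_(0 <= k < l) nth false w (o + (u * l + k)).

Definition ranking_check (n : nat) (g : nat -> nat -> bool) (rk : nat -> nat) : bool :=
  all (fun u => all (fun v => (g u v ==> (rk u != rk v)) &&
    all (fun w => [&& g u v, g u w, rk v < rk u & rk w < rk u] ==> (v == w)) (iota 0 n))
    (iota 0 n)) (iota 0 n).

Definition list_check (n l : nat) (y : word) : bool :=
  all (fun u => entry y 0 l u == 3) (iota 0 n).

Definition colour_check (n l : nat) (g : nat -> nat -> bool) (y : word) (col : nat -> nat) : bool :=
  all (fun u => ((col u < l) && nth false y (u * l + col u)) &&
    all (fun v => g u v ==> (col u != col v)) (iota 0 n)) (iota 0 n).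

(* [y] lists colours among 3 * size x; [z] holds rankings of both graphs and a
   colouring. *)
Definition verifier (x y z : word) : bool :=
  let n := leading_ones x in let b := size x in
  well_formed x &&
  (ranking_check n (edge1 x) (entry z 0 b) &&
  (ranking_check n (edge2 x) (entry z (b * b) b) &&
  (* A word [y] that does not give three colours to each vertex imposes no condition on the
     colouring. *)
  (list_check n (3 * b) y ==>
   colour_check n (3 * b) (fun u v => edge1 x u v || edge2 x u v) y
     (entry z (b * b + b * b) (3 * b))))).

Lemma verifier_polytime : polytime_rel verifier.
Proof.
have dn : dfn (fun c s => leading_ones (c 3)) by rewrite /leading_ones; solve_dfn.
have d1 F G : dfn F -> dfn G -> dfn (fun c s => nat_of_bool (edge1 (c 3) (F c s) (G c s))).
  by move=> dF dG; rewrite /edge1; solve_dfn.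
have d2 F G : dfn F -> dfn G -> dfn (fun c s => nat_of_bool (edge2 (c 3) (F c s) (G c s))).
  by move=> dF dG; rewrite /edge2; solve_dfn.
have dw i O l F : dfn O -> dfn l -> dfn F -> dfn (fun c s =>
    entry (c (i : 'I_3).+1) (O c s) (l c s) (F c s)).
  move=> dO dl dF; have [wO wl wF] : [/\ dfn (fun c s => O c (behead s)),
      dfn (fun c s => l c (behead s)) & dfn (fun c s => F c (behead s))].
    by split; apply: dfn_weak.
  by rewrite /entry; apply: dfn_sum_nat => //; apply: dfn_bit; solve_dfn.
have dy O l F : dfn O -> dfn l -> dfn F -> dfn (fun c s => entry (c 1) (O c s) (l c s) (F c s)).
  exact: (dw (@Ordinal 3 0 isT)).
have dz O l F : dfn O -> dfn l -> dfn F -> dfn (fun c s => entry (c 2) (O c s) (l c s) (F c s)).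
  exact: (dw (@Ordinal 3 1 isT)).
have db : dfn (fun c s => size (c 3)) by solve_dfn.
have [e eE] : dfnb (fun c s => verifier (c 3) (c 1) (c 2)).
  rewrite /verifier /well_formed /simple_relation /ranking_check /list_check /colour_check.
  cbv zeta beta.
  by repeat first [dfn_step; cbv beta | apply: d1 | apply: d2 | apply: dy | apply: dz].
by apply: (@polytime_rel_term e) => x y z; rewrite eE eqb0 negbK.
Qed.

Lemma sum_ltn l r : r <= l -> \sum_(0 <= k < l) (k < r) = r.
Proof.
move=> rl; rewrite big_mkord.
have -> : \sum_(k < l) (k < r) = \sum_(k < l | k < r) 1.
  by rewrite [RHS]big_mkcond; apply: eq_bigr => k _; case: ifP.
by rewrite (big_ord_narrow rl) sum1_card card_ord.
Qed.

Lemma entry_mkseq (s t : word) (f : nat -> nat) n l u : u < n -> f u <= l ->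
  entry (s ++ mkseq (fun i => i %% l < f (i %/ l)) (n * l) ++ t) (size s) l u = f u.
Proof.
move=> un fl; rewrite -[RHS](sum_ltn fl) /entry; apply: eq_big_nat => k /andP[_ kl].
rewrite nth_cat ltnNge leq_addr /= addKn nth_cat size_mkseq.
have ulk : u * l + k < n * l.
  apply: leq_trans (_ : u.+1 * l <= _); first by rewrite mulSnr ltn_add2l.
  by rewrite leq_mul2r un orbT.
have l0 : 0 < l by apply: leq_ltn_trans kl.
by rewrite ulk nth_mkseq // divnMDl // modnMDl divn_small // modn_small // addn0.
Qed.

(** * Reading an encoded pair of graphs *)

Section Encoded.

Variables (n : nat) (F1 F2 : sgraph 'I_n).
Let x := encode F1 F2.

Lemma size_encode : size x = n + (n * n + n * n).+1.
Proof. by rewrite /x /encode size_cat size_nseq /= size_cat !size_adjacency_bits. Qed.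

Lemma leading_ones_encode : leading_ones x = n.
Proof.
have nx : n <= size x by rewrite size_encode leq_addr.
rewrite /leading_ones -[RHS](sum_ltn nx); apply: eq_big_nat => i /andP[_ ix]; congr nat_of_bool.
have bitE j : j <= n -> nth false x j = (j < n).
  rewrite /x /encode nth_cat size_nseq nth_nseq => jn; case: ltnP => // nj.
  by have -> : j - n = 0 by lia.
apply/allP/idP => [ones|ltin j]; last first.
  by rewrite mem_iota ltnS => /= ji; rewrite bitE; lia.
rewrite ltnNge; apply/negP => ni; have := ones n; rewrite mem_iota ltnS ni => /(_ isT).
by rewrite bitE // ltnn.
Qed.

Lemma nth_adjacency_bits (G : sgraph 'I_n) (u v : 'I_n) :
  nth false (adjacency_bits G) (u * n + v) = G u v.
Proof.
pose g u v := [exists u' : 'I_n, exists v' : 'I_n, [&& u' == u :> nat, v' == v :> nat & G u' v']].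
have gE (u' v' : 'I_n) : G u' v' = g u' v'.
  apply/idP/existsP => [uv|[a /existsP[b /and3P[/eqP/val_inj -> /eqP/val_inj -> //]]]].
  by exists u'; apply/existsP; exists v'; rewrite !eqxx.
have ltuv : u * n + v < n * n.
  apply: leq_trans (_ : u.+1 * n <= _); first by rewrite mulSnr ltn_add2l.
  by rewrite leq_mul2r ltn_ord orbT.
rewrite (adjacency_bits_mkseq gE) nth_mkseq // gE.
rewrite divnMDl ?modnMDl; last by apply: leq_ltn_trans (ltn_ord u).
by rewrite divn_small ?modn_small ?addn0.
Qed.

Lemma edge1_encode (u v : 'I_n) : edge1 x u v = F1 u v.
Proof.
rewrite /edge1 leading_ones_encode -[in RHS]nth_adjacency_bits /x /encode nth_cat size_nseq.
rewrite ltnNge leq_addr /= addKn /= nth_cat size_adjacency_bits.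
have -> // : u * n + v < n * n.
apply: leq_trans (_ : u.+1 * n <= _); first by rewrite mulSnr ltn_add2l.
by rewrite leq_mul2r ltn_ord orbT.
Qed.

Lemma edge2_encode (u v : 'I_n) : edge2 x u v = F2 u v.
Proof.
rewrite /edge2 leading_ones_encode -[in RHS]nth_adjacency_bits /x /encode nth_cat size_nseq.
by rewrite ltnNge leq_addr /= addKn /= nth_cat size_adjacency_bits ltnNge leq_addr /= addKn.
Qed.

End Encoded.

Lemma all_iotaP n (P : pred nat) : reflect (forall u : 'I_n, P u) (all P (iota 0 n)).
Proof.
apply: (iffP allP) => [allP u|allP u]; first by apply: allP; rewrite mem_iota ltn_ord.
by rewrite mem_iota => /= un; apply: (allP (Ordinal un)).
Qed.

Lemma well_formed_encode n (F1 F2 : sgraph 'I_n) : well_formed (encode F1 F2).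
Proof.
rewrite /well_formed leading_ones_encode size_encode eqxx /=.
apply/andP; split; apply/all_iotaP => u; apply/andP; split.
- by rewrite edge1_encode adj_irr.
- by apply/all_iotaP => v; rewrite !edge1_encode adj_sym.
- by rewrite edge2_encode adj_irr.
- by apply/all_iotaP => v; rewrite !edge2_encode adj_sym.
Qed.

Lemma relation_graph n (g : nat -> nat -> bool) : simple_relation n g ->
  exists G : sgraph 'I_n, forall u v, G u v = g u v.
Proof.
move=> /all_iotaP simple.
have sym : symmetric (fun u v : 'I_n => g u v).
  by move=> u v; have /andP[_ /all_iotaP/(_ v)/eqP] := simple u.
have irr : irreflexive (fun u v : 'I_n => g u v).
  by move=> u; have /andP[/negbTE] := simple u.
by exists (SGraph sym irr).
Qed.

Lemma well_formedP x : well_formed x -> exists F1 F2 : sgraph 'I_(leading_ones x),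
  x = encode F1 F2.
Proof.
set n := leading_ones x; case/and3P=> /eqP szx /relation_graph[F1 E1] /relation_graph[F2 E2].
exists F1, F2; rewrite (encode_mkseq E1 E2); apply: (@eq_from_nth _ false).
  by rewrite size_mkseq.
move=> i ix; rewrite nth_mkseq -?szx // /graph_bit.
(* A 0 at position [j] stops the count, so all letters before position [n] are ones. *)
have leading j : nth false x j = false -> n <= j.
  move=> xj; rewrite /n /leading_ones leqNgt; apply/negP => lt.
  have : \sum_(0 <= i < size x) all (fun k => nth false x k) (iota 0 i.+1) <= 
      \sum_(0 <= i < size x) (i < j).
    apply: leq_sum => k _; case: (boolP (all _ _)) => // /allP ones; rewrite lt0b.
    by rewrite ltnNge; apply/negP => jk; have := ones j; rewrite mem_iota ltnS jk xj => /(_ isT).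
  case: (leqP j (size x)) => jx; first by rewrite sum_ltn // leqNgt lt.
  move=> _; have : leading_ones x <= size x.
    apply: leq_trans (_ : \sum_(0 <= i < size x) 1 <= _).
      by apply: leq_sum => k _; apply: leq_b1.
    by rewrite sum_nat_const_nat subn0 muln1.
  by rewrite leqNgt (ltn_trans jx lt).
have before j : j < n -> nth false x j.
  by move=> jn; apply/negPn/negP => /negbTE/leading; rewrite leqNgt jn.
case: (ltngtP i n) => [/before //|ni|->]; last first.
  (* A 1 at position [n] would add one more prefix of ones to the count. *)
  apply/negbTE/negP => xn; have nx : n < size x by rewrite szx; lia.
  suff: n.+1 <= n by rewrite ltnn.
  rewrite {2}/n /leading_ones -[X in X <= _](sum_ltn nx); apply: leq_sum => k _.
  rewrite ltnS; case: (leqP k n) => // kn.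
  suff -> : all (fun j => nth false x j) (iota 0 k.+1) by [].
  apply/allP => j; rewrite mem_iota ltnS /= => jk; have := leq_trans jk kn; rewrite leq_eqVlt.
  by case/predU1P => [-> //|/before].
have kE : n + (i - n.+1).+1 = i by lia.
case: ltnP => k1; first by rewrite /edge1 -/n -divn_eq kE.
rewrite /edge2 -/n -divn_eq.
by have -> : n + (n * n + (i - n.+1 - n * n)).+1 = i by lia.
Qed.

Lemma ranking_checkP n (G : sgraph 'I_n) (g : nat -> nat -> bool) (rk : nat -> nat) :
  (forall u v : 'I_n, g u v = G u v) ->
  reflect (ranking G (fun v : 'I_n => rk v)) (ranking_check n g rk).
Proof.
move=> gG; apply: (iffP (all_iotaP _ _)) => [rkP|[neq par] u].
  split=> [u v uv|u v w uv uw rv rw].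
    by have /all_iotaP/(_ v)/andP[] := rkP u; rewrite gG uv.
  have /all_iotaP/(_ v)/andP[_ /all_iotaP/(_ w)] := rkP u.
  by rewrite !gG uv uw rv rw => /eqP/val_inj.
apply/all_iotaP => v; rewrite gG; apply/andP; split; first by apply/implyP/neq.
apply/all_iotaP => w; rewrite !gG; apply/implyP => /and4P[uv uw rv rw].
by rewrite (par u v w).
Qed.

Lemma edge_encode n (F1 F2 : sgraph 'I_n) (u v : 'I_n) :
  edge1 (encode F1 F2) u v || edge2 (encode F1 F2) u v = graph_union F1 F2 u v.
Proof. by rewrite edge1_encode edge2_encode. Qed.

(** With [b] the size of the input, [z] consists of two rankings in [b] blocks of length [b] each
    and of a colouring in [b] blocks of length [3 * b]. The same length leaves room for the lists in
    [y]. *)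
Definition witness_length : {poly nat} := (5%:P * 'X^2)%R.

Lemma witness_lengthE n : witness_length.[n]%R = n * n + (n * n + n * (3 * n)).
Proof.
rewrite /witness_length hornerM hornerC hornerXn.
have -> : (n ^+ 2)%R = n * n by [].
by rewrite -[(_ * _)%R]/(muln 5 (n * n)); lia.
Qed.

Lemma verifier_complete n (F1 F2 : sgraph 'I_n) y :
  is_forest F1 -> is_forest F2 -> choosable 3 (graph_union F1 F2) ->
  exists2 z, size z = witness_length.[size (encode F1 F2)]%R & verifier (encode F1 F2) y z.
Proof.
set x := encode F1 F2; set b := size x.
move=> /forest_ranking[rk1 rk1P lt1] /forest_ranking[rk2 rk2P lt2] ch.
have nb : n <= b by rewrite /b size_encode leq_addr.
(* If [y] does not encode lists of three colours, the colouring is not tested and a constant one is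
   used. *)
have [col [ltcol colP]] : exists col : 'I_n -> nat, (forall v, col v < 3 * b) /\
    (list_check n (3 * b) y -> (forall v : 'I_n, nth false y (v * (3 * b) + col v)) /\
       forall u v, graph_union F1 F2 u v -> col u != col v).
  case: (boolP (list_check n (3 * b) y)) => [/all_iotaP lists|_]; last first.
    by exists (fun=> 0); split=> // v; have := ltn_ord v; lia.
  pose S (v : 'I_n) := [seq Posz c | c <- iota 0 (3 * b) & nth false y (v * (3 * b) + c)].
  have [|c [cS cE]] := ch (fun v => seq_fset tt (S v)).
    move=> v; rewrite size_seq_fset undup_id; last first.
      by rewrite map_inj_uniq ?filter_uniq ?iota_uniq // => ? ? [].
    rewrite size_map size_filter -sum1_count big_mkcond /=.
    apply: etrans (eqP (lists v)); rewrite /entry /index_iota subn0.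
    by apply: eq_bigr => i _; rewrite add0n; case: (nth _ _ _).
  have cmem v : exists2 k, c v = Posz k & (k < 3 * b) && nth false y (v * (3 * b) + k).
    have := cS v; rewrite seq_fsetE => /mapP[k]; rewrite mem_filter mem_iota => /andP[yk kb] ->.
    by exists k => //; rewrite yk andbT.
  exists (fun v => absz (c v)); split=> [v|_]; first by have [k -> /andP[]] := cmem v.
  split=> [v|u v uv]; first by have [k -> /andP[]] := cmem v.
  have := cE u v uv; have [k -> _] := cmem u; have [k' -> _] := cmem v.
  by apply: contra => /eqP /= ->.
pose lift (f : 'I_n -> nat) (u : nat) := if insub u is Some v then f v else 0.
have liftE f (v : 'I_n) : lift f v = f v by rewrite /lift valK.
pose block f c l := mkseq (fun i => i %% l < lift f (i %/ l)) (c * l).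
pose z := block rk1 b b ++ (block rk2 b b ++ block col b (3 * b)).
exists z; first by rewrite witness_lengthE !size_cat !size_mkseq.
have vb (v : 'I_n) : v < b by apply: leq_trans (ltn_ord v) nb.
have z1 (v : 'I_n) : entry z 0 b v = rk1 v.
  rewrite -(liftE rk1); apply: (@entry_mkseq [::] (block rk2 b b ++ block col b (3 * b))) => //.
  by rewrite liftE; have := lt1 v; rewrite card_ord; lia.
have z2 (v : 'I_n) : entry z (b * b) b v = rk2 v.
  rewrite -(liftE rk2) -{1}(size_mkseq (fun i => i %% b < lift rk1 (i %/ b)) (b * b)).
  by apply: entry_mkseq => //; rewrite liftE; have := lt2 v; rewrite card_ord; lia.
have z3 (v : 'I_n) : entry z (b * b + b * b) (3 * b) v = col v.
  have -> : b * b + b * b = size (block rk1 b b ++ block rk2 b b).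
    by rewrite size_cat !size_mkseq.
  rewrite -(liftE col) /z -[block col _ _]cats0 catA.
  by apply: entry_mkseq => //; rewrite liftE ltnW.
rewrite /verifier leading_ones_encode well_formed_encode /=.
apply/and3P; split.
- apply/(ranking_checkP _ (@edge1_encode n F1 F2)); case: rk1P => neq par.
  by split=> [u v|u v w]; rewrite !z1; [apply: neq | apply: par].
- apply/(ranking_checkP _ (@edge2_encode n F1 F2)); case: rk2P => neq par.
  by split=> [u v|u v w]; rewrite !z2; [apply: neq | apply: par].
apply/implyP => /colP[ycol neq]; apply/all_iotaP => u; rewrite z3 ltcol ycol /=.
by apply/all_iotaP => v; rewrite edge_encode z3; apply/implyP/neq.
Qed.

(** A word [y] of zeros already yields that the input encodes two forests. Given lists are then
    renamed into the palette and presented as a second [y], whose answer is translated back. *)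
Lemma verifier_sound x :
  (forall y, size y = witness_length.[size x]%R ->
     exists2 z, size z = witness_length.[size x]%R & verifier x y z) ->
  union_of_two_forests_3_choosability x.
Proof.
move=> win.
have [|z0 _ /andP[wf _]] := win (nseq witness_length.[size x]%R false); first by rewrite size_nseq.
have [n [F1 [F2 xE]]] : exists n (F1 F2 : sgraph 'I_n), x = encode F1 F2.
  by have [F1 [F2 xE]] := well_formedP wf; exists (leading_ones x), F1, F2.
rewrite {wf z0}xE in win *; set b := size (encode F1 F2).
have nb : n <= b by rewrite /b size_encode leq_addr.
exists n, F1, F2; have [|z0 _] := win (nseq witness_length.[b]%R false); first by rewrite size_nseq.
rewrite /verifier leading_ones_encode => /and4P[_].
move=> /(ranking_checkP _ (@edge1_encode n F1 F2))/ranking_forest f1.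
move=> /(ranking_checkP _ (@edge2_encode n F1 F2))/ranking_forest f2 _.
split=> // S cardS; pose l := 3 * b.
(* All colours that occur, at most three for each vertex; a colour is represented by its position in
   [P], which fits into a palette of size [3 * b]. *)
pose P := undup (flatten [seq enum_fset (S v) | v <- enum 'I_n]).
have memP v c : c \in S v -> c \in P.
  move=> cv; rewrite mem_undup; apply/flattenP; exists (enum_fset (S v)) => //.
  by apply: map_f; rewrite mem_enum.
have szP : size P <= l.
  apply: leq_trans (size_undup _) _; rewrite size_flatten /shape -map_comp sumnE big_map.
  rewrite (eq_bigr (fun=> 3)) => [|v _]; last exact: cardS.
  by rewrite big_const_seq count_predT size_enum_ord iter_addn_0 leq_mul2l nb.
pose mem_at (u k : nat) : bool :=
  if insub u is Some v then (k < size P) && (nth 0%R P k \in S (v : 'I_n)) else false.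
have memE (v : 'I_n) k : mem_at v k = (k < size P) && (nth 0%R P k \in S v) by rewrite /mem_at valK.
pose y := mkseq (fun i => mem_at (i %/ l) (i %% l)) witness_length.[b]%R.
have yE (v : 'I_n) k : k < l -> nth false y (v * l + k) = (k < size P) && (nth 0%R P k \in S v).
  move=> kl; rewrite nth_mkseq.
    have l0 : 0 < l by apply: leq_ltn_trans kl.
    by rewrite divnMDl // modnMDl divn_small // modn_small // addn0 memE.
  rewrite witness_lengthE !addnA; apply: leq_trans (leq_addl _ _).
  apply: leq_trans (_ : v.+1 * l <= _); first by rewrite mulSnr ltn_add2l.
  by rewrite leq_mul2r (leq_trans _ nb) ?orbT.
have [|z _] := win y; first by rewrite size_mkseq.
rewrite /verifier leading_ones_encode => /and4P[_ _ _ /implyP].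
have -> : list_check n l y.
  apply/all_iotaP => v; rewrite -(cardS v) /entry.
  rewrite (eq_big_nat _ _ (F2 := fun k => (k < size P) && (nth 0%R P k \in S v) : nat)); last first.
    by move=> k /andP[_ kl]; rewrite add0n yE.
  rewrite (@big_cat_nat _ _ _ (size P)) //= [X in _ + X]big_nat_cond [X in _ + X]big1 ?addn0; last first.
    by move=> k /andP[/andP[Pk _] _]; rewrite ltnNge Pk.
  rewrite (eq_big_nat _ _ (F2 := fun k => (nth 0%R P k \in S v) : nat)); last first.
    by move=> k /andP[_ ->].
  rewrite -(big_nth 0%R predT (fun c => (c \in S v) : nat)).
  have -> : \sum_(c <- P) (c \in S v) = size [seq c <- P | c \in S v].
    by rewrite size_filter -sum1_count [RHS]big_mkcond; apply: eq_bigr => c _; case: (c \in _).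
  apply/eqP/perm_size/uniq_perm; rewrite ?filter_uniq ?undup_uniq ?fset_uniq // => c.
  by rewrite mem_filter; case: (boolP (c \in S v)) => // /memP ->.
move=> /(_ isT)/all_iotaP ok; set col := entry z _ _ in ok.
have okv (v : 'I_n) : [/\ col v < size P, nth 0%R P (col v) \in S v &
    forall w, graph_union F1 F2 v w -> col v != col w].
  have /andP[/andP[cl]] := ok v; rewrite yE // => /andP[cP cS] /all_iotaP cE; split=> // w vw.
  by have := cE w; rewrite edge_encode vw.
exists (fun v : 'I_n => nth 0%R P (col v)); split=> [v|u v uv]; first by have [] := okv v.
have [cu _ /(_ v uv) neq] := okv u; have [cv _ _] := okv v.
by rewrite nth_uniq ?undup_uniq.
Qed.

Theorem Pi2p_member : in_Pi2p union_of_two_forests_3_choosability.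
Proof.
exists verifier, witness_length; split=> [|x]; first exact: verifier_polytime.
split=> [[n [F1 [F2 [-> f1 f2 ch]]]] y _|]; last exact: verifier_sound.
exact: verifier_complete.
Qed.

Theorem theorem1p12 : Pi2p_complete union_of_two_forests_3_choosability.
Proof. by split; [exact: Pi2p_member | exact: Pi2p_hard]. Qed.
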